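(* Let $s\in\{\tfrac12,1,\tfrac32,\dots\}$ and take $\alpha=2$ in the error measures $D_{\max}$ and $\Delta_{\max}$ defined in the context. Set $$r_{\min}(s)=\begin{cases}1/2 & s=1/2\\ 5/4 & s=1\\ \bigl(2s-\sqrt{2s+3}+3\bigr)/2 & s>1\end{cases}\qquad\text{and}\qquad \Delta_{\min}(s)^2=\begin{cases}1/6 & s=1/2\\ 3/8 & s=1\\ \bigl(s-\sqrt{2s+3}+2\bigr)/2 & s>1,\end{cases}$$ with $\Delta_{\min}(s)\ge 0$. Then for every observable $F$ with outcome space $\mathbb R^3$ on the spin-$s$ system (covariant or not) $$D_{\max}(F)\ge\Delta_{\min}(s)\quad\text{and}\quad \Delta_{\max}(F)\ge\Delta_{\min}(s).$$ Both bounds are attained at a unique covariant observable, namely the covariant observable whose parameter measure $F_n(dr)$ is the point measure at $n=s$, $r=r_{\min}(s)$, i.e. the observable given by $$\int F(d\mathbf x)\,h(\mathbf x)=(2s+1)\int dR\ U_R|s\rangle\langle s|U_R^*\ h\bigl(r_{\min}(s)\,R\boldsymbol\nu\bigr)$$ for bounded measurable $h$ on $\mathbb R^3$. Moreover, except for $s=1$, for this optimal observable the calibration error is the same for all calibration inputs $m$: the quantity $\int\langle m|F(d\boldsymbol\eta)|m\rangle\,(\mathbf e_3\cdot\boldsymbol\eta-m)^2$ does not depend on $m\in\{-s,\dots,s\}$.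
   Context: The spin-$s$ system is the irreducible $(2s+1)$-dimensional unitary representation $R\mapsto U_R$ of $SU(2)$ on $\mathcal H=\mathbb C^{2s+1}$ with angular momentum operators $\mathbf L=(L_1,L_2,L_3)$, $\hbar=1$; $|m\rangle$, $m\in\{-s,\dots,s\}$, is the orthonormal basis with $L_3|m\rangle=m|m\rangle$. $R$ also denotes the corresponding rotation of $\mathbb R^3$, $dR$ is normalized Haar measure, and $\boldsymbol\nu=\mathbf e_3$ is the north pole (unit vector along the 3-axis). An observable with outcome space $X$ is a normalized positive operator valued measure on $X$; for a state (density operator) $\rho$, $F_\rho(dx)=\operatorname{tr}\rho F(dx)$ is its output distribution. For an observable $F$ on $\mathbb R^3$ and a unit vector $\mathbf e$, the marginal $F^{\mathbf e}$ is the observable on $\mathbb R$ obtained as the image of $F$ under $\boldsymbol\eta\mapsto\mathbf e\cdot\boldsymbol\eta$. $E^{\mathbf e}$ denotes the spectral measure of $\mathbf e\cdot\mathbf L=\sum_je_jL_j$. For probability measures $\mu,\nu$ on $\mathbb R$ let $D_2(\mu,\nu)=\inf_\gamma\bigl(\int\gamma(dx\,dy)\,|x-y|^2\bigr)^{1/2}$, the infimum being over all couplings $\gamma$ (probability measures on $\mathbb R\times\mathbb R$ with marginals $\mu$ and $\nu$). For observables $F,E$ on $\mathbb R$ the metric error is $D_2(F,E)=\sup_\rho D_2(F_\rho,E_\rho)$, and the calibration error is $\Delta_2^c(F,E)=\lim_{\varepsilon\to0}\sup\{D_2(F_\rho,\delta_x)\,|\,\rho \text{ a state},\,x\in\mathbb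 R,\ D_2(E_\rho,\delta_x)\le\varepsilon\}$, where $\delta_x$ is the point measure at $x$. For an observable $F$ on $\mathbb R^3$ set $D_{\max}(F)=\sup_{\mathbf e}D_2(F^{\mathbf e},E^{\mathbf e})$ and $\Delta_{\max}(F)=\sup_{\mathbf e}\Delta_2^c(F^{\mathbf e},E^{\mathbf e})$, over unit vectors $\mathbf e\in\mathbb R^3$ (values in $[0,\infty]$). An observable $F$ on $\mathbb R^3$ is covariant if $U_R F(R^{-1}S)U_R^*=F(S)$ for all rotations $R$ and Borel sets $S\subset\mathbb R^3$. Covariant observables are parameterized by probability measures $F_n(dr)$ on $\{-s,\dots,s\}\times\mathbb R_+$ through $$\int F(d\mathbf x)h(\mathbf x)=\sum_n\int F_n(dr)\,(2s+1)\int dR\ U_R|n\rangle\langle n|U_R^*\ h(r\,R\boldsymbol\nu).$$ *)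

(* Defs.v *)
From HB Require Import structures.
From mathcomp Require Import all_boot all_order all_algebra.
From mathcomp Require Import complex ring.
From mathcomp Require Import all_classical all_reals all_analysis measurable_realfun.
Import Order.TTheory GRing.Theory Num.Theory.
Import numFieldNormedType.Exports.

Set Implicit Arguments.
Unset Strict Implicit.
Unset Printing Implicit Defensive.

Local Open Scope classical_set_scope.
Local Open Scope ring_scope.
Local Open Scope complex_scope.
Local Open Scope sesquilinear_scope.

Section Quantum.
Variables (R : realType) (n : nat).
Implicit Types A : 'M[R[i]]_n.

Definition psd A :=
  A^t* = A /\ forall v : 'cV[R[i]]_n, 0 <= (v^t* *m A *m v) 0 0.

Record state := State {
  density :> 'M[R[i]]_n ;
  density_psd : psd density ;
  density_tr : \tr density = 1 }.

Lemma trC_mul (m p q : nat) (M : 'M[R[i]]_(m, p)) (N : 'M[R[i]]_(p, q)) :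
  (M *m N)^t* = N^t* *m M^t*.
Proof. by rewrite trmx_mul map_mxM. Qed.

Lemma psd_proj (v : 'cV[R[i]]_n) : psd (v *m v^t*).
Proof.
split=> [|w]; first by rewrite trC_mul trmxCK.
rewrite mulmxA -mulmxA mxE big_ord1.
have -> : (v^t* *m w) 0 0 = ((w^t* *m v) 0 0)^*.
  by rewrite -[v^t* *m w]trmxCK trC_mul trmxCK !mxE.
exact: mul_conjC_ge0.
Qed.

Definition pure_state (v : 'cV[R[i]]_n) (v1 : v^t* *m v = 1%:M) : state.
Proof.
refine (@State (v *m v^t*) (psd_proj v) _).
by rewrite mxtrace_mulC v1 mxtrace1.
Defined.

Section Observable.
Context {d} (X : measurableType d).

(** [F A] for non-measurable [A] is junk (still required to be positive, as the
    library does for measures); countable additivity is in the weak sense. *)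
Record observable := Observable {
  povm :> set X -> 'M[R[i]]_n ;
  povm_psd : forall S, psd (povm S) ;
  povm_set0 : povm set0 = 0 ;
  povm_setT : povm setT = 1%:M ;
  povm_sigma_additive : forall v : 'cV[R[i]]_n,
    semi_sigma_additive
      (fun S => (complex.Re ((v^t* *m povm S *m v) 0 0))%:E) }.

Definition observable_eq (F G : observable) :=
  forall S, measurable S -> F S = G S.

Definition outfun (F : observable) (rho : state) (S : set X) : \bar R :=
  (complex.Re (\tr (rho *m F S)))%:E.

Definition vecfun (F : observable) (v : 'cV[R[i]]_n) (S : set X) : \bar R :=
  (complex.Re ((v^t* *m F S *m v) 0 0))%:E.

Section VecMeasure.
Variables (F : observable) (v : 'cV[R[i]]_n).

Let vecfun_ge0 S : (0 <= vecfun F v S)%E.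
Proof.
rewrite lee_fin; have := (povm_psd F S).2 v.
by rewrite lecE => /andP[].
Qed.

Let vecfun_sigma_additive : semi_sigma_additive (vecfun F v).
Proof. exact: povm_sigma_additive. Qed.

Let vecfun0 : vecfun F v set0 = 0%E.
Proof. by rewrite /vecfun povm_set0 mulmx0 mul0mx mxE. Qed.

HB.instance Definition _ := isMeasure.Build _ _ _ (vecfun F v)
  vecfun0 vecfun_ge0 vecfun_sigma_additive.

End VecMeasure.

Section OutMeasure.
Variables (F : observable) (rho : state).

Let P := spectralmx rho.
Let w i : 'cV[R[i]]_n := (row i P)^t*.

Let wE (M : 'M[R[i]]_n) i : ((w i)^t* *m M *m w i) 0 0 = (P *m M *m P^t*) i i.
Proof.
rewrite /w trmxCK -row_mul -[RHS](mxE tt (fun a b => (P *m M *m P^t*) a b)).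
by rewrite !mxE; apply: eq_bigr => k _; rewrite !mxE.
Qed.

Let rhoE : density rho = P^t* *m diag_mx (spectral_diag rho) *m P.
Proof.
rewrite -invmx_unitary ?spectral_unitarymx //.
by apply/orthomx_spectralP/normalmxP; rewrite (density_psd rho).1.
Qed.

Let PPt : P *m P^t* = 1%:M.
Proof. exact/unitarymxP/spectral_unitarymx. Qed.

Let q_ge0 i : 0 <= spectral_diag rho 0 i.
Proof.
suff <- : ((w i)^t* *m rho *m w i) 0 0 = spectral_diag rho 0 i.
  exact: (density_psd rho).2.
rewrite wE; have /(congr1 (fun M => (P *m M *m P^t*) i i)) := rhoE => ->.
by rewrite !mulmxA PPt mul1mx -mulmxA PPt mulmx1 mxE eqxx mulr1n.
Qed.

Let q (i : 'I_n) : {nonneg R}.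
Proof.
refine (@NngNum _ (complex.Re (spectral_diag rho 0 i)) _).
by have := q_ge0 i; rewrite lecE => /andP[].
Defined.

Let qE i : ((q i)%:num)%:C = spectral_diag rho 0 i.
Proof. exact/RRe_real/ger0_real. Qed.

Let m (k : nat) : {measure set X -> \bar R} :=
  if insub k is Some i then mscale (q i) (vecfun F (w i)) else mzero.

Let outfunE : outfun F rho = msum m n.
Proof.
apply/funext => S; rewrite /outfun /msum.
have -> : \tr (rho *m F S)
   = \sum_(i < n) ((q i)%:num)%:C * ((w i)^t* *m F S *m w i) 0 0.
  have /(congr1 (fun M => \tr (M *m F S))) := rhoE => ->.
  rewrite -!mulmxA mxtrace_mulC -!mulmxA /mxtrace; apply: eq_bigr => i _.
  by rewrite mul_diag_mx mxE qE wE mulmxA.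
rewrite (raddf_sum (@complex.Re R : {additive _ -> _})) -sumEFin.
apply: eq_bigr => i _; rewrite /m valK /=.
by rewrite /mscale /vecfun -EFinM; case: (_ 0 0) => a b /=; rewrite mul0r subr0.
Qed.

Let outfun_ge0 S : (0 <= outfun F rho S)%E.
Proof. by rewrite outfunE. Qed.

Let outfun0 : outfun F rho set0 = 0%E.
Proof. by rewrite outfunE measure0. Qed.

Let outfun_sigma_additive : semi_sigma_additive (outfun F rho).
Proof. by rewrite outfunE; exact: measure_semi_sigma_additive. Qed.

HB.instance Definition _ := isMeasure.Build _ _ _ (outfun F rho)
  outfun0 outfun_ge0 outfun_sigma_additive.

Let outfun_setT : outfun F rho setT = 1%E.
Proof. by rewrite /outfun povm_setT mulmx1 density_tr. Qed.

HB.instance Definition _ := Measure_isProbability.Build _ _ _ (outfun F rho)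
  outfun_setT.

Definition outdist : probability X R := outfun F rho.

End OutMeasure.
End Observable.

Section Image.
Context {d d'} {X : measurableType d} {Y : measurableType d'}.
Variables (F : observable X) (f : X -> Y) (mf : measurable_fun setT f).

Let mpre S : measurable S -> measurable (f @^-1` S).
Proof. by move=> mS; rewrite -[_ @^-1` _]setTI; exact: mf. Qed.

Let image_sigma_additive (v : 'cV[R[i]]_n) : semi_sigma_additive
  (fun S => (complex.Re ((v^t* *m F (f @^-1` S) *m v) 0 0))%:E).
Proof.
move=> S mS tS mUS; rewrite preimage_bigcup.
apply: (@povm_sigma_additive _ _ F v (fun k => f @^-1` S k)).
- by move=> k; exact: mpre.
- by apply/trivIsetP => i j _ _ ij; rewrite -preimage_setI;
    move/trivIsetP : tS => /(_ i j Logic.I Logic.I ij) ->; rewrite preimage_set0.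
- by rewrite -preimage_bigcup; exact: mpre.
Qed.

Definition image_observable : observable Y :=
  @Observable _ Y (fun S => F (f @^-1` S)) (fun S => povm_psd F _)
    (povm_set0 F) (povm_setT F) image_sigma_additive.

End Image.

Section Spectral.
Variable H : 'M[R[i]]_n.

Definition spectral_projection (S : set R) : 'M[R[i]]_n :=
  (spectralmx H)^t*
  *m diag_mx (\row_i (\1_S (complex.Re (spectral_diag H 0 i)))%:C)
  *m spectralmx H.

Let spE S (v : 'cV[R[i]]_n) : (v^t* *m spectral_projection S *m v) 0 0 =
  \sum_i ((\1_S (complex.Re (spectral_diag H 0 i)))%:C
     * `|(spectralmx H *m v) i 0| ^+ 2).
Proof.
rewrite /spectral_projection; set D := diag_mx _; set u := spectralmx H *m v.
have -> : v^t* *m ((spectralmx H)^t* *m D *m spectralmx H) *m v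
    = u^t* *m (D *m u) by rewrite /u trC_mul !mulmxA.
rewrite mul_diag_mx mxE; apply: eq_bigr => i _; rewrite !mxE normCK.
by rewrite mulrCA; congr (_ * _); rewrite mulrC.
Qed.

Let sp_psd S : psd (spectral_projection S).
Proof.
split=> [|v].
  rewrite /spectral_projection !trC_mul trmxCK mulmxA; congr (_ *m _ *m _).
  rewrite tr_diag_mx map_diag_mx; congr (diag_mx _).
  by apply/rowP => i; rewrite !mxE; exact: conjc_real.
rewrite spE sumr_ge0 // => i _.
by rewrite mulr_ge0 ?exprn_ge0 // ler0c.
Qed.

Let sp0 : spectral_projection set0 = 0.
Proof.
rewrite /spectral_projection [X in diag_mx X](_ : _ = 0).
  by rewrite raddf0 mulmx0 mul0mx.
by apply/rowP => i; rewrite !mxE indic0.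
Qed.

Let spT : spectral_projection setT = 1%:M.
Proof.
rewrite /spectral_projection [X in diag_mx X](_ : _ = const_mx 1).
  rewrite diag_const_mx mulmx1 -invmx_unitary ?spectral_unitarymx //.
  by rewrite mulVmx ?spectral_unit.
by apply/rowP => i; rewrite !mxE indicT.
Qed.

Let sp_sigma_additive (v : 'cV[R[i]]_n) : semi_sigma_additive
  (fun S => (complex.Re ((v^t* *m spectral_projection S *m v) 0 0))%:E).
Proof.
have q0 i : 0 <= complex.Re (`|(spectralmx H *m v) i 0| ^+ 2).
  have : 0 <= `|(spectralmx H *m v) i 0| ^+ 2 by rewrite exprn_ge0.
  by rewrite lecE => /andP[].
pose m (k : nat) : {measure set R -> \bar R} :=
  if insub k is Some i
  then mscale (NngNum (q0 i)) (\d_(complex.Re (spectral_diag H 0 i))) else mzero.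
rewrite (_ : (fun S => _) = msum m n); first exact: measure_semi_sigma_additive.
apply/funext => S; rewrite spE /msum.
rewrite (raddf_sum (@complex.Re R : {additive _ -> _})) -sumEFin.
apply: eq_bigr => i _; rewrite /m valK /= /mscale /= diracE -EFinM indicE.
by rewrite !mul0r !subr0 mulrC.
Qed.

(** The spectral measure of a Hermitian [H], i.e. [S |-> \1_S(H)]; the
    eigenvalues [spectral_diag H] are then real. *)
Definition spectral_measure : observable R :=
  Observable sp_psd sp0 spT sp_sigma_additive.

End Spectral.
End Quantum.

Section Distances.
Local Open Scope ereal_scope.
Variable R : realType.

Definition couplings (mu nu : probability R R) :
    set (probability (R * R)%type R) :=
  [set gamma | forall S, measurable S ->
     gamma (S `*` setT) = mu S /\ gamma (setT `*` S) = nu S].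

Definition D2 (mu nu : probability R R) : \bar R :=
  ereal_inf [set Lnorm gamma 2%:E (fun z : R * R => (z.1 - z.2)%:E)
            | gamma in couplings mu nu].

Variable n : nat.
Implicit Types F E : observable R n R.

Definition metric_error F E : \bar R :=
  ereal_sup (range (fun rho : state R n => D2 (outdist F rho) (outdist E rho))).

Definition calibrated (E : observable R n R) (eps : R) : set (state R n * R) :=
  [set p | D2 (outdist E p.1) \d_(p.2) <= eps%:E].

Definition calibration_error F E : \bar R :=
  lim (ereal_sup [set D2 (outdist F p.1) \d_(p.2) | p in calibrated E eps]
       @[eps --> 0^'+]).

End Distances.

Section R3.
Variable R : realType.

Implicit Types e x : 3.-tuple R.

Definition dot e x : R := \sum_(j < 3) tnth e j * tnth x j.
Definition unit_vector e := dot e e = 1.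
Definition scale3 (r : R) x : 3.-tuple R := [tuple r * tnth x j | j < 3].
Definition north : 3.-tuple R := [tuple (j == ord_max)%:R | j < 3].

Lemma measurable_dot e : measurable_fun setT (dot e).
Proof.
apply: measurable_sum => j; apply: measurable_funM => //.
exact: measurable_tnth.
Qed.

Definition marginal n (F : observable R n (3.-tuple R)) e : observable R n R :=
  image_observable F (measurable_dot e).

End R3.

Section SU2.
Variable R : realType.

Record su2 := Su2 {
  su2mx :> 'M[R[i]]_2 ;
  su2_unitary : su2mx \is unitarymx ;
  su2_det : \det su2mx = 1 }.

Lemma su2_one_unitary : (1%:M : 'M[R[i]]_2) \is unitarymx.
Proof. by apply/unitarymxP; rewrite trmx1 map_mx1 mulmx1. Qed.

Definition su2_one : su2 := Su2 su2_one_unitary (det1 _ _).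

Lemma su2_mul_det (g h : su2) : \det (su2mx g *m su2mx h) = 1.
Proof. by rewrite det_mulmx !su2_det mulr1. Qed.

Definition su2_mul (g h : su2) : su2 :=
  Su2 (mul_unitarymx (su2_unitary g) (su2_unitary h)) (su2_mul_det g h).

HB.instance Definition _ := gen_eqMixin su2.
HB.instance Definition _ := gen_choiceMixin su2.
HB.instance Definition _ := isPointed.Build su2 su2_one.

(** An element of SU(2) is determined by its first row [(a, b)], the second
    one being [(- b^*, a^* )], so these coordinates generate the Borel sets. *)
Definition su2_coord (g : su2) : 4.-tuple R :=
  [tuple complex.Re (g 0 0); complex.Im (g 0 0);
         complex.Re (g 0 1); complex.Im (g 0 1)].

Definition SU2 := g_sigma_algebra_preimageType su2_coord.

Definition haar_measure (mu : probability SU2 R) :=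
  forall (g : su2) (S : set SU2), measurable S ->
    mu ((fun h : su2 => su2_mul g h) @^-1` S) = mu S.

Definition mx2 (a b c d : R[i]) : 'M[R[i]]_2 :=
  \matrix_(i, j) if i == 0 then (if j == 0 then a else b)
                 else (if j == 0 then c else d).

Definition pauli (j : 'I_3) : 'M[R[i]]_2 :=
  nth 0 [:: mx2 0 1 1 0; mx2 0 (- 'i) 'i 0; mx2 1 0 0 (- 1)] j.

(** [g (x . sigma) g^* = (rotation g x) . sigma] *)
Definition rotation_mx (g : su2) : 'M[R]_3 :=
  \matrix_(j, k) (complex.Re (\tr (pauli j *m g *m pauli k *m g^t*)) / 2).

Definition rotation (g : su2) (x : 3.-tuple R) : 3.-tuple R :=
  [tuple \sum_(k < 3) rotation_mx g j k * tnth x k | j < 3].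

Definition vdot m (e : 3.-tuple R) (A : 'I_3 -> 'M[R[i]]_m) : 'M[R[i]]_m :=
  \sum_(j < 3) (tnth e j)%:C *: A j.

(** [exp (- i t (e . sigma) / 2)] for a unit vector [e] *)
Definition axis_mx (e : 3.-tuple R) (t : R) : 'M[R[i]]_2 :=
  (cos (t / 2))%:C%:M - ('i * (sin (t / 2))%:C) *: vdot e pauli.

Lemma sum3 (V : nmodType) (f : 'I_3 -> V) :
  \sum_(j < 3) f j = f (inord 0) + f (inord 1) + f (inord 2).
Proof.
rewrite !big_ord_recl big_ord0 addr0 addrA; congr (f _ + f _ + f _);
by apply/val_inj; rewrite /= inordK.
Qed.

Lemma axis_mxE e t : axis_mx e t =
  mx2 (cos (t / 2) -i* (sin (t / 2) * tnth e (inord 2)))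
      ((- (sin (t / 2) * tnth e (inord 1))) -i* (sin (t / 2) * tnth e (inord 0)))
      ((sin (t / 2) * tnth e (inord 1)) -i* (sin (t / 2) * tnth e (inord 0)))
      (cos (t / 2) +i* (sin (t / 2) * tnth e (inord 2))).
Proof.
rewrite /axis_mx /vdot sum3 /pauli !inordK //=.
apply/matrixP => i j; rewrite !mxE.
case: i => [[|[|//]] ?]; case: j => [[|[|//]] ?] /=; simpc; apply/eqP;
  rewrite eq_complex /=; apply/andP; split; apply/eqP; ring.
Qed.

Section Axis.
Variables (e : 3.-tuple R) (t : R) (e1 : unit_vector e).

Let key : cos (t / 2) ^+ 2 + sin (t / 2) ^+ 2 * (tnth e (inord 0) ^+ 2
  + tnth e (inord 1) ^+ 2 + tnth e (inord 2) ^+ 2) = 1.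
Proof.
move: e1; rewrite /unit_vector /dot sum3.
by rewrite -!expr2 => ->; rewrite mulr1 cos2Dsin2.
Qed.

Lemma axis_mx_unitary : axis_mx e t \is unitarymx.
Proof.
apply/unitarymxP/matrixP => i j; rewrite axis_mxE !mxE !big_ord_recl big_ord0 !mxE.
move: key; set c := cos _; set s := sin _; set x := tnth e _; set y := tnth e _.
set z := tnth e _ => k.
case: i => [[|[|//]] ?]; case: j => [[|[|//]] ?] /=; apply/eqP;
  rewrite eq_complex /=; apply/andP; split; apply/eqP; rewrite -?k; ring.
Qed.

Lemma axis_mx_det : \det (axis_mx e t) = 1.
Proof.
rewrite axis_mxE (expand_det_row _ 0) !big_ord_recl big_ord0 /cofactor !det_mx11 !mxE /= ?addn0 ?add0n ?expr0 ?expr1 ?mul1r ?addr0 mulN1r.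
move: key; set c := cos _; set s := sin _; set x := tnth e _; set y := tnth e _.
set z := tnth e _ => k.
apply/eqP; rewrite eq_complex /=; apply/andP; split; apply/eqP; rewrite -?k; ring.
Qed.

Definition axis_rotation : su2 := Su2 axis_mx_unitary axis_mx_det.

End Axis.
End SU2.

Section Spin.
Variable R : realType.

Definition spin (N : nat) : R := N%:R / 2.

(** [m] runs through [-s, ..., s], [s = N / 2], as [j] runs through ['I_N.+1];
    [j = ord_max] is [m = s]. *)
Definition magnetic N (j : 'I_N.+1) : R := j%:R - spin N.

(** An irreducible unitary representation [rep] of SU(2) of dimension [N.+1],
    with its angular momentum operators [angmom] and an orthonormal eigenbasis
    [ket] of [L_3 = angmom ord_max]. [rep_irreducible]: as [stablemx] acts on
    row vectors, [W] stable by [(rep g)^T] is an invariant subspace.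
    [rep_generator] says that [e . L] is the generator of the rotations about [e]:
    [rep (exp (- i t (e . sigma) / 2)) = exp (- i t (e . L))]. *)
Record spin_system (N : nat) := SpinSystem {
  rep : su2 R -> 'M[R[i]]_N.+1 ;
  angmom : 'I_3 -> 'M[R[i]]_N.+1 ;
  ket : 'I_N.+1 -> 'cV[R[i]]_N.+1 ;
  rep_unitary : forall g, rep g \is unitarymx ;
  rep_mul : forall g h, rep (su2_mul g h) = rep g *m rep h ;
  rep_continuous : forall (g : su2 R) (eps : R), 0 < eps ->
    exists2 delta : R, 0 < delta & forall h : su2 R,
      (forall i j, `|h i j - g i j| < delta%:C) ->
      forall i j, `|rep h i j - rep g i j| < eps%:C ;
  rep_irreducible : forall W : 'M[R[i]]_N.+1,
    (forall g, stablemx W (rep g)^T) -> W = 0 \/ row_full W ;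
  rep_generator : forall (e : 3.-tuple R) (e1 : unit_vector e) i j,
    is_derive (0 : R) (1 : R)
      (fun t : R => complex.Re (rep (axis_rotation t e1) i j))
      (complex.Re ((- 'i *: vdot e angmom) i j)) /\
    is_derive (0 : R) (1 : R)
      (fun t : R => complex.Im (rep (axis_rotation t e1) i j))
      (complex.Im ((- 'i *: vdot e angmom) i j)) ;
  ket_orthonormal : forall i j, (ket i)^t* *m ket j = ((i == j)%:R)%:M ;
  ket_eigen : forall j,
    angmom ord_max *m ket j = (magnetic j)%:C *: ket j }.

Variables (N : nat) (Q : spin_system N).

Lemma ket_norm j : (ket Q j)^t* *m ket Q j = 1%:M.
Proof. by rewrite ket_orthonormal eqxx. Qed.

Definition ket_state j : state R N.+1 := pure_state (ket_norm j).

Implicit Types F : observable R N.+1 (3.-tuple R).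

Definition D_max F : \bar R :=
  ereal_sup [set metric_error (marginal F e) (spectral_measure (vdot e (angmom Q)))
            | e in @unit_vector R].

Definition Delta_max F : \bar R :=
  ereal_sup [set calibration_error (marginal F e)
                   (spectral_measure (vdot e (angmom Q)))
            | e in @unit_vector R].

Definition covariant F :=
  forall (g : su2 R) (S : set (3.-tuple R)), measurable S ->
    rep Q g *m F (rotation g @^-1` S) *m (rep Q g)^t* = F S.

(** [F] is the covariant observable whose parameter measure is the point mass
    at [(n, r)]; the operator identity is tested on all states. *)
Definition point_covariant (haar : probability (SU2 R) R) F (n : 'I_N.+1)
    (r : R) :=
  forall (rho : state R N.+1) (h : 3.-tuple R -> R),
    measurable_fun setT h -> (exists M, forall x, `|h x| <= M) ->
    \int[outdist F rho]_x h x =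
      N.+1%:R * \int[haar]_g
        (complex.Re (\tr (rho *m (rep Q g *m (ket Q n *m (ket Q n)^t*)
                                   *m (rep Q g)^t*)))
         * h (scale3 r (rotation g (north R)))).

Definition calibration_moment F (j : 'I_N.+1) : \bar R :=
  (\int[outdist F (ket_state j)]_x ((dot (north R) x - magnetic j) ^+ 2)%:E)%E.

Definition r_min : R :=
  if N == 1%N then 1 / 2
  else if N == 2%N then 5 / 4
  else (2 * spin N - Num.sqrt (2 * spin N + 3) + 3) / 2.

Definition Delta_min_sq : R :=
  if N == 1%N then 1 / 6
  else if N == 2%N then 3 / 8
  else (spin N - Num.sqrt (2 * spin N + 3) + 2) / 2.

Definition Delta_min : R := Num.sqrt Delta_min_sq.

End Spin.

(* Main.v *)
Require Import Defs.
From HB Require Import structures.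
From mathcomp Require Import all_boot all_order all_algebra.
From mathcomp Require Import complex ring lra.
From mathcomp Require Import all_classical all_reals all_analysis measurable_realfun.
Import Order.TTheory GRing.Theory Num.Theory.
Import numFieldNormedType.Exports.

Set Implicit Arguments.
Unset Strict Implicit.
Unset Printing Implicit Defensive.

Local Open Scope classical_set_scope.
Local Open Scope ring_scope.
Local Open Scope complex_scope.
Local Open Scope sesquilinear_scope.

(** Lower bound. For an arbitrary observable [F] let $\mu$ be its output law in the maximally mixed
    state. Each $\langle v|F|v\rangle$ is absolutely continuous with respect to $\mu$, so [F] has a
    positive operator density [D] of trace $2s+1$ ([operator_density]). The vector $U_k|m\rangle$ is
    an eigenvector of $\mathbf e\cdot\mathbf L$ for $\mathbf e=k\nu$, hence an exact calibration
    input, and $\Delta_{\max}(F)^2$ bounds its mean square error ([cal_le_Delta_max]). It then also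
    bounds the Haar average of these errors over [k], and every mixture of such averages over [m].
    By Tonelli the average is the $\mu$-integral of a function of the outcome alone. For
    $x=r\,k\nu$, left invariance writes this function as a convex combination over [n], weighted by
    the normalised diagonal of $D(x)$ in the frame [k], of $e(m,n,r)=(2s+1)\int|\langle
    n|U_g|m\rangle|^2(rR_{33}-m)^2dg$ ([int_local_error], [mean_error_bound]).

    Computing $e$. The averages of $U_g|m\rangle\langle m|U_g^*$ weighted by monomials of degree 0,
    1, 2 in the components of $g\nu$ are scalar, vector and symmetric tensor operators. Schur's
    lemma and the Wigner-Eckart theorem ([commutant], [vector_op_proportional],
    [tensor_op_quadratic]) leave at most two unknown coefficients in each, which are found from
    traces ([int_trans0], [int_trans1], [int_trans2]).

    Minimising. $e$ is affine in $m^2$, so mixing the inputs $m=s$ and the smallest $|m|$ replaces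
    $m^2$ by an intermediate value $q$. For the least favourable $q$ the minimum over $n$ and
    $r\ge0$ is $\Delta_{\min}^2$, reached only at $n=s$, $r=r_{\min}$ ([weighted_error]). For $s>1$
    this is a saddle point: $e(m,s,r_{\min})$ does not depend on $m$, and $q$ makes $r_{\min}$ the
    minimiser in $r$. For $s=1$ the saddle value of $q$ exceeds $s^2$ and all weight goes to $m=s$;
    for $s=1/2$ there is only one value of $m^2$.

    Attainment. The effects of the marginal along $\mathbf e$ of the coherent-state observable are
    diagonal in the eigenbasis of $\mathbf e\cdot\mathbf L$. Hence in any state the outputs of the
    marginal and of $E^{\mathbf e}$ are mixtures with equal weights, and coupling each component
    with its eigenvalue gives $D_2^2\le\max_m e(m,s,r_{\min})=\Delta_{\min}^2$
    ([metric_error_coherent]). As $\Delta_{\max}\le D_{\max}$, both bounds are attained.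

    Uniqueness. Equality forces, for $\mu$-almost every $x$, both $|x|=r_{\min}$ and
    $D(x)=(2s+1)U_k|s\rangle\langle s|U_k^*$ with $k\nu$ the direction of $x$. Covariance makes
    $\mu$ the invariant law on that sphere ([covariant_law]), so [F] is determined
    ([optimal_unique]). *)

(** * Unit quaternions as coordinates on SU(2), and the rotation matrices they induce *)

Section Quaternions.
Variable R : realType.
Implicit Types (g h : su2 R) (v e : 3.-tuple R).

Definition o0 : 'I_3 := @Ordinal 3 0 isT.
Definition o1 : 'I_3 := @Ordinal 3 1 isT.
Definition o2 : 'I_3 := @Ordinal 3 2 isT.

Lemma sumI3 (V : nmodType) (f : 'I_3 -> V) :
  \sum_(j < 3) f j = f o0 + f o1 + f o2.
Proof.
rewrite !big_ord_recl big_ord0 addr0 addrA; congr (f _ + f _ + f _);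
by apply/val_inj.
Qed.

Lemma I3_ind (P : 'I_3 -> Prop) : P o0 -> P o1 -> P o2 -> forall j, P j.
Proof.
move=> P0 P1 P2 [[|[|[|//]]] lt].
- by rewrite (_ : Ordinal lt = o0) //; apply/val_inj.
- by rewrite (_ : Ordinal lt = o1) //; apply/val_inj.
- by rewrite (_ : Ordinal lt = o2) //; apply/val_inj.
Qed.

Lemma ord_max3 : ord_max = o2 :> 'I_3.
Proof. exact/val_inj. Qed.

(** The quaternion [a + i (x s1 + y s2 + z s3)], [s1], [s2], [s3] the Pauli
    matrices. *)
Definition qmx (a x y z : R) : 'M[R[i]]_2 :=
  mx2 (a +i* z) (y +i* x) (- y +i* x) (a -i* z).

Lemma complex_eq (u w : R[i]) :
  complex.Re u = complex.Re w -> complex.Im u = complex.Im w -> u = w.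
Proof. by case: u w => [a b] [c d] /= -> ->. Qed.

Lemma sum_ord2 (V : nmodType) (f : 'I_2 -> V) : \sum_(j < 2) f j = f 0 + f 1.
Proof. by rewrite !big_ord_recl big_ord0 addr0; congr (_ + f _); apply/val_inj. Qed.

Lemma mx2_eq (A B : 'M[R[i]]_2) : A 0 0 = B 0 0 -> A 0 1 = B 0 1 ->
  A 1 0 = B 1 0 -> A 1 1 = B 1 1 -> A = B.
Proof.
move=> h1 h2 h3 h4; apply/matrixP => i j.
have P (k : 'I_2) : k = 0 \/ k = 1.
  by case: k => [[|[|//]] lt]; [left|right]; apply/val_inj.
by case: (P i) => ->; case: (P j) => ->.
Qed.

Lemma qmx_mul a x y z a' x' y' z' :
  qmx a x y z *m qmx a' x' y' z' =
  qmx (a * a' - x * x' - y * y' - z * z')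
      (a * x' + a' * x - y * z' + z * y')
      (a * y' + a' * y - z * x' + x * z')
      (a * z' + a' * z - x * y' + y * x').
Proof.
by apply: mx2_eq; rewrite !mxE !sum_ord2 !mxE /=; simpc;
  apply: complex_eq => /=; ring.
Qed.

Lemma qmx_tC a x y z : (qmx a x y z)^t* = qmx a (- x) (- y) (- z).
Proof.
by apply: mx2_eq; rewrite !mxE /=; apply: complex_eq => /=; ring.
Qed.

Lemma qmx_id : qmx 1 0 0 0 = 1%:M.
Proof.
by apply: mx2_eq; rewrite !mxE /=; apply: complex_eq => /=; ring.
Qed.

Lemma qmx_unitary a x y z : a ^+ 2 + x ^+ 2 + y ^+ 2 + z ^+ 2 = 1 ->
  qmx a x y z \is unitarymx.
Proof.
move=> h; apply/unitarymxP; rewrite qmx_tC qmx_mul -qmx_id.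
by congr qmx; rewrite -?h; ring.
Qed.

Lemma det_mx2 (A : 'M[R[i]]_2) : \det A = A 0 0 * A 1 1 - A 0 1 * A 1 0.
Proof.
rewrite (expand_det_row _ 0) sum_ord2 /cofactor !det_mx11 !mxE /=.
rewrite /= ?addn0 ?add0n ?expr0 ?expr1 mul1r mulN1r mulrN.
by congr (_ * A _ _ - _ * A _ _); apply/val_inj.
Qed.

Lemma adj_mx2 (A : 'M[R[i]]_2) :
  \adj A = mx2 (A 1 1) (- A 0 1) (- A 1 0) (A 0 0).
Proof.
apply: mx2_eq; rewrite /mx2 !mxE /cofactor !det_mx11 !mxE /=.
- by rewrite addn0 expr0 mul1r; congr (A _ _); apply/val_inj.
- by rewrite addn0 expr1 mulN1r; congr (- A _ _); apply/val_inj.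
- by rewrite add0n expr1 mulN1r; congr (- A _ _); apply/val_inj.
- by rewrite sqrrN expr1n mul1r; congr (A _ _); apply/val_inj.
Qed.

Lemma qmx_det a x y z : a ^+ 2 + x ^+ 2 + y ^+ 2 + z ^+ 2 = 1 ->
  \det (qmx a x y z) = 1.
Proof.
by move=> h; rewrite det_mx2 !mxE /=; apply: complex_eq => /=; rewrite -?h; ring.
Qed.

Definition mkq a x y z (h : a ^+ 2 + x ^+ 2 + y ^+ 2 + z ^+ 2 = 1) : su2 R :=
  Su2 (qmx_unitary h) (qmx_det h).

Lemma su2_inj g h : su2mx g = su2mx h -> g = h.
Proof.
case: g h => [A uA dA] [B uB dB] /= AB; subst B.
by congr Su2; [exact: bool_irrelevance|exact: eq_irrelevance].
Qed.

(** As the determinant is 1, the inverse [g^t*] is also the adjugate; comparing entries forces the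
    second row to be $(-\bar b,\bar a)$. *)
Lemma su2P g : let a := complex.Re (g 0 0) in let z := complex.Im (g 0 0) in
  let y := complex.Re (g 0 1) in let x := complex.Im (g 0 1) in
  su2mx g = qmx a x y z /\ a ^+ 2 + x ^+ 2 + y ^+ 2 + z ^+ 2 = 1.
Proof.
move=> a z y x.
have gE : (su2mx g)^t* = \adj (su2mx g).
  have /unitarymxP U := su2_unitary g.
  have := mul_mx_adj (su2mx g); rewrite su2_det => V.
  by rewrite -[LHS]mulmx1 -V mulmxA (mulmx1C U) mul1mx.
have h10 : g 1 0 = - (g 0 1)^*.
  have /(congr1 (fun M : 'M[R[i]]_2 => M 1 0)) := gE; rewrite adj_mx2 !mxE /= => h.
  by rewrite -[LHS]opprK -h.
have h11 : g 1 1 = (g 0 0)^*.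
  by have /(congr1 (fun M : 'M[R[i]]_2 => M 0 0)) := gE; rewrite adj_mx2 !mxE /= => /esym.
have gq : su2mx g = qmx a x y z.
  apply: mx2_eq; rewrite /qmx ?mxE /= ?h10 ?h11 /a /x /y /z;
  by case: (g 0 0) => ? ?; case: (g 0 1) => ? ?; apply: complex_eq; rewrite /= ?oppr0 ?opprK.
split=> //.
have := su2_det g; rewrite gq det_mx2 !mxE /= => /(congr1 (@complex.Re R)) /= <-.
ring.
Qed.

Lemma su2_ex g : exists a x y z,
  su2mx g = qmx a x y z /\ a ^+ 2 + x ^+ 2 + y ^+ 2 + z ^+ 2 = 1.
Proof. by have := su2P g; do 4 eexists; eassumption. Qed.

(** The Euler-Rodrigues matrix. As [qmx] carries $+i(x,y,z)\cdot\sigma$, the terms linear in [a]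
    have the sign opposite to the usual one. *)
Definition rotq a x y z (j k : 'I_3) : R :=
  nth 0 (nth [::] [::
   [:: a ^+ 2 + x ^+ 2 - y ^+ 2 - z ^+ 2; 2 * (x * y + a * z); 2 * (x * z - a * y)];
   [:: 2 * (x * y - a * z); a ^+ 2 - x ^+ 2 + y ^+ 2 - z ^+ 2; 2 * (y * z + a * x)];
   [:: 2 * (x * z + a * y); 2 * (y * z - a * x); a ^+ 2 - x ^+ 2 - y ^+ 2 + z ^+ 2]]
   j) k.

Lemma pauliE (j : 'I_3) : pauli R j =
  - 'i *: qmx (0 : R) (j == o0)%:R (j == o1)%:R (j == o2)%:R.
Proof.
by move: j; apply: I3_ind; apply: mx2_eq; rewrite !mxE /=; simpc.
Qed.

Lemma tr_qmx a x y z : \tr (qmx a x y z) = (2 * a)%:C.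
Proof. by rewrite /mxtrace sum_ord2 !mxE /=; apply: complex_eq => /=; ring. Qed.

Lemma rotation_mxE g a x y z : su2mx g = qmx a x y z ->
  forall j k, rotation_mx g j k = rotq a x y z j k.
Proof.
move=> gE j k; rewrite mxE gE qmx_tC !pauliE -!scalemxAl -!scalemxAr.
rewrite -!scalemxAl !qmx_mul !mxtraceZ tr_qmx mulrA mulrNN -expr2 sqr_i mulN1r /=.
by move: k; apply: I3_ind; move: j; apply: I3_ind; rewrite /rotq /=; field.
Qed.

Lemma tuple3_eq (u v : 3.-tuple R) :
  (forall j, tnth u j = tnth v j) -> u = v.
Proof. by move=> h; apply: eq_from_tnth. Qed.

Definition vec3 (a b c : R) : 3.-tuple R := [tuple a; b; c].

Lemma vec3E v : v = vec3 (tnth v o0) (tnth v o1) (tnth v o2).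
Proof. by apply/tuple3_eq; apply: I3_ind; rewrite !(tnth_nth 0). Qed.

Lemma tnth_rotation g v j :
  tnth (rotation g v) j = \sum_(k < 3) rotation_mx g j k * tnth v k.
Proof. by rewrite tnth_mktuple. Qed.

Lemma rotation_mx_mul g h :
  rotation_mx (su2_mul g h) = rotation_mx g *m rotation_mx h.
Proof.
have [a [x [y [z [gE _]]]]] := su2_ex g.
have [a' [x' [y' [z' [hE _]]]]] := su2_ex h.
have := qmx_mul a x y z a' x' y' z'; rewrite -gE -hE.
rewrite -[_ *m _]/(su2mx (su2_mul g h)) => ghE.
apply/matrixP => j k; rewrite (rotation_mxE ghE).
rewrite mxE sumI3 !(rotation_mxE gE) !(rotation_mxE hE).
by move: k; apply: I3_ind; move: j; apply: I3_ind; rewrite /rotq /=; ring.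
Qed.

Lemma rotation_mx_orth g : rotation_mx g *m (rotation_mx g)^T = 1%:M.
Proof.
have [a [x [y [z [gE n1]]]]] := su2_ex g.
apply/matrixP => j k; rewrite mxE sumI3 [(_^T) o0 _]mxE [(_^T) o1 _]mxE [(_^T) o2 _]mxE.
rewrite [1%:M _ _]mxE !(rotation_mxE gE).
by move: k; apply: I3_ind; move: j; apply: I3_ind; rewrite /rotq /=;
  (* Diagonal entries equal the squared norm of the quaternion, squared, so the 1 on the right is
     first rewritten as that power. *)
  (ring || (rewrite mulr1n -[RHS](expr1n _ 2) -[in RHS]n1; ring)).
Qed.

End Quaternions.

(** * SU(2) acting on three-space: isometry, transitivity, derivatives at the identity *)

Section Rotations.
Variable R : realType.
Implicit Types (g h : su2 R) (v e : 3.-tuple R).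

Lemma su2_mulA g h k : su2_mul g (su2_mul h k) = su2_mul (su2_mul g h) k.
Proof. by apply: su2_inj; rewrite /= mulmxA. Qed.

Lemma su2_mul1 g : su2_mul g (su2_one R) = g.
Proof. by apply: su2_inj; rewrite /= mulmx1. Qed.

Lemma su2_1mul g : su2_mul (su2_one R) g = g.
Proof. by apply: su2_inj; rewrite /= mul1mx. Qed.

Lemma su2_inv_unitary g : (su2mx g)^t* \is unitarymx.
Proof. by rewrite trmxC_unitary su2_unitary. Qed.

Lemma su2_inv_det g : \det ((su2mx g)^t*) = 1.
Proof. by rewrite det_map_mx det_tr su2_det rmorph1. Qed.

Definition su2_inv g : su2 R := Su2 (su2_inv_unitary g) (su2_inv_det g).

Lemma su2_mulV g : su2_mul g (su2_inv g) = su2_one R.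
Proof. by apply: su2_inj; apply/unitarymxP/su2_unitary. Qed.

Lemma su2_mulVg g : su2_mul (su2_inv g) g = su2_one R.
Proof.
apply: su2_inj; apply: mulmx1C; exact/unitarymxP/su2_unitary.
Qed.

Lemma su2_mulK g h : su2_mul (su2_inv g) (su2_mul g h) = h.
Proof. by rewrite su2_mulA su2_mulVg su2_1mul. Qed.

Lemma su2_mulVK g h : su2_mul g (su2_mul (su2_inv g) h) = h.
Proof. by rewrite su2_mulA su2_mulV su2_1mul. Qed.

Lemma rotationM g h v : rotation (su2_mul g h) v = rotation g (rotation h v).
Proof.
apply: tuple3_eq => j; rewrite !tnth_rotation rotation_mx_mul.
under eq_bigr do rewrite mxE mulr_suml.
rewrite exchange_big; apply: eq_bigr => k _ /=.
by rewrite tnth_rotation mulr_sumr; apply: eq_bigr => l _; rewrite mulrA.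
Qed.

Lemma rotation_mx1 : rotation_mx (su2_one R) = 1%:M.
Proof.
have := rotation_mx_orth (su2_one R).
have := rotation_mx_mul (su2_one R) (su2_one R); rewrite su2_mul1 => h1 h2.
by rewrite -[LHS]mulmx1 -h2 mulmxA -h1 h2.
Qed.

Lemma rotation1 v : rotation (su2_one R) v = v.
Proof.
apply: tuple3_eq => j; rewrite tnth_rotation rotation_mx1 (bigD1 j) //= mxE eqxx mul1r.
by rewrite big1 ?addr0 // => k kj; rewrite mxE eq_sym (negPf kj) mul0r.
Qed.

Lemma rotationK g v : rotation (su2_inv g) (rotation g v) = v.
Proof. by rewrite -rotationM su2_mulVg rotation1. Qed.

Lemma rotationVK g v : rotation g (rotation (su2_inv g) v) = v.
Proof. by rewrite -rotationM su2_mulV rotation1. Qed.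

Lemma rotation_mxV g : rotation_mx (su2_inv g) = (rotation_mx g)^T.
Proof.
rewrite -[RHS]mul1mx -rotation_mx1 -(su2_mulVg g) rotation_mx_mul -mulmxA.
by rewrite rotation_mx_orth mulmx1.
Qed.

Lemma dot_rotationl g v e : dot (rotation g v) e = dot v (rotation (su2_inv g) e).
Proof.
rewrite /dot; under eq_bigr do rewrite tnth_rotation mulr_suml.
rewrite exchange_big; apply: eq_bigr => k _ /=.
rewrite tnth_rotation rotation_mxV mulr_sumr; apply: eq_bigr => l _.
by rewrite [_^T _ _]mxE; ring.
Qed.

Lemma dot_rotation g v e : dot (rotation g v) (rotation g e) = dot v e.
Proof. by rewrite dot_rotationl rotationK. Qed.

Lemma rotation_unit g e : unit_vector e -> unit_vector (rotation g e).
Proof. by rewrite /unit_vector dot_rotation. Qed.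

Lemma vdotE m e (A : 'I_3 -> 'M[R[i]]_m) :
  vdot e A = (tnth e o0)%:C *: A o0 + (tnth e o1)%:C *: A o1 + (tnth e o2)%:C *: A o2.
Proof. by rewrite /vdot sumI3. Qed.

Lemma vdot_pauli e : vdot e (@pauli R) =
  - 'i *: qmx 0 (tnth e o0) (tnth e o1) (tnth e o2).
Proof.
by rewrite vdotE; apply: mx2_eq; rewrite !mxE /=; simpc; apply: complex_eq => /=; ring.
Qed.

Lemma rotation_pauli g e :
  su2mx g *m vdot e (@pauli R) *m (su2mx g)^t* = vdot (rotation g e) (@pauli R).
Proof.
have [a [x [y [z [gE n1]]]]] := su2_ex g.
rewrite !vdot_pauli gE qmx_tC -scalemxAr -scalemxAl; congr (_ *: _).
rewrite !qmx_mul; congr qmx; rewrite ?tnth_rotation ?sumI3 ?(rotation_mxE gE) /rotq /=; ring.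
Qed.

Lemma rotation_pauli_comm g e :
  su2mx g *m vdot e (@pauli R) = vdot (rotation g e) (@pauli R) *m su2mx g.
Proof.
rewrite -rotation_pauli -!mulmxA (_ : (su2mx g)^t* *m su2mx g = 1%:M) ?mulmx1 //.
by apply: mulmx1C; exact/unitarymxP/su2_unitary.
Qed.

(** Conjugation by [g] moves the axis of a one-parameter subgroup; differentiated, this gives the
    covariance of the generators in [U_J]. *)
Lemma axis_conj g e t (e1 : unit_vector e) :
  su2_mul g (axis_rotation t e1) =
  su2_mul (axis_rotation t (rotation_unit g e1)) g.
Proof.
apply: su2_inj; rewrite /= /axis_mx mulmxBr mulmxBl scalar_mxC.
by rewrite -scalemxAr rotation_pauli_comm -scalemxAl.
Qed.

Lemma axis_mxq e t : axis_mx e t = qmx (cos (t / 2)) (- (sin (t / 2) * tnth e o0))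
  (- (sin (t / 2) * tnth e o1)) (- (sin (t / 2) * tnth e o2)).
Proof.
rewrite /axis_mx vdot_pauli.
by apply: mx2_eq; rewrite !mxE /=; simpc; apply: complex_eq => /=; ring.
Qed.

Lemma dotE v e : dot v e =
  tnth v o0 * tnth e o0 + tnth v o1 * tnth e o1 + tnth v o2 * tnth e o2.
Proof. by rewrite /dot sumI3. Qed.

Lemma tnth_north (j : 'I_3) : tnth (north R) j = (j == o2)%:R.
Proof. by rewrite tnth_mktuple ord_max3. Qed.

Lemma unit_north : unit_vector (north R).
Proof. by rewrite /unit_vector dotE !tnth_north /=; ring. Qed.

Lemma tnth_rotation_north g j : tnth (rotation g (north R)) j = rotation_mx g j o2.
Proof. by rewrite tnth_rotation sumI3 !tnth_north /=; ring. Qed.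

(** A quaternion with [z = 0] suffices: the third coordinate dictates $a^2=(1+r)/2$, and the other
    two equations are then linear. The south pole, where [a] would vanish, is reached by a half
    turn. *)
Lemma rotation_transitive e : unit_vector e -> exists g, rotation g (north R) = e.
Proof.
rewrite /unit_vector dotE -!expr2 => n1.
set p := tnth e o0 in n1 *; set q := tnth e o1 in n1 *; set r := tnth e o2 in n1 *.
suff [a [x [y [nq [h0 h1 h2]]]]] : exists a x y : R,
    a ^+ 2 + x ^+ 2 + y ^+ 2 + 0 ^+ 2 = 1 /\
    [/\ - (2 * a * y) = p, 2 * a * x = q & a ^+ 2 - x ^+ 2 - y ^+ 2 = r].
  exists (mkq nq); apply: tuple3_eq => j; rewrite tnth_rotation_north.
  rewrite (@rotation_mxE _ (mkq nq) _ _ _ _ erefl).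
  by move: j; apply: I3_ind; rewrite /rotq /= -/p -/q -/r -?h0 -?h1 -?h2; ring.
have r1 : -1 <= r <= 1.
  by apply/andP; split; move: (sqr_ge0 p) (sqr_ge0 q); nra.
have [r0|r0] := eqVneq r (-1).
  have p0 : p = 0 by apply/eqP; rewrite -sqrf_eq0; apply/eqP; move: n1 (sqr_ge0 p) (sqr_ge0 q); rewrite r0; lra.
  have q0 : q = 0 by apply/eqP; rewrite -sqrf_eq0; apply/eqP; move: n1 (sqr_ge0 p) (sqr_ge0 q); rewrite r0; lra.
  by exists 0, 1, 0; rewrite r0 p0 q0; split; [|split]; ring.
pose a := Num.sqrt ((1 + r) / 2).
have rp : 0 < 1 + r by rewrite lt_neqAle; case/andP: r1 => r1 _; apply/andP; split; [apply: contra_neq r0|]; lra.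
have a2 : a ^+ 2 = (1 + r) / 2 by rewrite sqr_sqrtr // divr_ge0 // ltW.
have a0 : a != 0 by rewrite sqrtr_eq0 -ltNge divr_gt0.
have r' : 1 + r != 0 by rewrite gt_eqF.
have pq : p ^+ 2 + q ^+ 2 = (1 - r) * (1 + r) by rewrite -subr_sqr expr1n -n1; ring.
have s2 : (q / (2 * a)) ^+ 2 + (- p / (2 * a)) ^+ 2 = (1 - r) / 2.
  rewrite !expr_div_n sqrrN exprMn a2 -mulrDl [q ^+ 2 + _]addrC pq.
  by field.
exists a, (q / (2 * a)), (- p / (2 * a)); split; last split.
- by rewrite expr0n addr0 -addrA s2 a2; field.
- by field.
- by field.
- by rewrite -addrA -opprD s2 a2; field.
Qed.

Lemma is_derive_cos_half : is_derive (0 : R) (1 : R) (fun t : R => cos (t / 2)) 0.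
Proof.
have h : is_derive (0 : R) (1 : R) (fun t : R => t / 2) (1 / 2).
  by apply: is_derive_eq; rewrite /GRing.scale /=; ring.
have := @is_derive1_comp R cos (fun t => t / 2) 0 _ _ (is_derive_cos (0 / 2)) h.
by rewrite mul0r sin0 oppr0 mul0r.
Qed.

Lemma is_derive_sin_half : is_derive (0 : R) (1 : R) (fun t : R => sin (t / 2)) (1 / 2).
Proof.
have h : is_derive (0 : R) (1 : R) (fun t : R => t / 2) (1 / 2).
  by apply: is_derive_eq; rewrite /GRing.scale /=; ring.
have := @is_derive1_comp R sin (fun t => t / 2) 0 _ _ (is_derive_sin (0 / 2)) h.
by rewrite mul0r cos0 mul1r.
Qed.

(** Entries of a rotation about an axis are quadratic forms in $\cos(t/2)$ and $\sin(t/2)$; at 0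
    only the mixed term has a derivative. *)
Lemma is_derive_half_angle (p q r : R) : is_derive (0 : R) (1 : R)
  (fun t : R => p * cos (t / 2) ^+ 2 + q * (cos (t / 2) * sin (t / 2)) + r * sin (t / 2) ^+ 2)
  (q / 2).
Proof.
have dc := is_derive_cos_half; have ds := is_derive_sin_half.
apply: is_derive_eq; rewrite /GRing.scale /= mul0r sin0 cos0; ring.
Qed.

(** The matrix of $v\mapsto e\times v$, the infinitesimal rotation about [e]. *)
Definition crossmx e (j k : 'I_3) : R :=
  nth 0 (nth [::] [:: [:: 0; - tnth e o2; tnth e o1];
                      [:: tnth e o2; 0; - tnth e o0];
                      [:: - tnth e o1; tnth e o0; 0]] j) k.

Lemma is_derive_rotation e (e1 : unit_vector e) j k : is_derive (0 : R) (1 : R)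
  (fun t => rotation_mx (axis_rotation t e1) j k) (crossmx e j k).
Proof.
rewrite (_ : (fun t => _) = fun t => rotq (cos (t / 2)) (- (sin (t / 2) * tnth e o0))
  (- (sin (t / 2) * tnth e o1)) (- (sin (t / 2) * tnth e o2)) j k); last first.
  by apply/funext => t; apply: rotation_mxE; rewrite /= axis_mxq.
have [p [r E]] : exists p r : R, forall c s : R, rotq c (- (s * tnth e o0))
    (- (s * tnth e o1)) (- (s * tnth e o2)) j k =
    p * c ^+ 2 + (2 * crossmx e j k) * (c * s) + r * s ^+ 2.
  exists (j == k)%:R, (rotq 0 (tnth e o0) (tnth e o1) (tnth e o2) j k) => c s.
  by move: k; apply: I3_ind; move: j; apply: I3_ind; rewrite /rotq /crossmx /=; ring.
under eq_fun do rewrite E.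
have := is_derive_half_angle p (2 * crossmx e j k) r.
by rewrite (_ : _ / 2 = crossmx e j k) //; field.
Qed.

End Rotations.

(** * Commutators of matrices *)

Section Commutator.
Variables (C : comNzRingType) (n : nat).
Implicit Types X Y Z : 'M[C]_n.

Definition ad X Y := X *m Y - Y *m X.

Lemma adDl X Y Z : ad (X + Y) Z = ad X Z + ad Y Z.
Proof. by rewrite /ad mulmxDl mulmxDr opprD addrACA. Qed.

Lemma adDr X Y Z : ad X (Y + Z) = ad X Y + ad X Z.
Proof. by rewrite /ad mulmxDl mulmxDr opprD addrACA. Qed.

Lemma adZl a X Y : ad (a *: X) Y = a *: ad X Y.
Proof. by rewrite /ad -scalemxAl -scalemxAr scalerBr. Qed.

Lemma adZr a X Y : ad X (a *: Y) = a *: ad X Y.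
Proof. by rewrite /ad -scalemxAl -scalemxAr scalerBr. Qed.

Lemma adNl X Y : ad (- X) Y = - ad X Y.
Proof. by rewrite -scaleN1r adZl scaleN1r. Qed.

Lemma adNr X Y : ad X (- Y) = - ad X Y.
Proof. by rewrite -scaleN1r adZr scaleN1r. Qed.

Lemma adC X Y : ad X Y = - ad Y X.
Proof. by rewrite /ad opprB. Qed.

Lemma adXX X : ad X X = 0.
Proof. by rewrite /ad subrr. Qed.

Lemma adX0 X : ad X 0 = 0.
Proof. by rewrite /ad mulmx0 mul0mx subrr. Qed.

Lemma adM X Y Z : ad X (Y *m Z) = ad X Y *m Z + Y *m ad X Z.
Proof. by rewrite /ad mulmxBl mulmxBr !mulmxA addrA subrK. Qed.

Lemma ad_sumr I (r : seq I) (P : pred I) X (F : I -> 'M[C]_n) :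
  ad X (\sum_(i <- r | P i) F i) = \sum_(i <- r | P i) ad X (F i).
Proof. by rewrite /ad mulmx_sumr mulmx_suml -sumrB. Qed.

End Commutator.

(** * Ladder operators; Wigner-Eckart theorem for vector and symmetric tensor operators *)

Section Ladder.
Variables (C : numClosedFieldType) (N : nat).
Local Notation M := 'M[C]_N.+1.

(** This is $i\sum_c\varepsilon_{abc}F_c$, the value of $[J_a,F_b]$ when [F] is a vector
    operator. *)
Definition cross_op (a b : 'I_3) (F : 'I_3 -> M) : M :=
  nth 0 (nth [::] [:: [:: 0; 'i *: F o2; - ('i *: F o1)];
                      [:: - ('i *: F o2); 0; 'i *: F o0];
                      [:: 'i *: F o1; - ('i *: F o0); 0]] a) b.

Variable J : 'I_3 -> M.

Definition vector_op (A : 'I_3 -> M) := forall a b, ad (J a) (A b) = cross_op a b A.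

Definition tensor_op (B : 'I_3 -> 'I_3 -> M) := forall a b c,
  ad (J a) (B b c) = cross_op a b (B ^~ c) + cross_op a c (B b).

Hypothesis J_vector : vector_op J.
Hypothesis J_herm : forall a, (J a)^t* = J a.
Hypothesis J_diag : forall i j, J o2 i j = (j%:R - N%:R / 2) *+ (i == j).

Let Jp := J o0 + 'i *: J o1.
Let Jm := J o0 - 'i *: J o1.

Lemma ii : 'i * 'i = -1 :> C.
Proof. by rewrite -expr2 sqrCi. Qed.

Ltac adlin := rewrite ?(adDl, adDr, adNl, adNr, adZl, adZr).

Lemma iiZ (X : M) : 'i *: ('i *: X) = - X.
Proof. by rewrite scalerA ii scaleN1r. Qed.

Lemma i2Z (X : M) : 'i *: (2 *: X) = 2 *: ('i *: X).
Proof. by rewrite !scalerA mulrC. Qed.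

Ltac mxlin := rewrite ?(scalerDr, scalerN, scaler0, i2Z, iiZ);
  apply/matrixP => ? ?; rewrite !mxE; ring.

(** The combination [A o0 + 'i *: A o1] is the highest-weight component of a vector operator: it has
    weight 1, commutes with [Jp], and is lowered by [Jm] to a multiple of [A o2]. The next two
    lemmas give these last two facts. *)
Lemma vec_J2p A : vector_op A ->
  ad (J o2) (A o0 + 'i *: A o1) = A o0 + 'i *: A o1.
Proof. by move=> hA; adlin; rewrite !hA /cross_op /=; mxlin. Qed.

Lemma vec_Jpp A : vector_op A -> ad Jp (A o0 + 'i *: A o1) = 0.
Proof. by move=> hA; rewrite /Jp; adlin; rewrite !hA /cross_op /=; mxlin. Qed.

Lemma vec_Jmp A : vector_op A -> ad Jm (A o0 + 'i *: A o1) = - 2 *: A o2.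
Proof. by move=> hA; rewrite /Jm; adlin; rewrite !hA /cross_op /=; mxlin. Qed.

(** For symmetric [B] this is the component $B_{++}$, of highest weight 2. *)
Let plus2 (B : 'I_3 -> 'I_3 -> M) := B o0 o0 - B o1 o1 + 2 *: ('i *: B o0 o1).

Lemma tens_J2pp B : tensor_op B -> (forall b c, B b c = B c b) ->
  ad (J o2) (plus2 B) = 2 *: plus2 B.
Proof.
by move=> hB sB; rewrite /plus2; adlin; rewrite !hB /cross_op /= (sB o1 o0); mxlin.
Qed.

Lemma tens_Jppp B : tensor_op B -> (forall b c, B b c = B c b) ->
  ad Jp (plus2 B) = 0.
Proof.
move=> hB sB; rewrite /plus2 /Jp; adlin.
by rewrite !hB /cross_op /= ?(sB o1 o0) ?(sB o2 o0) ?(sB o2 o1); mxlin.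
Qed.

Lemma tens_Jmpp B : tensor_op B -> (forall b c, B b c = B c b) ->
  ad Jm (plus2 B) = - 4 *: (B o0 o2 + 'i *: B o1 o2).
Proof.
move=> hB sB; rewrite /plus2 /Jm; adlin.
by rewrite !hB /cross_op /= ?(sB o1 o0) ?(sB o2 o0) ?(sB o2 o1); mxlin.
Qed.

Lemma tens_Jmp2 B : tensor_op B -> (forall b c, B b c = B c b) ->
  ad Jm (B o0 o2 + 'i *: B o1 o2) = B o0 o0 + B o1 o1 - 2 *: B o2 o2.
Proof.
move=> hB sB; rewrite /Jm; adlin.
by rewrite !hB /cross_op /= ?(sB o1 o0) ?(sB o2 o0) ?(sB o2 o1); mxlin.
Qed.

(** Entrywise $[J_3,Y]_{ij}=(i-j)Y_{ij}$, so an operator of weight [k] lives on the [k]-th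
    subdiagonal. *)
Lemma weight_entry (k : nat) (Y : M) : ad (J o2) Y = k%:R *: Y ->
  forall i j : 'I_N.+1, i != (j + k)%N :> nat -> Y i j = 0.
Proof.
move=> hY i j ij; have /matrixP /(_ i j) := hY.
rewrite /ad !mxE (bigD1 i) //= big1 ?addr0; last first.
  by move=> l li; rewrite J_diag eq_sym (negPf li) mul0r.
rewrite (bigD1 j) //= big1 ?addr0; last first.
  by move=> l lj; rewrite J_diag (negPf lj) mulr0.
rewrite !J_diag !eqxx !mulr1n => /eqP; rewrite -subr_eq0.
have -> : (i%:R - N%:R / 2) * Y i j - Y i j * (j%:R - N%:R / 2) - k%:R * Y i j
  = (i%:R - (j + k)%:R) * Y i j by rewrite natrD; ring.
by rewrite mulf_eq0 subr_eq0 eqr_nat (negPf ij) /= => /eqP.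
Qed.

Lemma J2p : ad (J o2) Jp = Jp.
Proof. exact: vec_J2p. Qed.

Lemma Jp_entry (i j : 'I_N.+1) : i != j.+1 :> nat -> Jp i j = 0.
Proof. by move=> ij; apply: (@weight_entry 1); rewrite ?scale1r ?J2p ?addn1. Qed.

Lemma J_hermE a i j : (J a j i)^*%R = J a i j.
Proof. by have /matrixP /(_ i j) := J_herm a; rewrite !mxE. Qed.

Lemma Jm_entryE i j : Jm i j = (Jp j i)^*%R.
Proof. by rewrite !mxE rmorphD rmorphM /= conjCi !J_hermE mulNr. Qed.

Lemma ad_pm : ad Jp Jm = 2 *: J o2.
Proof.
rewrite /Jp /Jm; adlin; rewrite !J_vector /cross_op /=; mxlin.
Qed.

Let dn (i : 'I_N.+1) := (Jp *m Jm) i i.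
Let up (i : 'I_N.+1) := (Jm *m Jp) i i.

Lemma dn_up i : dn i = up i + 2 * (i%:R - N%:R / 2).
Proof.
have /matrixP /(_ i i) := ad_pm; rewrite /ad [LHS]mxE [(- _ : M) i i]mxE [RHS]mxE J_diag eqxx mulr1n.
by rewrite -/(dn i) -/(up i) => <-; ring.
Qed.

Lemma dn0 : dn ord0 = 0.
Proof. by rewrite /dn mxE big1 // => k _; rewrite Jp_entry ?mul0r. Qed.

Lemma dn_succ (i j : 'I_N.+1) : j = i.+1 :> nat -> dn j = Jp j i * (Jp j i)^*%R /\ up i = dn j.
Proof.
move=> ji; have -> : dn j = Jp j i * (Jp j i)^*%R.
  rewrite /dn mxE (bigD1 i) //= big1 ?addr0 ?Jm_entryE // => k ki.
  by rewrite Jp_entry ?mul0r // ji eqSS eq_sym.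
split=> //; rewrite /up mxE (bigD1 j) //= big1 ?addr0 ?Jm_entryE 1?mulrC // => k kj.
by rewrite [Jp k i]Jp_entry ?mulr0 // -ji.
Qed.

(** The diagonals [dn] and [up] differ by that of $2J_3$ and are shifts of each other ([dn_succ]),
    which gives a recursion starting at [dn0]. The value is the familiar $s(s+1)-m(m+1)$. *)
Lemma upE i : up i = i.+1%:R * (N%:R - i%:R).
Proof.
case: i => i lt; elim: i lt => [|i IH] lt.
  rewrite (_ : Ordinal lt = ord0) ?dn0; last exact/val_inj.
  have := dn_up ord0; rewrite dn0 => /eqP; rewrite eq_sym addr_eq0 => /eqP ->.
  by rewrite /=; field.
have lt' : (i < N.+1)%N by exact: ltnW.
have := dn_up (Ordinal lt).
rewrite -(dn_succ (i := Ordinal lt') (j := Ordinal lt) erefl).2 IH /= => /eqP.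
by rewrite -subr_eq => /eqP <-; rewrite -[i.+2%:R]natr1 -[i.+1%:R]natr1; field.
Qed.

Lemma dnE i : dn i = i%:R * (N%:R + 1 - i%:R).
Proof. by rewrite dn_up upE -natr1; field. Qed.

(** No rung of the ladder is zero; this drives the commutant argument of [commute_Jp_eq0]. *)
Lemma Jp_neq0 (i j : 'I_N.+1) : j = i.+1 :> nat -> Jp j i != 0.
Proof.
move=> ji; have [h1 h2] := dn_succ ji.
have : up i != 0.
  rewrite upE mulf_neq0 ?pnatr_eq0 // subr_eq0 eqr_nat neq_ltn.
  by have := ltn_ord j; rewrite ji ltnS => ->; rewrite orbT.
by rewrite h2 h1; apply: contraNneq => ->; rewrite mul0r.
Qed.

Lemma offdiag_pm i j : i != j -> (Jp *m Jm) i j = 0 /\ (Jm *m Jp) i j = 0.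
Proof.
move=> ij; have ijn : i != j :> nat by [].
split; rewrite mxE big1 // => k _; rewrite Jm_entryE.
  have [ik|ik] := eqVneq (i : nat) k.+1; last by rewrite [Jp i k]Jp_entry ?mul0r.
  rewrite [Jp j k]Jp_entry ?conjC0 ?mulr0 //.
  by rewrite -ik eq_sym.
have [ik|ik] := eqVneq (k : nat) i.+1; last by rewrite [Jp k i]Jp_entry ?conjC0 ?mul0r.
rewrite [Jp k j]Jp_entry ?mulr0 //.
by rewrite ik eqSS.
Qed.

Lemma JpmE i j : (Jp *m Jm + Jm *m Jp) i j =
  (N%:R / 2 * (N%:R / 2 + 1) - (i%:R - N%:R / 2) ^+ 2) * 2 *+ (i == j).
Proof.
rewrite mxE; have [<-|ij] := eqVneq i j.
  by rewrite mulr1n -/(dn i) -/(up i) upE dnE -natr1; field.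
by have [-> ->] := offdiag_pm ij; rewrite addr0 mulr0n.
Qed.

Lemma casimir : J o0 *m J o0 + J o1 *m J o1 + J o2 *m J o2 =
  (N%:R / 2 * (N%:R / 2 + 1))%:M.
Proof.
have h : J o0 *m J o0 + J o1 *m J o1 = 2^-1 *: (Jp *m Jm + Jm *m Jp).
  rewrite /Jp /Jm !(mulmxDl, mulmxDr, mulmxN, mulNmx).
  rewrite -!(scalemxAl, scalemxAr) iiZ.
  move: (J o0 *m J o0) (J o1 *m J o1) (J o0 *m J o1) (J o1 *m J o0) => a b c d.
  rewrite [X in _ = _ *: X](_ : _ = 2 *: (a + b)); first by rewrite scalerA mulVf ?scale1r.
  by mxlin.
rewrite h; apply/matrixP => i j; rewrite mxE [(_ *: _ : M) i j]mxE JpmE [RHS]mxE.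
rewrite [X in _ + X]mxE (bigD1 i) //= big1 ?addr0; last first.
  by move=> k ki; rewrite J_diag eq_sym (negPf ki) mul0r.
rewrite !J_diag eqxx; case: eqP => [<-|_]; rewrite ?mulr1n ?mulr0n; last by ring.
by field.
Qed.

Lemma J01_diag i : J o0 i i = 0 /\ J o1 i i = 0.
Proof.
have hp : Jp i i = 0 by apply: Jp_entry; rewrite neq_ltn ltnSn.
have hm : Jm i i = 0 by rewrite Jm_entryE hp conjC0.
have e0 : J o0 i i = (Jp i i + Jm i i) / 2 by rewrite !mxE; field.
have e1 : 'i * J o1 i i = (Jp i i - Jm i i) / 2 by rewrite !mxE; field.
split; first by rewrite e0 hp hm addr0 mul0r.
apply/eqP; have /eqP := e1; rewrite hp hm subrr mul0r mulf_eq0.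
by rewrite (negPf (neq0Ci _)).
Qed.

Lemma lin_diag (y : 'I_3 -> C) (i : 'I_N.+1) :
  (\sum_k y k *: J k) i i = y o2 * (i%:R - N%:R / 2).
Proof.
have [h0 h1] := J01_diag i.
by rewrite sumI3 !mxE h0 h1 J_diag eqxx mulr1n !mulr0 !add0r.
Qed.

(** $J_+^2$ and $J_-^2$ have zero diagonal, so the squares of [J o0] and [J o1] share their
    diagonal, half of that of the Casimir operator minus $J_3^2$, and their cross terms cancel.
    Products with the diagonal [J o2] drop out because [J o0] and [J o1] have zero diagonal. *)
Lemma quad_diag (y : 'I_3 -> C) (i : 'I_N.+1) :
  let Y : M := \sum_k y k *: J k in let m : C := i%:R - N%:R / 2 in
  (Y *m Y) i i = y o2 ^+ 2 * m ^+ 2 +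
    (y o0 ^+ 2 + y o1 ^+ 2) * ((N%:R / 2 * (N%:R / 2 + 1) - m ^+ 2) / 2).
Proof.
move=> Y m; rewrite /Y sumI3.
have Jm_entry (k l : 'I_N.+1) : l != k.+1 :> nat -> Jm k l = 0.
  by move=> kl; rewrite Jm_entryE Jp_entry ?conjC0.
have h1 : (Jp *m Jp) i i = 0.
  rewrite mxE big1 // => k _; have [ik|ik] := eqVneq (i : nat) k.+1.
    rewrite [Jp k i]Jp_entry ?mulr0 //.
    by rewrite ik neq_ltn leqnSn.
  by rewrite [Jp i k]Jp_entry ?mul0r.
have h2 : (Jm *m Jm) i i = 0.
  rewrite mxE big1 // => k _; have [ik|ik] := eqVneq (i : nat) k.+1.
    rewrite [Jm i k]Jm_entry ?mul0r //.
    by rewrite ik neq_ltn leqnSn.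
  by rewrite [Jm k i]Jm_entry ?mulr0.
have h3 := JpmE i i; rewrite eqxx mulr1n -/m in h3.
have h22 : (J o2 *m J o2) i i = m ^+ 2.
  rewrite mxE (bigD1 i) //= big1 ?addr0; last first.
    by move=> k ki; rewrite J_diag eq_sym (negPf ki) mul0r.
  by rewrite !J_diag eqxx mulr1n -expr2.
have hd (A : M) : (A *m J o2) i i = A i i * m.
  rewrite mxE (bigD1 i) //= big1 ?addr0; last first.
    by move=> k ki; rewrite J_diag (negPf ki) mulr0.
  by rewrite J_diag eqxx mulr1n.
have hg (A : M) : (J o2 *m A) i i = A i i * m.
  rewrite mxE (bigD1 i) //= big1 ?addr0; last first.
    by move=> k ki; rewrite J_diag eq_sym (negPf ki) mul0r.
  by rewrite J_diag eqxx mulr1n mulrC.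
have [d0 d1] := J01_diag i.
move: h1 h2 h3; rewrite /Jp /Jm !(mulmxDl, mulmxDr, mulmxN, mulNmx).
rewrite -!(scalemxAl, scalemxAr) iiZ.
have := hd (J o0); have := hd (J o1); have := hg (J o0); have := hg (J o1).
move: h22; rewrite d0 d1 !mul0r.
move: (J o0 *m J o0) (J o1 *m J o1) (J o2 *m J o2) (J o0 *m J o1) (J o1 *m J o0) => a b c e f.
move: (J o0 *m J o2) (J o2 *m J o0) (J o1 *m J o2) (J o2 *m J o1) => p q r s.
move: (y o0) (y o1) (y o2) => u v w; rewrite !mxE.
move: (a i i) (b i i) (c i i) (e i i) (f i i) (p i i) (q i i) (r i i) (s i i).
move=> {a b c e f p q r s} a b c e f p q r s -> -> -> -> -> h1 h2 h3.
(* Adding the diagonals of $J_+^2$ and $J_-^2$ yields [a = b]; subtracting them yields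
   [e + f = 0]. *)
have ab : a - b = 0.
  have : (a - b) *+ 2 = 0 by rewrite -[RHS](addr0 0) -{1}h1 -h2; ring.
  by move/eqP; rewrite mulrn_eq0 => /eqP.
have ef : e + f = 0.
  have : ('i * (e + f)) *+ 2 = 0 by rewrite -[RHS](subrr 0) -{1}h1 -h2; ring.
  by move/eqP; rewrite mulrn_eq0 /= mulf_eq0 (negPf (neq0Ci _)) => /eqP.
have b' : b = a by apply/eqP; rewrite eq_sym -subr_eq0 ab.
have f' : f = - e by apply/eqP; rewrite -addr_eq0 addrC ef.
have -> : (N%:R / 2 * (N%:R / 2 + 1) - m ^+ 2) / 2 = a.
  apply: (mulIf (x := 4)); first by rewrite pnatr_eq0.
  transitivity ((N%:R / 2 * (N%:R / 2 + 1) - m ^+ 2) * 2); first by field.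
  by rewrite -h3 b'; ring.
by rewrite b' f'; ring.
Qed.

(** [Jp] sends each basis vector to a nonzero multiple of the next one, so an operator commuting
    with it is determined by its first column. *)
Lemma commute_Jp_eq0 (A : M) : ad Jp A = 0 -> (forall i, A i ord0 = 0) -> A = 0.
Proof.
move=> /eqP; rewrite subr_eq0 => /eqP cA A0.
suff h (j : nat) : forall lt : (j < N.+1)%N, forall i, A i (Ordinal lt) = 0.
  by apply/matrixP => i [j lt]; rewrite h mxE.
elim: j => [|j IH] lt i; first by rewrite (_ : Ordinal lt = ord0) //; exact/val_inj.
have lt' : (j < N.+1)%N by exact: ltnW.
have /matrixP /(_ i (Ordinal lt')) := cA.
rewrite mxE big1 => [|k _]; last by rewrite IH mulr0.
rewrite mxE (bigD1 (Ordinal lt)) //= big1 ?addr0 => [|k kj].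
  by move/esym/eqP; rewrite mulf_eq0 (negPf (Jp_neq0 _)) // orbF => /eqP.
by rewrite Jp_entry ?mulr0.
Qed.

(** Schur's lemma. Weight 0 leaves only the corner entry in the first column; once the corresponding
    scalar is subtracted, that column is zero. *)
Lemma commutant (A : M) : (forall a, ad (J a) A = 0) -> A = (A ord0 ord0)%:M.
Proof.
move=> h; apply/eqP; rewrite -subr_eq0; apply/eqP; apply: commute_Jp_eq0.
  rewrite adDr adNr /Jp adDl adZl !h scaler0 addr0 sub0r.
  by rewrite /ad scalar_mxC subrr oppr0.
move=> i; rewrite !mxE; have [->|i0] := eqVneq i ord0; first by rewrite mulr1n subrr.
by rewrite mulr0n subr0; apply: (@weight_entry 0); rewrite ?h ?scale0r // addn0.
Qed.

Lemma commute_J2_diag (A : M) : ad (J o2) A = 0 -> forall i j, i != j -> A i j = 0.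
Proof. by move=> h i j ij; apply: (@weight_entry 0); rewrite ?h ?scale0r // addn0. Qed.

(** The highest-weight component has a single entry in its first column, so a suitable [a] makes it
    equal to [a *: Jp]; lowering both sides carries the proportionality to the third components. *)
Lemma vector_op_proportional A : (0 < N)%N -> vector_op A ->
  exists a, A o2 = a *: J o2.
Proof.
move=> N0 hA; pose i1 : 'I_N.+1 := Ordinal (N0 : (1 < N.+1)%N).
pose Ap := A o0 + 'i *: A o1; pose a := Ap i1 ord0 / Jp i1 ord0.
have wA : ad (J o2) Ap = 1%:R *: Ap by rewrite scale1r vec_J2p.
have /eqP : Ap - a *: Jp = 0.
  apply: commute_Jp_eq0; first by rewrite adDr adNr adZr adXX scaler0 subr0 vec_Jpp.
  move=> i; rewrite [LHS]mxE [(- _ : M) i _]mxE [(_ *: _ : M) i _]mxE.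
  have [->|ii1] := eqVneq i i1.
    by rewrite /a divfK ?subrr // Jp_neq0.
  have ii1' : i != 1 :> nat by [].
  by rewrite (@weight_entry 1 Ap wA i ord0 ii1') (@Jp_entry i ord0 ii1') mulr0 subrr.
rewrite subr_eq0 => /eqP E; exists a.
have := congr1 (ad Jm) E; rewrite adZr vec_Jmp // vec_Jmp //.
rewrite scalerA mulrC -scalerA => /(scalerI _); apply.
by rewrite oppr_eq0 pnatr_eq0.
Qed.

(** Lowering $B_{++}=0$ twice kills the traceless part of the third diagonal component, which is
    therefore a third of the trace. *)
Lemma tens_eq0 B : tensor_op B -> (forall b c, B b c = B c b) -> plus2 B = 0 ->
  3 *: B o2 o2 = B o0 o0 + B o1 o1 + B o2 o2.
Proof.
move=> hB sB h0.
have h1 : B o0 o2 + 'i *: B o1 o2 = 0.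
  apply/eqP; have := tens_Jmpp hB sB; rewrite h0 adX0 => /esym/eqP.
  by rewrite scaler_eq0 oppr_eq0 pnatr_eq0.
have := tens_Jmp2 hB sB; rewrite h1 adX0 => /esym/eqP; rewrite subr_eq0 => /eqP ->.
by mxlin.
Qed.

Lemma cross_op_map (f : M -> M) a b F : f 0 = 0 -> (forall X, f (- X) = - f X) ->
  (forall X, f ('i *: X) = 'i *: f X) ->
  cross_op a b (f \o F) = f (cross_op a b F).
Proof.
move=> f0 fN fi; move: b; apply: I3_ind; move: a; apply: I3_ind;
by rewrite /cross_op /= ?fN ?fi ?f0.
Qed.

Lemma tensor_op_sym : tensor_op (fun b c => J b *m J c + J c *m J b).
Proof.
move=> a b c; rewrite adDr !adM !J_vector.
pose f Y X := X *m Y + Y *m X : M.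
have f0 Y : f Y 0 = 0 by rewrite /f mul0mx mulmx0 addr0.
have fN Y X : f Y (- X) = - f Y X by rewrite /f mulNmx mulmxN opprD.
have fi Y X : f Y ('i *: X) = 'i *: f Y X by rewrite /f -scalemxAl -scalemxAr scalerDr.
have := @cross_op_map (f (J c)) a b J (f0 _) (fN _) (fi _).
have := @cross_op_map (f (J b)) a c J (f0 _) (fN _) (fi _).
rewrite /f => E1 E2.
rewrite [X in _ = X + _](_ : _ = cross_op a b J *m J c + J c *m cross_op a b J) //.
rewrite [X in _ = _ + X](_ : _ = cross_op a c J *m J b + J b *m cross_op a c J); last first.
  by rewrite -E1; congr cross_op; apply/funext => k /=; rewrite addrC.
move: (cross_op a b J *m J c) (J b *m cross_op a c J) (cross_op a c J *m J b).
move: (J c *m cross_op a b J) => p q r s.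
by rewrite [s + p]addrC addrACA [r + s]addrC.
Qed.

Let S (b c : 'I_3) := J b *m J c + J c *m J b.

Lemma S_sym b c : S b c = S c b.
Proof. by rewrite /S addrC. Qed.

Lemma plus2_S : plus2 S = 2 *: (Jp *m Jp).
Proof.
rewrite /plus2 /S /Jp !(mulmxDl, mulmxDr) -!(scalemxAl, scalemxAr) iiZ.
move: (J o0 *m J o0) (J o1 *m J o1) (J o0 *m J o1) (J o1 *m J o0) => a b c d.
by mxlin.
Qed.

Lemma plus2Z k (B : 'I_3 -> 'I_3 -> M) :
  plus2 (fun b c => B b c - k *: S b c) = plus2 B - k *: plus2 S.
Proof.
rewrite /plus2; move: (S o0 o0) (S o1 o1) (S o0 o1) => s0 s1 s2.
move: (B o0 o0) (B o1 o1) (B o0 o1) => b0 b1 b2.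
by mxlin.
Qed.

Lemma cross_opB a b k (F G : 'I_3 -> M) :
  cross_op a b (fun l => F l - k *: G l) = cross_op a b F - k *: cross_op a b G.
Proof.
by move: b; apply: I3_ind; move: a; apply: I3_ind; rewrite /cross_op /=; mxlin.
Qed.

Lemma tensor_opB k B : tensor_op B -> tensor_op (fun b c => B b c - k *: S b c).
Proof.
move=> hB a b c; rewrite adDr adNr adZr hB tensor_op_sym !cross_opB.
by rewrite scalerDr opprD addrACA.
Qed.

(** $B_{++}$ and $J_+^2$ both have weight 2 and commute with [Jp], hence are proportional.
    Subtracting that multiple of the symmetrised products of the [J] leaves a tensor without top
    component, so [tens_eq0] expresses the rest by the trace of [B] and the Casimir operator, both
    scalar. *)
Lemma tensor_op_quadratic B beta : tensor_op B -> (forall b c, B b c = B c b) ->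
  B o0 o0 + B o1 o1 + B o2 o2 = beta%:M ->
  exists a c, B o2 o2 = a *: (J o2 *m J o2) + c%:M.
Proof.
move=> hB sB trB.
have [k hk] : exists k, plus2 B = k *: plus2 S.
  have wB : ad (J o2) (plus2 B) = 2%:R *: plus2 B by exact: tens_J2pp.
  have wS : ad (J o2) (plus2 S) = 2%:R *: plus2 S.
    by apply: tens_J2pp; [exact: tensor_op_sym|exact: S_sym].
  have cB k : ad Jp (plus2 B - k *: plus2 S) = 0.
    rewrite adDr adNr adZr !tens_Jppp ?scaler0 ?subrr //; [exact: tensor_op_sym|exact: S_sym].
  (* In dimension at most 2 there is no second subdiagonal, so an operator of weight 2 vanishes. *)
  have [N2|N2] := leqP 2 N; last first.
    exists 0; rewrite scale0r; apply: commute_Jp_eq0.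
      by have := cB 0; rewrite scale0r subr0.
    move=> i; apply: (@weight_entry 2 _ wB); rewrite neq_ltn add0n.
    by rewrite (leq_trans (ltn_ord i)).
  pose i2 : 'I_N.+1 := Ordinal (N2 : (2 < N.+1)%N).
  pose i1 : 'I_N.+1 := Ordinal (ltnW N2 : (1 < N.+1)%N).
  have S0 : plus2 S i2 ord0 != 0.
    rewrite plus2_S mxE mulf_neq0 ?pnatr_eq0 // mxE (bigD1 i1) //= big1 ?addr0.
      by rewrite mulf_neq0 // Jp_neq0.
    by move=> l li; rewrite [Jp l ord0]Jp_entry ?mulr0.
  exists (plus2 B i2 ord0 / plus2 S i2 ord0); apply/eqP; rewrite -subr_eq0; apply/eqP.
  apply: commute_Jp_eq0 => // i.
  rewrite [LHS]mxE [(- _ : M) i _]mxE [(_ *: _ : M) i _]mxE.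
  have [->|ii2] := eqVneq i i2; first by rewrite divfK // subrr.
  have ii2' : i != 2 :> nat by [].
  by rewrite (@weight_entry 2 _ wB i ord0 ii2') (@weight_entry 2 _ wS i ord0 ii2') mulr0 subrr.
have := @tens_eq0 _ (tensor_opB k hB) _ _.
rewrite plus2Z hk subrr => /(_ _ erefl) h.
have {}h : 3 *: (B o2 o2 - k *: S o2 o2) =
    beta%:M - k *: (2 *: (N%:R / 2 * (N%:R / 2 + 1))%:M).
  rewrite h; last by move=> b c; rewrite sB S_sym.
  rewrite -trB -casimir /S.
  move: (J o0 *m J o0) (J o1 *m J o1) (J o2 *m J o2) => a b c.
  by mxlin.
exists (2 * k), (3^-1 * (beta - k * 2 * (N%:R / 2 * (N%:R / 2 + 1)))).
have /(congr1 (fun X : M => k *: S o2 o2 + 3^-1 *: X)) := h.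
rewrite scalerA mulVf ?pnatr_eq0 // scale1r addrC subrK => ->.
rewrite /S; congr (_ + _).
  by rewrite scalerDr -scalerDl; congr (_ *: _); ring.
by apply/matrixP => i j; rewrite !mxE; case: eqP => _; rewrite ?mulr1n ?mulr0n; ring.
Qed.

End Ladder.

(** * Derivatives at 0 of complex and matrix-valued curves *)

Section Derivative.
Variable R : realType.
Local Notation C := R[i].

(** Componentwise, in the form in which [rep_generator] provides derivatives. *)
Definition cderiv (f : R -> C) (d : C) :=
  is_derive (0 : R) (1 : R) (fun t => complex.Re (f t)) (complex.Re d) /\
  is_derive (0 : R) (1 : R) (fun t => complex.Im (f t)) (complex.Im d).

Lemma cderiv_unique f d d' : cderiv f d -> cderiv f d' -> d = d'.
Proof.
move=> [[_ e1] [_ e2]] [[_ h1] [_ h2]].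
by apply: complex_eq; rewrite -?e1 -?h1 -?e2 -?h2.
Qed.

Lemma cderiv_cst c : cderiv (fun=> c) 0.
Proof. by split; exact: is_derive_cst. Qed.

Lemma cderivD f g d d' : cderiv f d -> cderiv g d' ->
  cderiv (fun t => f t + g t) (d + d').
Proof.
move=> [f1 f2] [g1 g2]; split.
- rewrite raddfD (_ : (fun t => _) =
    (fun t => complex.Re (f t)) \+ (fun t => complex.Re (g t))).
    exact: is_deriveD.
  by apply/funext => t /=; rewrite raddfD.
- rewrite raddfD (_ : (fun t => _) =
    (fun t => complex.Im (f t)) \+ (fun t => complex.Im (g t))).
    exact: is_deriveD.
  by apply/funext => t /=; rewrite raddfD.
Qed.

Lemma cderivM f g d d' : cderiv f d -> cderiv g d' ->
  cderiv (fun t => f t * g t) (d * g 0 + f 0 * d').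
Proof.
move=> [f1 f2] [g1 g2]; split.
- rewrite (_ : (fun t => _) = (fun t => complex.Re (f t) * complex.Re (g t)
    - complex.Im (f t) * complex.Im (g t))); last first.
    by apply/funext => t; case: (f t) => ? ?; case: (g t).
  apply: is_derive_eq; rewrite /GRing.scale /=.
  by case: (f 0) (g 0) => ? ? [? ?]; case: (d) (d') => ? ? [? ?] /=; ring.
- rewrite (_ : (fun t => _) = (fun t => complex.Re (f t) * complex.Im (g t)
    + complex.Im (f t) * complex.Re (g t))); last first.
    by apply/funext => t; case: (f t) => ? ?; case: (g t).
  apply: is_derive_eq; rewrite /GRing.scale /=.
  by case: (f 0) (g 0) => ? ? [? ?]; case: (d) (d') => ? ? [? ?] /=; ring.
Qed.

Lemma cderiv_conj f d : cderiv f d -> cderiv (fun t => (f t)^*%R) (d^*%R).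
Proof.
move=> [f1 f2]; split.
- rewrite (_ : (fun t => _) = fun t => complex.Re (f t)).
    by rewrite (_ : complex.Re _ = complex.Re d) //; case: (d).
  by apply/funext => t; case: (f t).
- rewrite (_ : (fun t => _) = - (fun t => complex.Im (f t))).
    by rewrite (_ : complex.Im _ = - complex.Im d); [exact: is_deriveN|case: (d)].
  by apply/funext => t; rewrite fctE; case: (f t).
Qed.

Lemma cderiv_real (f : R -> R) d : is_derive (0 : R) (1 : R) f d ->
  cderiv (fun t => (f t)%:C) d%:C.
Proof. by move=> fd; split => //=; exact: is_derive_cst. Qed.

Lemma cderiv_sum (I : Type) (r : seq I) (f : I -> R -> C) (d : I -> C) :
  (forall i, cderiv (f i) (d i)) ->
  cderiv (fun t => \sum_(i <- r) f i t) (\sum_(i <- r) d i).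
Proof.
move=> h; elim: r => [|i r IH].
  rewrite big_nil; under eq_fun do rewrite big_nil; exact: cderiv_cst.
rewrite big_cons; under eq_fun do rewrite big_cons; exact: cderivD.
Qed.

Definition mxderiv m n (F : R -> 'M[C]_(m, n)) (D : 'M[C]_(m, n)) :=
  forall i j, cderiv (fun t => F t i j) (D i j).

Lemma mxderiv_unique m n (F : R -> 'M[C]_(m, n)) D D' :
  mxderiv F D -> mxderiv F D' -> D = D'.
Proof. by move=> h h'; apply/matrixP => i j; exact: (cderiv_unique (h i j) (h' i j)). Qed.

Lemma mxderiv_cst m n (A : 'M[C]_(m, n)) : mxderiv (fun=> A) 0.
Proof. by move=> i j; rewrite mxE; exact: cderiv_cst. Qed.

Lemma mxderivM m n p (F : R -> 'M[C]_(m, n)) (G : R -> 'M[C]_(n, p)) D D' :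
  mxderiv F D -> mxderiv G D' ->
  mxderiv (fun t => F t *m G t) (D *m G 0 + F 0 *m D').
Proof.
move=> hF hG i j; rewrite !mxE -big_split /=.
under eq_fun do rewrite mxE.
by apply: cderiv_sum => k; exact: cderivM.
Qed.

Lemma mxderivMl m n p (A : 'M[C]_(m, n)) (G : R -> 'M[C]_(n, p)) D :
  mxderiv G D -> mxderiv (fun t => A *m G t) (A *m D).
Proof.
by move=> hG; have := mxderivM (mxderiv_cst A) hG; rewrite mul0mx add0r.
Qed.

Lemma mxderivMr m n p (A : 'M[C]_(n, p)) (F : R -> 'M[C]_(m, n)) D :
  mxderiv F D -> mxderiv (fun t => F t *m A) (D *m A).
Proof.
by move=> hF; have := mxderivM hF (mxderiv_cst A); rewrite mulmx0 addr0.
Qed.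

Lemma mxderivZ m n (c : R -> R) c' (A : 'M[C]_(m, n)) :
  is_derive (0 : R) (1 : R) c c' ->
  mxderiv (fun t => (c t)%:C *: A) (c'%:C *: A).
Proof.
move=> hc i j; under eq_fun do rewrite mxE.
have := cderivM (cderiv_real hc) (cderiv_cst (A i j)).
by rewrite mulr0 addr0 [in X in _ -> X]mxE.
Qed.

Lemma mxderiv_sum m n (I : Type) (r : seq I) (F : I -> R -> 'M[C]_(m, n)) D :
  (forall i, mxderiv (F i) (D i)) ->
  mxderiv (fun t => \sum_(i <- r) F i t) (\sum_(i <- r) D i).
Proof.
move=> h i j; rewrite summxE; under eq_fun do rewrite summxE.
by apply: cderiv_sum => k; exact: h.
Qed.

Lemma mxderiv_tC m n (F : R -> 'M[C]_(m, n)) D :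
  mxderiv F D -> mxderiv (fun t => (F t)^t*) (D^t*).
Proof.
by move=> h i j; rewrite !mxE; under eq_fun do rewrite !mxE; exact: cderiv_conj.
Qed.

End Derivative.

(** * Angular momentum in the [ket] basis and its transformation laws *)

Section SpinBasis.
Variables (R : realType) (N : nat) (Q : spin_system R N).
Local Notation C := R[i].
Local Notation M := 'M[C]_N.+1.
Implicit Types (g h : su2 R) (e : 3.-tuple R).

Definition ketmx : M := \matrix_(i, j) ket Q j i 0.

Lemma col_ketmx j : col j ketmx = ket Q j.
Proof. by apply/colP => i; rewrite !mxE. Qed.

Lemma ketmx_tCK : ketmx^t* *m ketmx = 1%:M.
Proof.
apply/matrixP => i j; have /matrixP /(_ 0 0) := ket_orthonormal Q i j.
rewrite !mxE => h; transitivity ((i == j)%:R *+ (0 == 0 :> 'I_1) : C); last first.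
  by rewrite eqxx mulr1n.
by rewrite -h; apply: eq_bigr => k _; rewrite !mxE.
Qed.

Lemma ketmxK : ketmx *m ketmx^t* = 1%:M.
Proof. exact: mulmx1C ketmx_tCK. Qed.

(** Operators are expressed in the eigenbasis [ket] of [L_3]. *)
Definition inket (X : M) : M := ketmx^t* *m X *m ketmx.

Lemma inketM X Y : inket (X *m Y) = inket X *m inket Y.
Proof. by rewrite /inket -!mulmxA (mulmxA ketmx) ketmxK mul1mx. Qed.

Lemma inket_tC X : inket (X^t*) = (inket X)^t*.
Proof. by rewrite /inket !trC_mul trmxCK mulmxA. Qed.

Lemma inket1 : inket 1%:M = 1%:M.
Proof. by rewrite /inket mulmx1 ketmx_tCK. Qed.

Lemma inketZ a X : inket (a *: X) = a *: inket X.
Proof. by rewrite /inket -scalemxAr -scalemxAl. Qed.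

Lemma inketD X Y : inket (X + Y) = inket X + inket Y.
Proof. by rewrite /inket mulmxDr mulmxDl. Qed.

Lemma inket_inj X Y : inket X = inket Y -> X = Y.
Proof.
move=> /(congr1 (fun Z => ketmx *m Z *m ketmx^t*)).
by rewrite /inket !mulmxA ketmxK !mul1mx -!mulmxA ketmxK !mulmx1.
Qed.

Lemma mxtrace_inket X : \tr (inket X) = \tr X.
Proof. by rewrite /inket mxtrace_mulC mulmxA ketmxK mul1mx. Qed.

Lemma inketE X i j : inket X i j = ((ket Q i)^t* *m X *m ket Q j) 0 0.
Proof.
rewrite /inket -!col_ketmx !mxE; apply: eq_bigr => k _; rewrite !mxE.
by congr (_ * _); apply: eq_bigr => l _; rewrite !mxE.
Qed.

Definition U g : M := inket (rep Q g).
Definition J a : M := inket (angmom Q a).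

Lemma inket_vdot e : inket (vdot e (angmom Q)) = vdot e J.
Proof. by rewrite !vdotE !inketD !inketZ. Qed.

Lemma U_mul g h : U (su2_mul g h) = U g *m U h.
Proof. by rewrite /U rep_mul inketM. Qed.

Lemma U_tC g : U g *m (U g)^t* = 1%:M.
Proof.
rewrite /U -inket_tC -inketM -inket1; congr inket.
exact/unitarymxP/rep_unitary.
Qed.

Lemma U_tCK g : (U g)^t* *m U g = 1%:M.
Proof. exact: mulmx1C (U_tC g). Qed.

Lemma U1 : U (su2_one R) = 1%:M.
Proof.
have := U_mul (su2_one R) (su2_one R); rewrite su2_mul1 => h.
by rewrite -[LHS]mulmx1 -(U_tC (su2_one R)) mulmxA -h.
Qed.

Lemma UV g : U (su2_inv g) = (U g)^t*.
Proof.
by rewrite -[LHS]mul1mx -(U_tCK g) -mulmxA -U_mul su2_mulV U1 mulmx1.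
Qed.

Lemma axis_rotation0 e (e1 : unit_vector e) : axis_rotation 0 e1 = su2_one R.
Proof.
apply: su2_inj; rewrite /= axis_mxq mul0r cos0 sin0 !mul0r !oppr0.
exact: qmx_id.
Qed.

Lemma U_deriv e (e1 : unit_vector e) :
  mxderiv (fun t => U (axis_rotation t e1)) (- 'i *: vdot e J).
Proof.
rewrite -inket_vdot -inketZ; apply: mxderivMr; apply: mxderivMl => i j.
exact: rep_generator.
Qed.

(** The product rule at [t = 0], applied to both sides of the intertwining relation. It turns
    covariance under finite rotations into commutators with the generators. *)
Lemma comm_of_intertwine e (e1 : unit_vector e) (I : finType) (c : I -> R -> R)
    (c' : I -> R) (B : I -> M) (A : M) :
  (forall i, is_derive (0 : R) (1 : R) (c i) (c' i)) ->
  \sum_i (c i 0)%:C *: B i = A ->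
  (forall t, U (axis_rotation t e1) *m A =
     (\sum_i (c i t)%:C *: B i) *m U (axis_rotation t e1)) ->
  ad (vdot e J) A = 'i *: \sum_i (c' i)%:C *: B i.
Proof.
move=> hc hA hU.
have d1 := mxderivMr A (U_deriv e1).
have d2 : mxderiv (fun t => (\sum_i (c i t)%:C *: B i) *m U (axis_rotation t e1))
    ((\sum_i (c' i)%:C *: B i) *m U (axis_rotation 0 e1)
     + (\sum_i (c i 0)%:C *: B i) *m (- 'i *: vdot e J)).
  by apply: mxderivM (U_deriv e1); apply: mxderiv_sum => i; exact: mxderivZ.
rewrite (_ : (fun t => _) = (fun t => U (axis_rotation t e1) *m A)) in d2; last first.
  by apply/funext => t; rewrite hU.
have := mxderiv_unique d1 d2; rewrite axis_rotation0 U1 mulmx1 hA.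
rewrite -scalemxAr -scalemxAl => /(congr1 (fun X => 'i *: X)).
rewrite scalerDr !scalerA mulrN -expr2 sqr_i opprK !scale1r => h.
by rewrite /ad h addrK.
Qed.

Definition bvec (a : 'I_3) : 3.-tuple R := [tuple (j == a)%:R | j < 3].

Lemma tnth_bvec a j : tnth (bvec a) j = (j == a)%:R.
Proof. by rewrite tnth_mktuple. Qed.

Lemma unit_bvec a : unit_vector (bvec a).
Proof.
rewrite /unit_vector dotE !tnth_bvec.
by move: a; apply: I3_ind => /=; ring.
Qed.

Lemma vdot_bvec (F : 'I_3 -> M) a : vdot (bvec a) F = F a.
Proof.
rewrite /vdot (bigD1 a) //= big1 => [|k ka]; rewrite tnth_bvec.
  by rewrite eqxx scale1r addr0.
by rewrite (negPf ka) scale0r.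
Qed.

Lemma north_bvec : north R = bvec o2.
Proof. by apply: tuple3_eq => j; rewrite !tnth_mktuple ord_max3. Qed.

Lemma tnth_rotation_bvec g j b : tnth (rotation g (bvec b)) j = rotation_mx g j b.
Proof.
rewrite tnth_rotation (bigD1 b) //= big1 => [|k kb]; rewrite tnth_bvec.
  by rewrite eqxx mulr1 addr0.
by rewrite (negPf kb) mulr0.
Qed.

Lemma cross_op_sum (a b : 'I_3) (F : 'I_3 -> M) :
  'i *: \sum_k (crossmx (bvec a) k b)%:C *: F k = cross_op a b F.
Proof.
rewrite sumI3; move: b; apply: I3_ind; move: a; apply: I3_ind;
rewrite /crossmx /cross_op /= ?tnth_bvec /=
  ?oppr0 ?rmorphN ?rmorph1 ?rmorph0 ?scaleN1r ?scale1r ?scale0r ?addr0 ?add0r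
  ?scalerN ?scaler0 //.
Qed.

(** Obtained by differentiating $U_tU_t^*=1$ at the identity. *)
Lemma J_herm a : (J a)^t* = J a.
Proof.
have d := U_deriv (unit_bvec a); rewrite vdot_bvec in d.
have := mxderivM d (mxderiv_tC d); rewrite /= axis_rotation0 U1 trmx1 map_mx1 mulmx1 mul1mx.
under eq_fun do rewrite U_tC.
move=> /mxderiv_unique /(_ (mxderiv_cst _)) /eqP.
rewrite linearZ /= map_mxZ /= rmorphN /= conjCi opprK scaleNr addrC subr_eq0.
by move=> /eqP /scalerI; apply; exact: neq0Ci.
Qed.

(** For a basis vector both sides come, up to the factor $-i$, from differentiating one curve
    written in two ways by [axis_conj]; the general case follows by linearity. *)
Lemma U_J g e : U g *m vdot e J = vdot (rotation g e) J *m U g.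
Proof.
have h a : U g *m J a = vdot (rotation g (bvec a)) J *m U g.
  have d1 := mxderivMl (U g) (U_deriv (unit_bvec a)).
  have d2 := mxderivMr (U g) (U_deriv (rotation_unit g (unit_bvec a))).
  rewrite (_ : (fun t => _) = fun t => U g *m U (axis_rotation t (unit_bvec a))) in d2.
    have := mxderiv_unique d1 d2; rewrite -scalemxAr -scalemxAl vdot_bvec.
    by move=> /scalerI; apply; rewrite oppr_eq0; exact: neq0Ci.
  by apply/funext => t; rewrite -!U_mul axis_conj.
rewrite {1}/vdot mulmx_sumr; under eq_bigr do rewrite -scalemxAr h /vdot mulmx_suml scaler_sumr.
rewrite exchange_big /vdot mulmx_suml; apply: eq_bigr => k _ /=.
rewrite tnth_rotation rmorph_sum /= scaler_suml mulmx_suml; apply: eq_bigr => l _.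
by rewrite tnth_rotation_bvec rmorphM /= mulrC -!scalemxAl scalerA.
Qed.

Lemma rotation_mx_axis0 e (e1 : unit_vector e) j k :
  rotation_mx (axis_rotation 0 e1) j k = (j == k)%:R.
Proof. by rewrite axis_rotation0 rotation_mx1 mxE. Qed.

Lemma vector_opP (A : 'I_3 -> M) :
  (forall g b, U g *m A b = (\sum_k (rotation_mx g k b)%:C *: A k) *m U g) ->
  vector_op J A.
Proof.
move=> hA a b; rewrite -cross_op_sum -[J a]vdot_bvec.
apply: (comm_of_intertwine (e1 := unit_bvec a)
  (c := fun k t => rotation_mx (axis_rotation t (unit_bvec a)) k b)).
- by move=> k; exact: is_derive_rotation.
- rewrite (bigD1 b) //= big1 => [|k kb]; rewrite rotation_mx_axis0.
    by rewrite eqxx scale1r addr0.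
  by rewrite (negPf kb) scale0r.
- by move=> t; exact: hA.
Qed.

Lemma tensor_opP (B : 'I_3 -> 'I_3 -> M) :
  (forall g b c, U g *m B b c = (\sum_(p : 'I_3 * 'I_3)
     (rotation_mx g p.1 b * rotation_mx g p.2 c)%:C *: B p.1 p.2) *m U g) ->
  tensor_op J B.
Proof.
move=> hB a b c; rewrite -!cross_op_sum -[J a]vdot_bvec.
set e1 := unit_bvec a.
pose I := ('I_3 * 'I_3)%type.
apply: etrans (@comm_of_intertwine _ e1 I
  (fun (p : 'I_3 * 'I_3) t => rotation_mx (axis_rotation t e1) p.1 b
                       * rotation_mx (axis_rotation t e1) p.2 c)
  (fun p => crossmx (bvec a) p.1 b * (p.2 == c)%:R + (p.1 == b)%:R * crossmx (bvec a) p.2 c)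
  (fun p => B p.1 p.2) (B b c) _ _ _) _; last first.
- rewrite -scalerDr; congr (_ *: _).
  rewrite -(pair_bigA_idem _ (fun k l => (crossmx (bvec a) k b * (l == c)%:R
    + (k == b)%:R * crossmx (bvec a) l c)%:C *: B k l)) /= ?addr0 //.
  under eq_bigr => k _ do under eq_bigr => l _ do rewrite rmorphD /= scalerDl.
  under eq_bigr do rewrite big_split /=.
  rewrite big_split /=; congr (_ + _).
    apply: eq_bigr => k _; rewrite (bigD1 c) //= big1 => [|l lc].
      by rewrite eqxx mulr1 addr0.
    by rewrite (negPf lc) mulr0 scale0r.
  rewrite exchange_big /=; apply: eq_bigr => k _; rewrite (bigD1 b) //= big1 => [|l lb].
    by rewrite eqxx mul1r addr0.
  by rewrite (negPf lb) mul0r scale0r.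
- by move=> t; exact: hB.
- rewrite (bigD1 (b, c)) //= big1 => [|[k l] kl]; rewrite !rotation_mx_axis0.
    by rewrite !eqxx mulr1 scale1r addr0.
  by move: kl; rewrite xpair_eqE /= -natrM mulnb => /negPf ->; rewrite scale0r.
- move=> [k l] /=.
  have d1 := is_derive_rotation e1 k b; have d2 := is_derive_rotation e1 l c.
  by apply: is_derive_eq; rewrite /GRing.scale /= !rotation_mx_axis0; ring.
Qed.

Lemma J_vector : vector_op J J.
Proof.
apply: vector_opP => g b; rewrite -[X in U g *m X]vdot_bvec U_J.
by congr (_ *m _); apply: eq_bigr => k _; rewrite tnth_rotation_bvec.
Qed.

Lemma comm_U_ad (A : M) e (e1 : unit_vector e) :
  (forall t, U (axis_rotation t e1) *m A = A *m U (axis_rotation t e1)) ->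
  ad (vdot e J) A = 0.
Proof.
move=> hA; apply: etrans (@comm_of_intertwine _ e1 'I_1 (fun _ => cst 1) (fun=> 0) (fun=> A) A _ _ _) _; last first.
- by rewrite big_ord1 scale0r scaler0.
- by move=> t; rewrite big_ord1 scale1r hA.
- by rewrite big_ord1 scale1r.
Qed.

Lemma magneticE (j : 'I_N.+1) : (magnetic R j)%:C = j%:R - N%:R / 2 :> C.
Proof. by rewrite /magnetic /spin rmorphB /= fmorph_div /= !rmorph_nat. Qed.

Lemma J_diagm i j : J o2 i j = (magnetic R j)%:C *+ (i == j).
Proof.
rewrite /J inketE -ord_max3 -mulmxA ket_eigen -scalemxAr mxE ket_orthonormal mxE.
by rewrite eqxx mulr1n; case: (i == j); rewrite ?mulr1 ?mulr0.
Qed.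

Lemma J_diag i j : J o2 i j = (j%:R - N%:R / 2) *+ (i == j).
Proof. by rewrite J_diagm magneticE. Qed.

End SpinBasis.

(** * Bounded measurable functions and complex integrals *)

Section BoundedMeasurable.
Context d (T : measurableType d) (R : realType).
Local Notation C := R[i].

(** A class closed under the ring operations and integrable for every finite measure, so that
    integrability conditions reduce to the shape of the integrand. *)
Definition bmf (f : T -> R) :=
  measurable_fun setT f /\ exists M, forall x, `|f x| <= M.

Lemma bmf_cst c : bmf (fun=> c).
Proof. by split; [exact: measurable_cst|exists `|c|]. Qed.

Lemma bmfD f g : bmf f -> bmf g -> bmf (fun x => f x + g x).
Proof.
move=> [mf [M fM]] [mg [M' gM]]; split; first exact: measurable_funD.
by exists (M + M') => x; rewrite (le_trans (ler_normD _ _)) // lerD.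
Qed.

Lemma bmfN f : bmf f -> bmf (fun x => - f x).
Proof.
move=> [mf [M fM]]; split; first exact: measurable_funN.
by exists M => x; rewrite normrN.
Qed.

Lemma bmfB f g : bmf f -> bmf g -> bmf (fun x => f x - g x).
Proof. by move=> hf /bmfN; exact: bmfD. Qed.

Lemma bmfM f g : bmf f -> bmf g -> bmf (fun x => f x * g x).
Proof.
move=> [mf [M fM]] [mg [M' gM]]; split; first exact: measurable_funM.
by exists (M * M') => x; rewrite normrM ler_pM.
Qed.

Lemma bmfX f n : bmf f -> bmf (fun x => f x ^+ n).
Proof.
move=> hf; elim: n => [|n IH]; first exact: bmf_cst.
by under eq_fun do rewrite exprS; exact: bmfM.
Qed.

Lemma bmf_sum I (r : seq I) (f : I -> T -> R) : (forall i, bmf (f i)) ->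
  bmf (fun x => \sum_(i <- r) f i x).
Proof.
move=> h; elim: r => [|i r IH].
  by under eq_fun do rewrite big_nil; exact: bmf_cst.
by under eq_fun do rewrite big_cons; exact: bmfD.
Qed.

Lemma bmf_indic (A : set T) : measurable A -> bmf (\1_A : T -> R).
Proof.
move=> mA; split; first exact: measurable_indic.
by exists 1 => x; rewrite indicE; case: (x \in A); rewrite ?normr1 ?normr0.
Qed.

Lemma bmf_integrable (mu : {finite_measure set T -> \bar R}) f :
  bmf f -> mu.-integrable setT (EFin \o f).
Proof.
move=> [mf [M fM]]; apply: measurable_bounded_integrable => //.
  by rewrite fin_num_fun_lty //; exact: fin_num_measure.
exists M; split; first exact: num_real.
by move=> y My x _ /=; rewrite (le_trans (fM x)) // ltW.
Qed.

Definition cbmf (f : T -> C) :=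
  bmf (fun x => complex.Re (f x)) /\ bmf (fun x => complex.Im (f x)).

Lemma cbmf_cst c : cbmf (fun=> c).
Proof. by split; exact: bmf_cst. Qed.

Lemma cbmfD f g : cbmf f -> cbmf g -> cbmf (fun x => f x + g x).
Proof.
move=> [f1 f2] [g1 g2]; split.
  by under eq_fun do rewrite raddfD; exact: bmfD.
by under eq_fun do rewrite raddfD; exact: bmfD.
Qed.

Lemma ReM (x y : C) : complex.Re (x * y) =
  complex.Re x * complex.Re y - complex.Im x * complex.Im y.
Proof. by case: x => ? ?; case: y. Qed.

Lemma ImM (x y : C) : complex.Im (x * y) =
  complex.Re x * complex.Im y + complex.Im x * complex.Re y.
Proof. by case: x => ? ?; case: y. Qed.

Lemma Re_conj (x : C) : complex.Re (x^*%R) = complex.Re x.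
Proof. by case: x. Qed.

Lemma Im_conj (x : C) : complex.Im (x^*%R) = - complex.Im x.
Proof. by case: x. Qed.

Lemma cbmfM f g : cbmf f -> cbmf g -> cbmf (fun x => f x * g x).
Proof.
move=> [f1 f2] [g1 g2]; split.
  by under eq_fun do rewrite ReM; apply: bmfB; exact: bmfM.
by under eq_fun do rewrite ImM; apply: bmfD; exact: bmfM.
Qed.

Lemma cbmf_conj f : cbmf f -> cbmf (fun x => (f x)^*%R).
Proof.
move=> [f1 f2]; split.
  by under eq_fun do rewrite Re_conj.
by under eq_fun do rewrite Im_conj; exact: bmfN.
Qed.

Lemma cbmf_sum I (r : seq I) (f : I -> T -> C) : (forall i, cbmf (f i)) ->
  cbmf (fun x => \sum_(i <- r) f i x).
Proof.
move=> h; elim: r => [|i r IH].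
  by under eq_fun do rewrite big_nil; exact: cbmf_cst.
by under eq_fun do rewrite big_cons; exact: cbmfD.
Qed.

Lemma cbmf_real f : bmf f -> cbmf (fun x => (f x)%:C).
Proof. by move=> hf; split => //=; exact: bmf_cst. Qed.

Variable mu : probability T R.

Definition cint (f : T -> C) : C :=
  (\int[mu]_x complex.Re (f x)) +i* (\int[mu]_x complex.Im (f x)).

Lemma bintD f g : bmf f -> bmf g ->
  \int[mu]_x (f x + g x) = \int[mu]_x f x + \int[mu]_x g x.
Proof. by move=> hf hg; rewrite RintegralD //; exact: bmf_integrable. Qed.

Lemma bintZ c f : bmf f -> \int[mu]_x (c * f x) = c * \int[mu]_x f x.
Proof. by move=> hf; rewrite RintegralZl //; exact: bmf_integrable. Qed.

Lemma bint_cst c : \int[mu]_x (c : R) = c.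
Proof.
have m1 : fine (mu setT) = 1 by rewrite probability_setT.
by rewrite Rintegral_cst // m1 mulr1.
Qed.

Lemma bintN f : bmf f -> \int[mu]_x (- f x) = - \int[mu]_x f x.
Proof.
move=> hf; rewrite -mulN1r -bintZ //.
by apply: eq_Rintegral => x _; rewrite mulN1r.
Qed.

Lemma bintB f g : bmf f -> bmf g ->
  \int[mu]_x (f x - g x) = \int[mu]_x f x - \int[mu]_x g x.
Proof. by move=> hf hg; rewrite bintD ?bintN //; exact: bmfN. Qed.

Lemma bint_sum I (r : seq I) (f : I -> T -> R) : (forall i, bmf (f i)) ->
  \int[mu]_x (\sum_(i <- r) f i x) = \sum_(i <- r) \int[mu]_x f i x.
Proof.
move=> h; elim: r => [|i r IH].
  by under eq_Rintegral do rewrite big_nil; rewrite bint_cst big_nil.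
under eq_Rintegral do rewrite big_cons.
by rewrite bintD // ?IH ?big_cons //; exact: bmf_sum.
Qed.

Lemma cintD f g : cbmf f -> cbmf g -> cint (fun x => f x + g x) = cint f + cint g.
Proof.
move=> [f1 f2] [g1 g2]; apply: complex_eq => /=.
  by under eq_Rintegral do rewrite raddfD /=; rewrite bintD.
by under eq_Rintegral do rewrite raddfD /=; rewrite bintD.
Qed.

Lemma cintZ c f : cbmf f -> cint (fun x => c * f x) = c * cint f.
Proof.
move=> [f1 f2]; apply: complex_eq => /=; rewrite ?ReM ?ImM /=.
  under eq_Rintegral do rewrite ReM.
  by rewrite bintB ?bintZ //; apply: bmfM => //; exact: bmf_cst.
under eq_Rintegral do rewrite ImM.
by rewrite bintD ?bintZ //; apply: bmfM => //; exact: bmf_cst.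
Qed.

Lemma cint_sum I (r : seq I) (f : I -> T -> C) : (forall i, cbmf (f i)) ->
  cint (fun x => \sum_(i <- r) f i x) = \sum_(i <- r) cint (f i).
Proof.
move=> h; elim: r => [|i r IH].
  rewrite big_nil; apply: complex_eq => /=;
  by under eq_Rintegral do rewrite big_nil /=; rewrite bint_cst.
rewrite big_cons -IH -cintD //; last exact: cbmf_sum.
by congr cint; apply/funext => x; rewrite big_cons.
Qed.

Lemma cint_real f : cint (fun x => (f x)%:C) = (\int[mu]_x f x)%:C.
Proof. by apply: complex_eq => //=; rewrite bint_cst. Qed.

End BoundedMeasurable.

(** * Measurability on SU(2) *)

Section SU2Measurable.
Variable R : realType.
Local Notation T := (SU2 R).

Lemma measurable_coord : measurable_fun setT (@su2_coord R : T -> 4.-tuple R).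
Proof. by move=> _ Y mY; exists Y. Qed.

Lemma measurable_coordj j : measurable_fun setT (fun g : T => tnth (su2_coord g) j).
Proof.
apply: (@measurableT_comp _ _ _ _ _ _ (fun x : 4.-tuple R => tnth x j)).
  exact: measurable_tnth.
exact: measurable_coord.
Qed.

Definition c0 : 'I_4 := @Ordinal 4 0 isT.
Definition c1 : 'I_4 := @Ordinal 4 1 isT.
Definition c2 : 'I_4 := @Ordinal 4 2 isT.
Definition c3 : 'I_4 := @Ordinal 4 3 isT.

Lemma I4_ind (P : 'I_4 -> Prop) : P c0 -> P c1 -> P c2 -> P c3 -> forall j, P j.
Proof.
move=> P0 P1 P2 P3 [[|[|[|[|//]]]] lt].
- by rewrite (_ : Ordinal lt = c0) //; apply/val_inj.
- by rewrite (_ : Ordinal lt = c1) //; apply/val_inj.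
- by rewrite (_ : Ordinal lt = c2) //; apply/val_inj.
- by rewrite (_ : Ordinal lt = c3) //; apply/val_inj.
Qed.

Lemma su2_coordq (g : su2 R) : let x := su2_coord g in
  su2mx g = qmx (tnth x c0) (tnth x c3) (tnth x c2) (tnth x c1).
Proof. by rewrite /= !(tnth_nth 0) /=; have [] := su2P g. Qed.

Lemma su2_coord_norm (g : su2 R) : let x := su2_coord g in
  tnth x c0 ^+ 2 + tnth x c3 ^+ 2 + tnth x c2 ^+ 2 + tnth x c1 ^+ 2 = 1.
Proof. by rewrite /= !(tnth_nth 0) /=; have [] := su2P g. Qed.

Lemma su2_coord_le1 (g : su2 R) j : `|tnth (su2_coord g) j| <= 1.
Proof.
have := su2_coord_norm g; rewrite /=; move: j.
by apply: I4_ind; move: (tnth _ c0) (tnth _ c1) (tnth _ c2) (tnth _ c3) => w x y z n1;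
  rewrite ler_norml; apply/andP; split; nra.
Qed.

Lemma bmf_coord j : bmf (fun g : T => tnth (su2_coord g) j).
Proof. by split; [exact: measurable_coordj|exists 1 => g; exact: su2_coord_le1]. Qed.

Lemma bmf_rotation j k : bmf (fun g : T => rotation_mx g j k).
Proof.
under eq_fun do rewrite (rotation_mxE (su2_coordq _)).
by move: k; apply: I3_ind; move: j; apply: I3_ind; rewrite /rotq /=;
  do ?[exact: bmf_cst|exact: bmf_coord|apply: bmfX|apply: bmfB|apply: bmfD|apply: bmfM].
Qed.

Lemma normc_lt (z : R[i]) (d : R) : 0 < d ->
  `|complex.Re z| < d / 2 -> `|complex.Im z| < d / 2 -> `|z| < d%:C.
Proof.
case: z => a b /= d0 ha hb; rewrite normc_def ltcR.
rewrite -[ltRHS]ger0_norm ?(ltW d0) // -sqrtr_sqr ltr_sqrt ?exprn_gt0 //.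
rewrite -(real_normK (num_real a)) -(real_normK (num_real b)).
have := normr_ge0 a; have := normr_ge0 b; move: ha hb.
move: `|a| `|b| => x y; nra.
Qed.

(** The sigma-algebra of [SU2] is generated by coordinates, so measurability of a continuous
    function has to be shown: the preimage of an open ray is the union of the countably many
    rational coordinate boxes that it contains. *)
Lemma measurable_su2 (f : su2 R -> R) :
  (forall (g : su2 R) (eps : R), 0 < eps -> exists2 delta : R, 0 < delta &
     forall h : su2 R, (forall i j, `|h i j - g i j| < delta%:C) ->
       `|f h - f g| < eps) ->
  measurable_fun setT (f : T -> R).
Proof.
move=> fc; apply: (@measurability _ _ T R setT f _ (RGenOInfty.measurableE R)).
move=> _ [_ [r ->] <-]; rewrite setTI.
pose box (p : {ffun 'I_4 -> rat * rat}) : set T :=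
  [set g | forall j, ratr (p j).1 < tnth (su2_coord g) j < ratr (p j).2].
pose F p := if `[< box p `<=` f @^-1` `]r, +oo[%classic >] then box p else set0.
have -> : f @^-1` `]r, +oo[%classic = \bigcup_p F p.
  apply/seteqP; split=> [g|g [p _]]; last first.
    by rewrite /F; case: asboolP => // h; exact: h.
  rewrite /= in_itv /= andbT => rg.
  have [d d0 hd] := fc g (f g - r) ltac:(by rewrite subr_gt0).
  pose x := su2_coord g.
  have hq j : exists p : rat * rat, [&& tnth x j - d / 4 < ratr p.1,
     ratr p.1 < tnth x j, tnth x j < ratr p.2 & ratr p.2 < tnth x j + d / 4].
    have [p1] := @rat_in_itvoo _ (tnth x j - d / 4) (tnth x j) ltac:(lra).
    have [p2] := @rat_in_itvoo _ (tnth x j) (tnth x j + d / 4) ltac:(lra).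
    rewrite !in_itv /= => /andP[h1 h2] /andP[h3 h4].
    by exists (p1, p2); apply/and4P.
  have [p hp] := choice hq.
  exists [ffun j => p j] => //; rewrite /F; case: asboolP => [_ j|]; last first.
    case=> h hh; rewrite /= in_itv /= andbT.
    have : `|f h - f g| < f g - r.
      have k j : `|tnth (su2_coord h) j - tnth x j| < d / 2.
        have := hh j; rewrite ffunE; case/and4P: (hp j) => ? ? ? ? /andP[? ?].
        by rewrite ltr_norml; apply/andP; split; lra.
      have kN j : `|- tnth (su2_coord h) j - - tnth x j| < d / 2.
        by rewrite -opprD normrN.
      by apply: hd => i j; apply: normc_lt => //; rewrite (su2_coordq h) (su2_coordq g) !mxE;
        case: (i == 0); case: (j == 0) => /=; first [exact: k|exact: kN].
    by rewrite ltr_norml => /andP[]; lra.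
  by rewrite ffunE; case/and4P: (hp j) => _ -> ->.
apply: countable_bigcupT_measurable => [|p]; first exact: countableP.
rewrite /F; case: asboolP => // _.
rewrite (_ : box p = \bigcap_(j in setT) [set g : T | ratr (p j).1 < tnth (su2_coord g) j < ratr (p j).2]).
  apply: fin_bigcap_measurable => [|j _]; first exact: finite_finset.
  rewrite (_ : [set _ | _] = (fun g : T => tnth (su2_coord g) j) @^-1`
     `]ratr (p j).1, ratr (p j).2[%classic); last first.
    by apply/seteqP; split => g /=; rewrite in_itv.
  by rewrite -[X in measurable X]setTI; apply: measurable_coordj.
by apply/seteqP; split => g /= h j; [move=> _|]; exact: h.
Qed.

Lemma normc_gt (z : R[i]) (d : R) : `|z| < d%:C ->
  `|complex.Re z| < d /\ `|complex.Im z| < d.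
Proof.
case: z => a b /=; rewrite normc_def ltcR => h; split; apply: le_lt_trans h;
by rewrite -sqrtr_sqr ler_wsqrtr // ?lerDl ?lerDr sqr_ge0.
Qed.

Variables (N : nat) (Q : spin_system R N).

(** Measurable by [rep_continuous], and bounded by 1 because the rows of a unitary matrix have norm
    1. *)
Lemma cbmf_rep i j : cbmf (fun g : T => rep Q g i j).
Proof.
have bnd (g : su2 R) : complex.Re (rep Q g i j) ^+ 2 + complex.Im (rep Q g i j) ^+ 2 <= 1.
  have /unitarymxP /matrixP /(_ i i) := rep_unitary Q g.
  rewrite !mxE eqxx => /(congr1 (@complex.Re R)) /=.
  rewrite (raddf_sum (@complex.Re R : {additive _ -> _})) (bigD1 j) //= => <-.
  rewrite !mxE; set u := rep Q g i j.
  have -> : complex.Re (u * u^*%R) = complex.Re u ^+ 2 + complex.Im u ^+ 2.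
    by rewrite ReM Re_conj Im_conj; ring.
  rewrite lerDl sumr_ge0 // => k _; rewrite !mxE ReM Re_conj Im_conj mulrN opprK.
  by rewrite -!expr2 addr_ge0 ?sqr_ge0.
split; split.
- apply: measurable_su2 => g eps /(rep_continuous Q g)[d d0 hd].
  exists d => // h /hd /(_ i j) /normc_gt[+ _].
  by rewrite (raddfB (@complex.Re R : {additive _ -> _})).
- exists 1 => g; move: (bnd g) (sqr_ge0 (complex.Im (rep Q g i j))) => b1 b2.
  by rewrite ler_norml; apply/andP; split; nra.
- apply: measurable_su2 => g eps /(rep_continuous Q g)[d d0 hd].
  exists d => // h /hd /(_ i j) /normc_gt[_ +].
  by rewrite (raddfB (@complex.Im R : {additive _ -> _})).
- exists 1 => g; move: (bnd g) (sqr_ge0 (complex.Re (rep Q g i j))) => b1 b2.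
  by rewrite ler_norml; apply/andP; split; nra.
Qed.

Lemma cbmf_mx_mul m n p (F : T -> 'M[R[i]]_(m, n)) (G : T -> 'M[R[i]]_(n, p)) :
  (forall i j, cbmf (fun g => F g i j)) -> (forall i j, cbmf (fun g => G g i j)) ->
  forall i j, cbmf (fun g => (F g *m G g) i j).
Proof.
move=> hF hG i j; under eq_fun do rewrite mxE.
by apply: cbmf_sum => k; exact: cbmfM.
Qed.

Lemma cbmf_U i j : cbmf (fun g : T => U Q g i j).
Proof.
apply: cbmf_mx_mul; last by move=> *; exact: cbmf_cst.
by apply: cbmf_mx_mul; [move=> *; exact: cbmf_cst|exact: cbmf_rep].
Qed.

Lemma cbmf_UtC i j : cbmf (fun g : T => (U Q g)^t* i j).
Proof.
rewrite (_ : (fun g => _) = fun g : T => (U Q g j i)^*%R).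
  by apply: cbmf_conj; exact: cbmf_U.
by apply/funext => g; rewrite mxE mxE.
Qed.

Lemma measurable_su2_mul (g : su2 R) :
  measurable_fun setT (fun h : T => su2_mul g h : T).
Proof.
have m : measurable_fun setT (fun h : T => su2_coord (su2_mul g h)).
  apply/measurable_fun_tnthP => j.
  have E (h : T) : tnth (su2_coord (su2_mul g h)) j =
     let x := su2_coord h in let y := su2_coord g in
     let a := tnth y c0 in let x' := tnth x c3 in let y' := tnth x c2 in
     let z' := tnth x c1 in let a' := tnth x c0 in
     let xx := tnth y c3 in let yy := tnth y c2 in let zz := tnth y c1 in
     nth 0 [:: a * a' - xx * x' - yy * y' - zz * z';
         a * z' + a' * zz - xx * y' + yy * x';
         a * y' + a' * yy - zz * x' + xx * z';
         a * x' + a' * xx - yy * z' + zz * y'] j.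
    rewrite [in LHS](tnth_nth 0) /= (su2_coordq g) (su2_coordq h) qmx_mul !mxE /=.
    by move: j; apply: I4_ind.
  apply: (@eq_measurable_fun _ _ _ _ _ (fun h : T => _)) => [h _|]; first by rewrite /= E.
  have m' k : measurable_fun setT (fun h : T => tnth (su2_coord h) k) by exact: measurable_coordj.
  by move: j {E}; apply: I4_ind => /=;
    do ?[exact: m'|apply: measurable_funD|apply: measurable_funN|
         apply: measurable_funM|exact: measurable_cst].
move=> _ S [B mB <-]; rewrite setTI.
have := m measurableT B mB.
by rewrite setTI => h; rewrite setTI /preimage /=; exact: h.
Qed.

End SU2Measurable.

(** * Left invariance of Haar integrals *)

Section Haar.
Variables (R : realType) (H : probability (SU2 R) R) (Hinv : haar_measure H).
Local Notation T := (SU2 R).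

Lemma haar_int (g : su2 R) (f : T -> R) : bmf f ->
  \int[H]_h f (su2_mul g h) = \int[H]_h f h.
Proof.
move=> hf; rewrite /Rintegral; congr fine.
have mL := measurable_su2_mul g.
pose mx := isMeasurableFun.Build _ _ _ _ _ mL.
pose phi : {mfun T >-> T} := HB.pack (fun h : T => su2_mul g h : T) mx.
transitivity (\int[pushforward H phi]_x (f x)%:E)%E.
  rewrite integral_pushforward //=.
    apply/measurable_EFinP; exact: hf.1.
  rewrite preimage_setT; apply: bmf_integrable; split.
    exact: (measurableT_comp hf.1 mL).
  by have [M hM] := hf.2; exists M.
by apply: eq_measure_integral => A mA _; exact: (Hinv g mA).
Qed.

Lemma haar_cint (g : su2 R) (f : T -> R[i]) : cbmf f ->
  cint H (fun h => f (su2_mul g h)) = cint H f.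
Proof. by move=> [f1 f2]; apply: complex_eq => /=; exact: haar_int. Qed.

End Haar.

(** * Second and fourth moments of a Haar-random direction *)

Section ColumnMoments.
Variables (R : realType) (H : probability (SU2 R) R) (Hinv : haar_measure H).
Local Notation T := (SU2 R).

(** The coordinates of the rotated north pole; [ez o2] is the cosine of its polar angle. *)
Definition ez (j : 'I_3) (g : T) : R := rotation_mx g j o2.

Lemma bmf_ez j : bmf (ez j).
Proof. exact: bmf_rotation. Qed.

Lemma ezM j (g h : su2 R) : ez j (su2_mul g h) = \sum_k rotation_mx g j k * ez k h.
Proof. by rewrite /ez rotation_mx_mul mxE. Qed.

Lemma ez_norm (g : T) : ez o0 g ^+ 2 + ez o1 g ^+ 2 + ez o2 g ^+ 2 = 1.
Proof.
have := rotation_unit g (@unit_north R).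
by rewrite /unit_vector dotE !tnth_rotation_north -!expr2.
Qed.

(** The quaternion with four equal coordinates is a third of a turn about the diagonal, permuting
    the axes cyclically. *)
Lemma quarter_norm : (1 / 2 : R) ^+ 2 + (1 / 2) ^+ 2 + (1 / 2) ^+ 2 + (1 / 2) ^+ 2 = 1.
Proof. by field. Qed.

Lemma ez_cycle (h : T) j : ez j (su2_mul (mkq quarter_norm) h) =
  ez (nth o0 [:: o1; o2; o0] j) h.
Proof.
rewrite ezM sumI3 !(@rotation_mxE _ (mkq quarter_norm) _ _ _ _ erefl) /rotq.
by move: j; apply: I3_ind => /=; field.
Qed.

(** A rational rotation about the third axis, with cosine $-7/25$ and sine $\pm24/25$ (the other
    sign is in [pyth_normN]); it relates the fourth moments. *)
Lemma pyth_norm : (3 / 5 : R) ^+ 2 + 0 ^+ 2 + 0 ^+ 2 + (4 / 5) ^+ 2 = 1.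
Proof. by field. Qed.

Lemma pyth_normN : (3 / 5 : R) ^+ 2 + 0 ^+ 2 + 0 ^+ 2 + (- (4 / 5)) ^+ 2 = 1.
Proof. by field. Qed.

Lemma int_cycle (f : R -> R -> R -> R) :
  bmf (fun g : T => f (ez o0 g) (ez o1 g) (ez o2 g)) ->
  \int[H]_g f (ez o0 g) (ez o1 g) (ez o2 g) =
  \int[H]_g f (ez o1 g) (ez o2 g) (ez o0 g).
Proof.
move=> hf; rewrite -(haar_int Hinv (mkq quarter_norm) hf).
by apply: eq_Rintegral => g _; rewrite !ez_cycle.
Qed.

Ltac bmf_tac := do ?[exact: bmf_cst|exact: bmf_ez|apply: bmfX|apply: bmfB
  |apply: bmfD|apply: bmfM].

Lemma int_ez2 : \int[H]_g ez o2 g ^+ 2 = 1 / 3.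
Proof.
have e1 : \int[H]_g ez o0 g ^+ 2 = \int[H]_g ez o1 g ^+ 2.
  by apply: (int_cycle (f := fun x y z => x ^+ 2)); bmf_tac.
have e2 : \int[H]_g ez o1 g ^+ 2 = \int[H]_g ez o2 g ^+ 2.
  by apply: (int_cycle (f := fun x y z => y ^+ 2)); bmf_tac.
have : \int[H]_g (ez o0 g ^+ 2 + ez o1 g ^+ 2 + ez o2 g ^+ 2) = 1.
  by under eq_Rintegral do rewrite ez_norm; exact: bint_cst.
by rewrite !bintD; bmf_tac; rewrite e1 e2; lra.
Qed.

(** Cyclic symmetry leaves one pure moment $A$ and one mixed moment $B$, with $3A+6B=1$ from the
    unit norm. Invariance under a rotation by an angle that is no multiple of a quarter turn gives
    $A=3B$, hence $A=1/5$. *)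
Lemma int_ez4 : \int[H]_g ez o2 g ^+ 4 = 1 / 5.
Proof.
have e1 : \int[H]_g ez o0 g ^+ 4 = \int[H]_g ez o1 g ^+ 4.
  by apply: (int_cycle (f := fun x y z => x ^+ 4)); bmf_tac.
have e2 : \int[H]_g ez o1 g ^+ 4 = \int[H]_g ez o2 g ^+ 4.
  by apply: (int_cycle (f := fun x y z => y ^+ 4)); bmf_tac.
have f1 : \int[H]_g (ez o0 g ^+ 2 * ez o1 g ^+ 2) = \int[H]_g (ez o1 g ^+ 2 * ez o2 g ^+ 2).
  by apply: (int_cycle (f := fun x y z => x ^+ 2 * y ^+ 2)); bmf_tac.
have f2 : \int[H]_g (ez o1 g ^+ 2 * ez o2 g ^+ 2) = \int[H]_g (ez o2 g ^+ 2 * ez o0 g ^+ 2).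
  by apply: (int_cycle (f := fun x y z => y ^+ 2 * z ^+ 2)); bmf_tac.
have s : \int[H]_g (ez o0 g ^+ 4 + ez o1 g ^+ 4 + ez o2 g ^+ 4 +
   2 * (ez o0 g ^+ 2 * ez o1 g ^+ 2) + 2 * (ez o1 g ^+ 2 * ez o2 g ^+ 2)
   + 2 * (ez o2 g ^+ 2 * ez o0 g ^+ 2)) = 1.
  rewrite -[RHS](bint_cst H); apply: eq_Rintegral => g _.
  transitivity ((ez o0 g ^+ 2 + ez o1 g ^+ 2 + ez o2 g ^+ 2) ^+ 2); first by ring.
  by rewrite ez_norm expr1n.
have b40 : bmf (fun g : T => ez o0 g ^+ 4) by bmf_tac.
have bp : bmf (fun g : T => (- (7 / 25) * ez o0 g + 24 / 25 * ez o1 g) ^+ 4) by bmf_tac.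
have bm : bmf (fun g : T => (- (7 / 25) * ez o0 g - 24 / 25 * ez o1 g) ^+ 4) by bmf_tac.
have rp : \int[H]_g (- (7 / 25) * ez o0 g + 24 / 25 * ez o1 g) ^+ 4 = \int[H]_g ez o0 g ^+ 4.
  rewrite -[RHS](haar_int Hinv (mkq pyth_norm) b40); apply: eq_Rintegral => g _.
  rewrite ezM sumI3 !(@rotation_mxE _ (mkq pyth_norm) _ _ _ _ erefl) /rotq /=.
  by congr (_ ^+ 4); field.
have rm : \int[H]_g (- (7 / 25) * ez o0 g - 24 / 25 * ez o1 g) ^+ 4 = \int[H]_g ez o0 g ^+ 4.
  rewrite -[RHS](haar_int Hinv (mkq pyth_normN) b40); apply: eq_Rintegral => g _.
  rewrite ezM sumI3 !(@rotation_mxE _ (mkq pyth_normN) _ _ _ _ erefl) /rotq /=.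
  by congr (_ ^+ 4); field.
(* Adding the two opposite rotations cancels the odd terms; as $c^4+s^4=1-2c^2s^2$, what remains is
   $A=3B$. *)
have q : \int[H]_g ((2 * (7 / 25) ^+ 4) * ez o0 g ^+ 4
    + (2 * (24 / 25) ^+ 4) * ez o1 g ^+ 4
    + (12 * (7 / 25) ^+ 2 * (24 / 25) ^+ 2) * (ez o0 g ^+ 2 * ez o1 g ^+ 2))
    = 2 * \int[H]_g ez o0 g ^+ 4.
  rewrite [RHS]mulr_natl [RHS]mulr2n -{1}rp -rm -bintD //; apply: eq_Rintegral => g _; ring.
move: s q; rewrite !bintD ?bintZ; bmf_tac.
move: e1 e2 f1 f2.
move: (\int[H]_g ez o0 g ^+ 4) (\int[H]_g ez o1 g ^+ 4) (\int[H]_g ez o2 g ^+ 4).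
move: (\int[H]_g (ez o0 g ^+ 2 * ez o1 g ^+ 2)) (\int[H]_g (ez o1 g ^+ 2 * ez o2 g ^+ 2)).
move: (\int[H]_g (ez o2 g ^+ 2 * ez o0 g ^+ 2)) => p q r a b c; lra.
Qed.

End ColumnMoments.

(** * Power sums of the eigenvalues of $J_3$ *)

Section PowerSums.
Variable F : numFieldType.

Lemma sum_shift2 (n : nat) (c : F) : \sum_(j < n) (j%:R - c) ^+ 2 =
  n%:R * c ^+ 2 - c * n%:R * (n%:R - 1) + n%:R * (n%:R - 1) * (2 * n%:R - 1) / 6.
Proof.
elim: n => [|n IH]; first by rewrite big_ord0; field.
by rewrite big_ord_recr /= IH -natr1; field.
Qed.

Lemma sum_shift4 (n : nat) (c : F) : \sum_(j < n) (j%:R - c) ^+ 4 =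
  n%:R * c ^+ 4 - 2 * c ^+ 3 * n%:R * (n%:R - 1)
  + c ^+ 2 * n%:R * (n%:R - 1) * (2 * n%:R - 1)
  - c * n%:R ^+ 2 * (n%:R - 1) ^+ 2
  + n%:R * (n%:R - 1) * (2 * n%:R - 1) * (3 * n%:R ^+ 2 - 3 * n%:R - 1) / 30.
Proof.
elim: n => [|n IH]; first by rewrite big_ord0; field.
by rewrite big_ord_recr /= IH -natr1; field.
Qed.

Variable N : nat.
Let X : F := N%:R / 2 * (N%:R / 2 + 1).

Lemma sum_magnetic2 : \sum_(j < N.+1) (j%:R - N%:R / 2) ^+ 2 = N.+1%:R * X / 3 :> F.
Proof. by rewrite sum_shift2 /X -natr1; field. Qed.

Lemma sum_magnetic4 : \sum_(j < N.+1) (j%:R - N%:R / 2) ^+ 4 =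
  N.+1%:R * X * (3 * X - 1) / 15 :> F.
Proof. by rewrite sum_shift4 /X -natr1; field. Qed.

End PowerSums.

Lemma mulr_shuffle (K : comNzRingType) (a b c e : K) : a * b * (e * c) = e * (a * c * b).
Proof. ring. Qed.

Lemma lin3_mxE (K : pzRingType) n (A B D : 'M[K]_n) (x y z : K) i j :
  (x *: A + y *: B + z *: D) i j = x * A i j + y * B i j + z * D i j.
Proof. by rewrite !mxE. Qed.

(** * Real forms of the diagonal entries of $y\cdot J$ and its square *)

Section BasisEntries.
Variables (R : realType) (N : nat) (Q : spin_system R N).
Local Notation C := R[i].
Local Notation J := (J Q).
Local Notation mag := (magnetic R).
Local Notation X := (spin R N * (spin R N + 1)).

Lemma spinE : (spin R N)%:C = N%:R / 2 :> C.
Proof. by rewrite /spin fmorph_div /= !rmorph_nat. Qed.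

Lemma XE : (X)%:C = N%:R / 2 * (N%:R / 2 + 1) :> C.
Proof. by rewrite rmorphM rmorphD rmorph1 /= spinE. Qed.

Lemma lin_J_diag (y : 'I_3 -> R) (m : 'I_N.+1) :
  (\sum_k (y k)%:C *: J k) m m = (y o2 * mag m)%:C.
Proof.
rewrite rmorphM /= magneticE.
exact: (lin_diag (J_vector Q) (J_herm Q) (J_diag Q)).
Qed.

Lemma quad_real (y0 y1 y2 m x : R) :
  y2%:C ^+ 2 * m%:C ^+ 2 + (y0%:C ^+ 2 + y1%:C ^+ 2) * ((x%:C - m%:C ^+ 2) / 2) =
  (y2 ^+ 2 * m ^+ 2 + (y0 ^+ 2 + y1 ^+ 2) * ((x - m ^+ 2) / 2))%:C.
Proof.
by rewrite rmorphD !rmorphM rmorphD /= fmorphV rmorphB !rmorphXn /= rmorph_nat.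
Qed.

Lemma quad_J_diag (y : 'I_3 -> R) (m : 'I_N.+1) :
  ((\sum_k (y k)%:C *: J k) *m (\sum_k (y k)%:C *: J k)) m m =
  (y o2 ^+ 2 * mag m ^+ 2 + (y o0 ^+ 2 + y o1 ^+ 2) * ((X - mag m ^+ 2) / 2))%:C.
Proof.
rewrite -quad_real magneticE XE.
exact: (quad_diag (J_vector Q) (J_herm Q) (J_diag Q)).
Qed.

End BasisEntries.

Opaque U J.

(** * Haar averages of rotated operators as scalar, vector and tensor operators *)

Section Averages.
Variables (R : realType) (N : nat) (Q : spin_system R N).
Variables (H : probability (SU2 R) R) (Hinv : haar_measure H).
Local Notation C := R[i].
Local Notation M := 'M[C]_N.+1.
Local Notation T := (SU2 R).
Local Notation U := (U Q).
Local Notation J := (J Q).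
Implicit Types (E A B : M) (p : T -> R) (g h : su2 R).

Definition rotated E (g : su2 R) : M := U g *m E *m (U g)^t*.

Lemma rotatedM E g h : rotated E (su2_mul g h) = U g *m rotated E h *m (U g)^t*.
Proof. by rewrite /rotated U_mul; move: (U g) (U h) => a b; rewrite trC_mul !mulmxA. Qed.

Lemma rotatedE E g : U g *m E *m (U g)^t* = rotated E g.
Proof. by []. Qed.

Lemma cbmf_rotated E i j : cbmf (fun g : T => rotated E g i j).
Proof.
apply: cbmf_mx_mul; last exact: cbmf_UtC.
by apply: cbmf_mx_mul; [exact: cbmf_U|move=> *; exact: cbmf_cst].
Qed.

Opaque rotated.

(** For [E] a projection onto a basis vector and [p] a monomial in the [ez], these are the operator
    moments of a covariant observable on the unit sphere, up to normalisation. *)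
Definition avg E p : M := \matrix_(i, j) cint H (fun g => (p g)%:C * rotated E g i j).

Lemma avg_mul E p A B : bmf p ->
  A *m avg E p *m B =
  \matrix_(i, j) cint H (fun g => (p g)%:C * (A *m rotated E g *m B) i j).
Proof.
move=> hp; have cp := cbmf_real hp.
have hE k l : cbmf (fun g : T => (p g)%:C * rotated E g k l).
  by apply: cbmfM => //; exact: cbmf_rotated.
apply/matrixP => i j; rewrite [LHS]mxE [RHS]mxE.
under eq_bigr do rewrite mxE mulr_suml.
transitivity (\sum_k \sum_l cint H (fun g => A i l * B k j * ((p g)%:C * rotated E g l k))).
  by apply: eq_bigr => k _; apply: eq_bigr => l _; rewrite cintZ // mxE mulrAC.
under eq_bigr => k _.
  rewrite -cint_sum; last by move=> l; apply: cbmfM => //; exact: cbmf_cst.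
  over.
rewrite -cint_sum; last first.
  by move=> k; apply: cbmf_sum => l; apply: cbmfM => //; exact: cbmf_cst.
congr cint; apply/funext => g; rewrite [in RHS]mxE mulr_sumr; apply: eq_bigr => k _.
rewrite [X in _ * (X * _)]mxE mulr_suml mulr_sumr; apply: eq_bigr => l _.
exact: mulr_shuffle.
Qed.

(** Left invariance moves the conjugation onto the weight, so the average inherits the
    transformation law of [p]. *)
Lemma avg_conj E p h : bmf p ->
  U h *m avg E p *m (U h)^t* = avg E (fun g => p (su2_mul (su2_inv h) g)).
Proof.
move=> hp; rewrite (avg_mul _ _ _ hp); apply/matrixP => i j; rewrite [LHS]mxE [RHS]mxE.
have hq : bmf (fun g : T => p (su2_mul (su2_inv h) g)).
  have [m [b hb]] := hp; split; last by exists b.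
  exact: (measurableT_comp m (measurable_su2_mul (su2_inv h))).
rewrite -[RHS](haar_cint Hinv h); last first.
  by apply: cbmfM; [exact: cbmf_real|exact: cbmf_rotated].
apply: (congr1 (cint H)); apply/funext => g; rewrite -rotatedM.
by rewrite su2_mulK.
Qed.

Lemma avg_trace E p A : bmf p ->
  \tr (A *m avg E p) = cint H (fun g => (p g)%:C * \tr (A *m rotated E g)).
Proof.
move=> hp; rewrite -[A *m _]mulmx1 (avg_mul _ _ _ hp) /mxtrace.
under eq_bigr do rewrite mxE.
rewrite -cint_sum; last first.
  move=> i; apply: cbmfM; first exact: cbmf_real.
  apply: cbmf_mx_mul; last by move=> *; exact: cbmf_cst.
  by apply: cbmf_mx_mul; [move=> *; exact: cbmf_cst|exact: cbmf_rotated].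
by congr cint; apply/funext => g; rewrite mulr_sumr; under eq_bigr do rewrite mulmx1.
Qed.

Lemma avg_sum E (I : finType) (c : I -> R) (p : I -> T -> R) :
  (forall i, bmf (p i)) ->
  avg E (fun g => \sum_i c i * p i g) = \sum_i (c i)%:C *: avg E (p i).
Proof.
move=> hp; apply/matrixP => k l; rewrite summxE [LHS]mxE.
have hE i : cbmf (fun g : T => (p i g)%:C * rotated E g k l).
  by apply: cbmfM; [exact: cbmf_real|exact: cbmf_rotated].
transitivity (\sum_i cint H (fun g => (c i)%:C * ((p i g)%:C * rotated E g k l))).
  rewrite -cint_sum; last by move=> i; apply: cbmfM => //; exact: cbmf_cst.
  congr cint; apply/funext => g; rewrite rmorph_sum /= mulr_suml.
  by apply: eq_bigr => i _; rewrite rmorphM /= mulrA.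
by apply: eq_bigr => i _; rewrite cintZ // !mxE.
Qed.

Lemma conj_eq A B g : U g *m A *m (U g)^t* = B -> U g *m A = B *m U g.
Proof. by move=> <-; rewrite -!mulmxA U_tCK mulmx1. Qed.

(** The average commutes with the representation, so Schur's lemma makes it scalar, and its trace
    fixes the scalar. *)
Lemma avg_cst E : avg E (fun=> 1) = (\tr E / N.+1%:R)%:M.
Proof.
have hs : avg E (fun=> 1) = (avg E (fun=> 1) ord0 ord0)%:M.
  apply: (commutant (J_vector Q) (J_herm Q) (J_diag Q)) => a.
  rewrite -[J a](@vdot_bvec R N); apply: (comm_U_ad (e1 := unit_bvec R a)) => t.
  by apply: conj_eq; rewrite avg_conj //; exact: bmf_cst.
have := avg_trace E 1%:M (@bmf_cst _ T R 1); rewrite mul1mx {1}hs mxtrace_scalar.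
rewrite (_ : cint _ _ = \tr E); last first.
  rewrite (_ : (fun g => _) = (fun=> \tr E)); last first.
    apply/funext => g; rewrite mul1r mul1mx -rotatedE mxtrace_mulC mulmxA.
    by rewrite U_tCK mul1mx.
  by apply: complex_eq => /=; rewrite bint_cst.
move=> h; rewrite -h -[_ *+ _]mulr_natr mulfK ?pnatr_eq0 //; exact: hs.
Qed.

Lemma ez_inv j g (h : T) : ez j (su2_mul (su2_inv g) h) =
  \sum_k rotation_mx g k j * ez k h.
Proof. by rewrite ezM; apply: eq_bigr => k _; rewrite rotation_mxV mxE. Qed.

Lemma avg_vector E : vector_op J (fun b => avg E (ez b)).
Proof.
apply: vector_opP => g b; apply: conj_eq.
rewrite avg_conj; last exact: bmf_ez.
by rewrite -avg_sum; [congr avg; apply/funext => h; exact: ez_inv|move=> *; exact: bmf_ez].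
Qed.

Lemma avg_tensor E : tensor_op J (fun b c => avg E (fun g => ez b g * ez c g)).
Proof.
have hb b c : bmf (fun g : T => ez b g * ez c g) by apply: bmfM; exact: bmf_ez.
apply: tensor_opP => g b c; apply: conj_eq.
rewrite avg_conj //.
have hp (q : 'I_3 * 'I_3) : bmf (fun g : T => ez q.1 g * ez q.2 g) by exact: hb.
rewrite -(avg_sum E (fun q : 'I_3 * 'I_3 => rotation_mx g q.1 b * rotation_mx g q.2 c) hp).
congr avg; apply/funext => h; rewrite !ez_inv big_distrlr /=.
rewrite pair_big /=; apply: eq_bigr => -[k l] _ /=; ring.
Qed.

Lemma rotated_delta m g i : rotated (delta_mx m m) g i i = U g i m * (U g i m)^*%R.
Proof.
rewrite -rotatedE mxE (bigD1 m) //= big1 ?addr0 => [|k km].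
  rewrite mxE (bigD1 m) //= big1 ?addr0 => [|k km]; first by rewrite !mxE !eqxx mulr1.
  by rewrite [delta_mx _ _ _ _]mxE (negPf km) mulr0.
rewrite mxE big1 ?mul0r // => l _.
by rewrite [delta_mx _ _ _ _]mxE (negPf km) andbF mulr0.
Qed.

(** The transition probability $|\langle n|U_g|m\rangle|^2$. *)
Definition trans (n m : 'I_N.+1) (g : T) : R := complex.Re (U g n m * (U g n m)^*%R).

Lemma trans_ge0 n m g : 0 <= trans n m g.
Proof.
rewrite /trans; case: (U g n m) => x y /=.
by rewrite mulrN opprK -!expr2 addr_ge0 ?sqr_ge0.
Qed.

Lemma transE n m g : (trans n m g)%:C = U g n m * (U g n m)^*%R.
Proof.
rewrite /trans; case: (U g n m) => x y; apply: complex_eq => //=.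
by rewrite mulrN addrC mulrC subrr.
Qed.

Lemma bmf_trans n m : bmf (trans n m).
Proof. by apply: (proj1 _); apply: cbmfM; [|apply: cbmf_conj]; exact: cbmf_U. Qed.

Lemma avg_delta n m p :
  avg (delta_mx m m) p n n = (\int[H]_g (p g * trans n m g))%:C.
Proof.
rewrite mxE -cint_real; apply: (congr1 (cint H)); apply/funext => g.
by rewrite rotated_delta -transE rmorphM.
Qed.

Lemma trace_rotated_delta A m g :
  \tr (A *m rotated (delta_mx m m) g) = ((U g)^t* *m A *m U g) m m.
Proof.
rewrite -rotatedE !mulmxA mxtrace_mulC !mulmxA.
rewrite /mxtrace (bigD1 m) //= big1 ?addr0 => [|k km].
  rewrite mxE (bigD1 m) //= big1 ?addr0 => [|k km]; first by rewrite !mxE !eqxx mulr1.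
  by rewrite [delta_mx _ _ _ _]mxE (negPf km) mulr0.
rewrite mxE big1 // => l _.
by rewrite [delta_mx _ _ _ _]mxE (negPf km) andbF mulr0.
Qed.

(** [U_J] at the inverse rotation: the coefficients form the third row of the rotation matrix, where
    [ez] uses the third column; the two share the entry [ez o2]. *)
Lemma U_J2 g : (U g)^t* *m J o2 *m U g = \sum_k (rotation_mx g o2 k)%:C *: J k.
Proof.
have := U_J Q (su2_inv g) (bvec R o2); rewrite UV vdot_bvec => ->.
rewrite -mulmxA U_tCK mulmx1; apply: eq_bigr => k _.
by rewrite tnth_rotation_bvec rotation_mxV mxE.
Qed.

Lemma row_norm g : rotation_mx g o2 o0 ^+ 2 + rotation_mx g o2 o1 ^+ 2 = 1 - ez o2 g ^+ 2.
Proof.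
have /matrixP /(_ o2 o2) := rotation_mx_orth g; rewrite mxE sumI3 [1%:M _ _]mxE eqxx.
rewrite ![_^T _ _]mxE -!expr2 => h.
by apply: (addIr (ez o2 g ^+ 2)); rewrite subrK; exact: h.
Qed.

Local Notation mag := (magnetic R).
Local Notation X := (spin R N * (spin R N + 1)).

Lemma trace_J2_rotated m g :
  \tr (J o2 *m rotated (delta_mx m m) g) = (ez o2 g * mag m)%:C.
Proof.
rewrite trace_rotated_delta (U_J2 g).
exact: (lin_J_diag Q (fun k => rotation_mx g o2 k)).
Qed.

Lemma trace_J22_rotated m g :
  \tr (J o2 *m J o2 *m rotated (delta_mx m m) g) =
  (ez o2 g ^+ 2 * mag m ^+ 2 + (1 - ez o2 g ^+ 2) * ((X - mag m ^+ 2) / 2))%:C.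
Proof.
rewrite trace_rotated_delta.
have -> : (U g)^t* *m (J o2 *m J o2) *m U g =
    ((U g)^t* *m J o2 *m U g) *m ((U g)^t* *m J o2 *m U g).
  move: (U_tC Q g); move: (U g) (J o2) => a b h.
  by rewrite -!mulmxA (mulmxA a (a^t*)) h mul1mx.
rewrite (U_J2 g) -row_norm.
exact: (quad_J_diag Q (fun k => rotation_mx g o2 k)).
Qed.

End Averages.

(** Two trace identities determine the coefficients of $aJ_3^2+c$. Here [t] is $2s$, and the
    determinant of the system is a multiple of $x(4x-3)$, where $4x-3=(2s-1)(2s+3)$ vanishes at spin
    1/2. *)
Lemma rank_two_solution (F : realFieldType) (t a c m n : F) : 0 < t ->
  let x := t / 2 * (t / 2 + 1) in
  a * ((t + 1) * x / 3) + (t + 1) * c = 1 / 3 ->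
  a * ((t + 1) * x * (3 * x - 1) / 15) + c * ((t + 1) * x / 3) =
    m ^+ 2 / 5 + (x - m ^+ 2) / 15 ->
  4 * x - 3 != 0 ->
  a * n ^+ 2 + c = 1 / (t + 1) *
    (1 / 3 + 2 / 3 * ((3 * m ^+ 2 - x) * (3 * n ^+ 2 - x)) / (x * (4 * x - 3))).
Proof.
move=> t0 x h1 h2 dx.
have t1 : t + 1 != 0 by rewrite gt_eqF // addr_gt0.
have x0 : x != 0 by rewrite gt_eqF // /x mulr_gt0 ?addr_gt0 // divr_gt0.
move: x x0 h1 h2 dx => x x0 h1 h2 dx.
have h1' : (t + 1) * c = 1 / 3 - a * ((t + 1) * x / 3) by rewrite -h1; ring.
have ec : c = 1 / (3 * (t + 1)) - a * x / 3.
  by apply: (mulfI t1); rewrite h1'; field; rewrite t1.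
have ea : a * ((t + 1) * x * (4 * x - 3)) = 6 * m ^+ 2 - 2 * x.
  (* The second trace identity times 45; the term [5 * x] comes from eliminating [c] by the first
     one. *)
  transitivity (45 * (m ^+ 2 / 5 + (x - m ^+ 2) / 15) - 5 * x); last by field.
  by rewrite -h2 ec; field; rewrite t1.
have ea' : a = (6 * m ^+ 2 - 2 * x) / ((t + 1) * x * (4 * x - 3)).
  by rewrite -ea mulfK // !mulf_neq0.
by rewrite ec ea'; field; rewrite t1 x0 dx.
Qed.

Opaque U J rotated.

(** * Moments of the transition probabilities *)

Section TransitionMoments.
Variables (R : realType) (N : nat) (Q : spin_system R N).
Variables (H : probability (SU2 R) R) (Hinv : haar_measure H) (N_gt0 : (0 < N)%N).
Local Notation C := R[i].
Local Notation T := (SU2 R).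
Local Notation mag := (magnetic R).
Local Notation X := (spin R N * (spin R N + 1)).
Local Notation trans := (trans Q).
Local Notation J := (J Q).

Lemma trace_J2 (A : 'M[C]_N.+1) : \tr (J o2 *m A) = \sum_n (mag n)%:C * A n n.
Proof.
apply: eq_bigr => n _; rewrite mxE (bigD1 n) //= big1 ?addr0 => [|k kn].
  by rewrite J_diagm eqxx mulr1n.
by rewrite J_diagm eq_sym (negPf kn) mul0r.
Qed.

Lemma trace_J22 (A : 'M[C]_N.+1) :
  \tr (J o2 *m J o2 *m A) = \sum_n (mag n ^+ 2)%:C * A n n.
Proof.
rewrite -mulmxA trace_J2; apply: eq_bigr => n _.
rewrite mxE (bigD1 n) //= big1 ?addr0 => [|k kn].
  by rewrite J_diagm eqxx mulr1n mulrA rmorphXn.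
by rewrite J_diagm eq_sym (negPf kn) mul0r.
Qed.

Lemma bmf_ez_trans k n m : bmf (fun g : T => ez o2 g ^+ k * trans n m g).
Proof. by apply: bmfM; [apply: bmfX; exact: bmf_ez|exact: bmf_trans]. Qed.

Lemma sum_trans m (g : T) : \sum_n trans n m g = 1.
Proof.
apply: (fmorph_inj (@real_complex R)); rewrite rmorph_sum rmorph1 /=.
have /matrixP /(_ m m) := U_tCK Q g; rewrite mxE [RHS]mxE eqxx => h.
apply: etrans h; apply: eq_bigr => n _; rewrite transE mulrC; congr (_ * _).
by rewrite [RHS]mxE [X in _ = (X)^*%R]mxE.
Qed.

Lemma int_trans0 n m : \int[H]_g trans n m g = N.+1%:R^-1.
Proof.
have /matrixP /(_ n n) := avg_cst Q Hinv (delta_mx m m).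
rewrite avg_delta mxE eqxx mulr1n (_ : \tr _ = 1); last first.
  rewrite /mxtrace (bigD1 m) //= big1 ?addr0 => [|k km]; first by rewrite mxE !eqxx.
  by rewrite mxE (negPf km).
move=> /(congr1 (@complex.Re R)) /=.
under eq_Rintegral do rewrite mul1r.
by rewrite div1r -(rmorph_nat (@real_complex R)) -fmorphV.
Qed.

Lemma magnetic_sum2 : \sum_(n < N.+1) mag n ^+ 2 = N.+1%:R * X / 3.
Proof. exact: sum_magnetic2. Qed.

Lemma magnetic_sum4 : \sum_(n < N.+1) mag n ^+ 4 = N.+1%:R * X * (3 * X - 1) / 15.
Proof. exact: sum_magnetic4. Qed.

Lemma spin_gt0 : 0 < spin R N.
Proof. by rewrite /spin divr_gt0 // ltr0n. Qed.

Lemma X_gt0 : 0 < X.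
Proof. by rewrite mulr_gt0 ?addr_gt0 ?spin_gt0. Qed.

(** The averaged operator is a multiple $aJ_3$, so the integral is $a\,n$. Tracing against $J_3$
    gives $\sum_n n\,D_n=m\int R_{33}^2=m/3$, which fixes [a]. *)
Lemma int_trans1 n m : \int[H]_g (ez o2 g * trans n m g) = mag m * mag n / (X * N.+1%:R).
Proof.
pose D k := \int[H]_g (ez o2 g * trans k m g).
have [a ha] := vector_op_proportional (J_vector Q) (J_herm Q) (J_diag Q) N_gt0
  (avg_vector Q Hinv (delta_mx m m)).
have hD k : D k = complex.Re a * mag k.
  have /matrixP /(_ k k) := ha; rewrite avg_delta mxE J_diagm eqxx mulr1n.
  by move=> /(congr1 (@complex.Re R)); case: (a) => ? ? /=; rewrite mulr0 subr0.
have hT : \sum_k mag k * D k = mag m / 3.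
  apply: (fmorph_inj (@real_complex R)); rewrite rmorph_sum /=.
  have := avg_trace Q H (delta_mx m m) (J o2) (bmf_ez R o2); rewrite trace_J2.
  move=> E; apply: etrans; last (apply: etrans E _; last first).
    by apply: eq_bigr => k _; rewrite avg_delta rmorphM.
  rewrite (_ : (fun g => _) = fun g => (mag m * ez o2 g ^+ 2)%:C); last first.
    by apply/funext => g; rewrite trace_J2_rotated -rmorphM mulrA -expr2 mulrC.
  rewrite cint_real bintZ ?int_ez2 ?div1r //.
  by apply: bmfX; exact: bmf_ez.
rewrite -/(D n) hD; move: hT.
under eq_bigr do rewrite hD mulrCA -expr2.
rewrite -mulr_sumr magnetic_sum2 => hT.
have X0 : X != 0 by rewrite gt_eqF // X_gt0.
have N0 : N.+1%:R != 0 :> R by rewrite pnatr_eq0.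
have -> : complex.Re a = (mag m / 3) / (N.+1%:R * X / 3).
  by rewrite -hT mulfK // mulf_neq0 ?(mulf_neq0 N0 X0) // invr_neq0 // pnatr_eq0.
move: (mag m) (mag n) (X) (N.+1%:R : R) X0 N0 => p q x y x0 y0.
by field; rewrite x0 y0.
Qed.

(** The averaged operator is $aJ_3^2+c$, so the integral is $a\,n^2+c$. The two coefficients come
    from $\sum_nD_n=1/3$ and from the trace against $J_3^2$, which involves the moments 1/3 and 1/5
    of the polar cosine. *)
Lemma int_trans2 n m : \int[H]_g (ez o2 g ^+ 2 * trans n m g) = N.+1%:R^-1 *
  (1 / 3 + 2 / 3 * ((3 * mag m ^+ 2 - X) * (3 * mag n ^+ 2 - X)) / (X * (4 * X - 3))).
Proof.
pose D k := \int[H]_g (ez o2 g ^+ 2 * trans k m g).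
have hb b c : bmf (fun g : T => ez b g * ez c g) by apply: bmfM; exact: bmf_ez.
have tr1 : avg Q H (delta_mx m m) (fun g => ez o0 g * ez o0 g)
  + avg Q H (delta_mx m m) (fun g => ez o1 g * ez o1 g)
  + avg Q H (delta_mx m m) (fun g => ez o2 g * ez o2 g) =
  (\tr (delta_mx m m : 'M[C]_N.+1) / N.+1%:R)%:M.
  rewrite -(avg_cst Q Hinv).
  have := avg_sum Q H (delta_mx m m) (fun=> 1) (fun k : 'I_3 => hb k k).
  rewrite sumI3 !scale1r => <-; congr avg; apply/funext => g.
  by rewrite sumI3 !mul1r -!expr2 ez_norm.
have [a [c hB]] := tensor_op_quadratic (J_vector Q) (J_herm Q) (J_diag Q)
  (avg_tensor Q Hinv (delta_mx m m))
  (fun b c => congr1 (avg Q H (delta_mx m m)) (funext (fun g => mulrC (ez b g) (ez c g)))) tr1.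
have hD k : D k = complex.Re a * mag k ^+ 2 + complex.Re c.
  have /matrixP /(_ k k) := hB; rewrite avg_delta.
  have -> : (a *: (J o2 *m J o2) + c%:M) k k = a * ((mag k) ^+ 2)%:C + c.
    rewrite mxE [X in X + _]mxE [X in _ + X]mxE eqxx mulr1n; congr (a * _ + _).
    rewrite mxE (bigD1 k) //= big1 ?addr0 => [|l lk].
      by rewrite J_diagm eqxx mulr1n -rmorphM -expr2.
    by rewrite J_diagm eq_sym (negPf lk) mul0r.
  by move=> /(congr1 (@complex.Re R)); case: (a) => ? ?; case: (c) => ? ? /=; rewrite mulr0 subr0.
have hT0 : \sum_k D k = 1 / 3.
  rewrite -bint_sum; last by move=> k; exact: bmf_ez_trans.
  rewrite -(int_ez2 Hinv); apply: eq_Rintegral => g _.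
  by rewrite -mulr_sumr sum_trans mulr1.
have hT2 : \sum_k mag k ^+ 2 * D k = mag m ^+ 2 / 5 + (X - mag m ^+ 2) / 15.
  apply: (fmorph_inj (@real_complex R)); rewrite rmorph_sum /=.
  have b2 : bmf (fun g : T => ez o2 g ^+ 2) by apply: bmfX; exact: bmf_ez.
  have b4 : bmf (fun g : T => ez o2 g ^+ 4) by apply: bmfX; exact: bmf_ez.
  have := avg_trace Q H (delta_mx m m) (J o2 *m J o2) b2; rewrite trace_J22.
  move=> E; apply: etrans; last (apply: etrans E _; last first).
    by apply: eq_bigr => k _; rewrite avg_delta rmorphM.
  rewrite (_ : (fun g => _) = fun g =>
    ((mag m ^+ 2 - (X - mag m ^+ 2) / 2) * ez o2 g ^+ 4 + (X - mag m ^+ 2) / 2 * ez o2 g ^+ 2)%:C); last first.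
    by apply/funext => g; rewrite trace_J22_rotated -rmorphM; congr (_%:C); ring.
  rewrite cint_real bintD ?bintZ ?int_ez2 ?int_ez4 //; first by congr (_%:C); field.
    by apply: bmfM => //; exact: bmf_cst.
  by apply: bmfM => //; exact: bmf_cst.
rewrite -/(D n) hD -[N.+1%:R^-1]div1r -[N.+1%:R]natr1.
have {}hT0 : complex.Re a * ((N%:R + 1) * X / 3) + (N%:R + 1) * complex.Re c = 1 / 3.
  rewrite -hT0; under [RHS]eq_bigr do rewrite hD.
  by rewrite big_split /= -mulr_sumr magnetic_sum2 sumr_const card_ord -[complex.Re c *+ _]mulr_natl -[N.+1%:R]natr1.
have [dX|dX] := eqVneq (4 * X - 3) 0; last first.
  apply: rank_two_solution hT0 _ dX; first by rewrite ltr0n.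
  rewrite -hT2; under [RHS]eq_bigr do rewrite hD mulrDr mulrCA -exprD.
  by rewrite big_split /= -mulr_sumr -mulr_suml magnetic_sum4 magnetic_sum2 -[N.+1%:R]natr1 [X in _ = _ + X]mulrC.
(* Spin 1/2: the inverse of 0 being 0, the quadrupole term of the formula disappears. This is the
   right value, since $m^2=1/4$ for all states and the first trace identity alone decides. *)
rewrite dX mulr0 invr0 mulr0 addr0.
have N1 : N = 1%N.
  apply/eqP; move/eqP: dX; rewrite /spin (_ : _ - 3 = (N%:R - 1) * (N%:R + 3)); last by field.
  have N3 : (N%:R + 3 == 0 :> R) = false by rewrite gt_eqF // addr_gt0 // ltr0n.
  by rewrite mulf_eq0 N3 orbF subr_eq0 pnatr_eq1.
have m4 (k : 'I_N.+1) : mag k ^+ 2 = 1 / 4.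
  rewrite /magnetic /spin; case: k => k; rewrite N1 => /=.
  by case: k => [|[|//]] _; field.
have tN : N%:R = 1 :> R by rewrite N1.
move: hT0; rewrite m4 /spin tN; move: (complex.Re a) (complex.Re c) => p q h.
transitivity ((p * ((1 + 1) * (1 / 2 * (1 / 2 + 1)) / 3) + (1 + 1) * q) / 2); first by field.
by rewrite h; field.
Qed.

End TransitionMoments.

(** * The quadratic minimisation over [n] and [r] *)

Section QuadraticOptimum.
Variable F : realFieldType.

(** [(2s+1) \int |<n|U_g|m>|^2 (r R_33 - m)^2 dg] as a function of
    [x = s (s + 1)], [m], [n] and [r]; it is affine in [m ^ 2]. *)
Definition efun (x m n r : F) : F :=
  r ^+ 2 * (1 / 3 + 2 / 3 * ((3 * m ^+ 2 - x) * (3 * n ^+ 2 - x)) / (x * (4 * x - 3)))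
  - 2 * r * m ^+ 2 * n / x + m ^+ 2.

(** A mixture of two calibration inputs behaves like a single input whose $m^2$ is the real number
    [q]. *)
Lemma efun_affine (p x m m' n r : F) (q := p * m ^+ 2 + (1 - p) * m' ^+ 2) :
  p * efun x m n r + (1 - p) * efun x m' n r =
  r ^+ 2 * (1 / 3 + 2 / 3 * ((3 * q - x) * (3 * n ^+ 2 - x)) / (x * (4 * x - 3)))
  - 2 * r * q * n / x + q.
Proof.
by rewrite /efun /q; move: (x * (4 * x - 3))^-1 x^-1 => u v; field.
Qed.

Section Bound.
Variables (a b q x d s : F).
Hypotheses (a0 : 0 < a) (q0 : 0 < q) (x0 : 0 < x) (d0 : 0 < d) (s0 : 0 < s).
Hypothesis key : q ^+ 2 * s ^+ 2 = x ^+ 2 * d * (a + b * s ^+ 2).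

(** [key] says that [q - d] is the minimum over [r] at [n = s]. Eliminating [b] through it writes
    the excess over this minimum as two nonnegative terms, one measuring $s^2-n^2$ and the other the
    deviation of $rn$ from $xd/q$. *)
Lemma optimum_identity r n :
  r ^+ 2 * (a + b * n ^+ 2) - 2 * r * q * n / x + q - (q - d) =
  a * r ^+ 2 * (s ^+ 2 - n ^+ 2) / s ^+ 2 + d * (q * (r * n) / (x * d) - 1) ^+ 2.
Proof.
have x0' : x != 0 by rewrite gt_eqF.
have d0' : d != 0 by rewrite gt_eqF.
have s0' : s != 0 by rewrite gt_eqF.
have -> : b = (q ^+ 2 / (x ^+ 2 * d)) - a / s ^+ 2.
  have -> : q ^+ 2 = x ^+ 2 * d * (a + b * s ^+ 2) / s ^+ 2.
    by rewrite -key mulfK // expf_neq0.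
  by field; rewrite x0' d0' s0'.
by field; rewrite x0' d0' s0'.
Qed.

Lemma optimum_ge r n : n ^+ 2 <= s ^+ 2 ->
  q - d <= r ^+ 2 * (a + b * n ^+ 2) - 2 * r * q * n / x + q.
Proof.
move=> ns; rewrite -subr_ge0 optimum_identity addr_ge0 //.
  apply: divr_ge0 (sqr_ge0 s); apply: mulr_ge0; last by rewrite subr_ge0.
  by apply: mulr_ge0; [exact: ltW|exact: sqr_ge0].
by apply: mulr_ge0; [exact: ltW|exact: sqr_ge0].
Qed.

(** Both terms vanish. The second makes $rn$ positive, so $r$ and $n$ are positive; then the first
    gives $n=s$, not merely $n^2=s^2$. *)
Lemma optimum_eq r n : n ^+ 2 <= s ^+ 2 -> 0 <= r ->
  r ^+ 2 * (a + b * n ^+ 2) - 2 * r * q * n / x + q <= q - d ->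
  n = s /\ r = x * d / (q * s).
Proof.
move=> ns r0; rewrite -subr_le0 optimum_identity => h.
have h1 : 0 <= a * r ^+ 2 * (s ^+ 2 - n ^+ 2) / s ^+ 2.
  apply: divr_ge0 (sqr_ge0 s); apply: mulr_ge0; last by rewrite subr_ge0.
  by apply: mulr_ge0; [exact: ltW|exact: sqr_ge0].
have h2 : 0 <= d * (q * (r * n) / (x * d) - 1) ^+ 2.
  by apply: mulr_ge0; [exact: ltW|exact: sqr_ge0].
have e1 : a * r ^+ 2 * (s ^+ 2 - n ^+ 2) / s ^+ 2 = 0.
  by apply/eqP; rewrite eq_le h1 andbT; apply: le_trans h; rewrite lerDl.
have e2 : d * (q * (r * n) / (x * d) - 1) ^+ 2 = 0.
  by apply/eqP; rewrite eq_le h2 andbT; apply: le_trans h; rewrite lerDr.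
have rn : q * (r * n) = x * d.
  move/eqP: e2; rewrite mulf_eq0 gt_eqF //= expf_eq0 /= subr_eq0 => /eqP e.
  by rewrite -[RHS]mul1r -e divfK // gt_eqF // mulr_gt0.
have rn0 : 0 < r * n by rewrite -(pmulr_rgt0 _ q0) rn mulr_gt0.
have r1 : 0 < r by rewrite lt_neqAle r0 andbT eq_sym; apply: contraTneq rn0 => ->; rewrite mul0r ltxx.
have n0 : 0 < n by rewrite -(pmulr_rgt0 _ r1).
have sn : n = s.
  have c0 : 0 < a * r ^+ 2 / s ^+ 2 by rewrite divr_gt0 ?mulr_gt0 ?exprn_gt0.
  have /eqP : (a * r ^+ 2 / s ^+ 2) * (s ^+ 2 - n ^+ 2) = 0 by rewrite -e1; ring.
  rewrite mulf_eq0 (gt_eqF c0) /= subr_eq0 eq_sym => /eqP e.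
  by apply/eqP; rewrite -(eqrXn2 (n := 2)) ?ltW // e.
split=> //; rewrite sn in rn.
have qs0 : q * s != 0 by rewrite gt_eqF // mulr_gt0.
by apply: (mulIf qs0); rewrite divfK // -rn; ring.
Qed.

End Bound.
End QuadraticOptimum.

(** * The least favourable mixture of calibration inputs *)

Section Optimum.
Variables (R : realType) (N : nat) (N_gt0 : (0 < N)%N).
Local Notation mag := (magnetic R).
Local Notation s := (spin R N).
Local Notation X := (s * (s + 1)).
Local Notation e m n r := (efun X (mag m) (mag n) r).

Lemma magnetic_max : mag (@ord_max N) = s.
Proof. by rewrite /magnetic /spin /=; field. Qed.

Lemma magnetic_sqr_le (n : 'I_N.+1) : mag n ^+ 2 <= s ^+ 2.
Proof.
rewrite -subr_ge0 (_ : _ - _ = n%:R * (N%:R - n%:R)); last by rewrite /magnetic /spin; field.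
by rewrite mulr_ge0 ?subr_ge0 ?ler_nat // -ltnS.
Qed.

Lemma magnetic_eq_max (n : 'I_N.+1) : mag n = s -> n = ord_max.
Proof.
rewrite /magnetic => /eqP; rewrite subr_eq /spin -splitr eqr_nat => /eqP h.
exact/val_inj.
Qed.

Lemma ab_reduce (x q : R) : x != 0 -> 4 * x - 3 != 0 ->
  1 / 3 - 2 * (3 * q - x) / (x * (4 * x - 3)) * x / 3 =
  (1 - 2 * (3 * q - x) / (4 * x - 3)) / 3.
Proof. by move=> h1 h2; field; rewrite h1 h2. Qed.

Lemma ab_affine (x q m : R) : x != 0 -> 4 * x - 3 != 0 ->
  1 / 3 + 2 / 3 * ((3 * q - x) * (3 * m - x)) / (x * (4 * x - 3)) =
  1 / 3 - 2 * (3 * q - x) / (x * (4 * x - 3)) * x / 3 +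
  2 * (3 * q - x) / (x * (4 * x - 3)) * m.
Proof. by move=> h1 h2; field; rewrite h1 h2. Qed.

(** The substitution $t=\sqrt{2s+3}$ makes everything rational. The radius $t(t-1)/2$ makes the
    error at $n=s$ independent of $m$ ([efun_large_spin]), and [q] is the value of $m^2$ for which
    it is also the minimiser in $r$ ([ab_radius]). *)
Lemma ab_key (t : R) (s := (t ^+ 2 - 3) / 2) (x := s * (s + 1))
  (q := (t ^+ 2 - 1) * (t - 1) / 4) (d := t * (t - 1) ^+ 2 / 4)
  (b := 2 * (3 * q - x) / (x * (4 * x - 3))) :
  t != 0 -> t ^+ 2 - 1 != 0 -> t ^+ 2 - 3 != 0 -> t ^+ 2 - 4 != 0 ->
  q ^+ 2 * s ^+ 2 = x ^+ 2 * d * (1 / 3 - b * x / 3 + b * s ^+ 2).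
Proof.
move=> h0 h1 h3 h4; have x4 : 4 * x - 3 = t ^+ 2 * (t ^+ 2 - 4) by rewrite /x /s; field.
have xE : x = (t ^+ 2 - 3) * (t ^+ 2 - 1) / 4 by rewrite /x /s; field.
rewrite /b x4 xE /q /d /s; field.
by rewrite h0 h1 h3 h4.
Qed.

Lemma ab_radius (t : R) (s := (t ^+ 2 - 3) / 2) (x := s * (s + 1))
  (q := (t ^+ 2 - 1) * (t - 1) / 4) (d := t * (t - 1) ^+ 2 / 4) :
  t - 1 != 0 -> t ^+ 2 - 1 != 0 -> t ^+ 2 - 3 != 0 ->
  x * d / (q * s) = (2 * s - t + 3) / 2.
Proof.
by move=> h0 h1 h3; rewrite /x /q /d /s; field; rewrite h0 h1 h3.
Qed.

(** The eigenvalue of least modulus, 0 or $-1/2$; mixtures with [ord_max] reach all values of $m^2$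
    between the extremes. *)
Definition mid : 'I_N.+1 := inord N./2.

Lemma magnetic_mid : mag mid ^+ 2 = (odd N)%:R / 4.
Proof.
rewrite /magnetic /mid inordK ?ltnS ?half_leqif_double //; last first.
  by rewrite -{2}[N]odd_double_half (leq_trans _ (leq_addl _ _)) // -addnn leq_addr.
have hN : N%:R = (odd N)%:R + 2 * (N./2)%:R :> R.
  by rewrite -{1}[N]odd_double_half natrD -muln2 natrM mulrC.
by rewrite /spin hN; case: (odd N); rewrite /= ?mulr1n ?mulr0n; field.
Qed.

(** Collects the data of the quadratic problem in the three cases of the theorem; [p] is the weight
    of the input $m=s$ in the mixture. *)
Lemma optimal_parameters : exists a b q d : R, exists p : R,
  [/\ 0 < a, 0 < q, 0 < d & q ^+ 2 * s ^+ 2 = X ^+ 2 * d * (a + b * s ^+ 2)] /\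
  [/\ 0 <= p <= 1, q = p * s ^+ 2 + (1 - p) * mag mid ^+ 2,
      q - d = Delta_min_sq R N & X * d / (q * s) = r_min R N] /\
  (forall n : 'I_N.+1, 1 / 3 + 2 / 3 * ((3 * q - X) * (3 * mag n ^+ 2 - X)) / (X * (4 * X - 3))
     = a + b * mag n ^+ 2).
Proof.
(* At spin 1/2 only $m^2=1/4$ occurs and the quadrupole term is 0, hence [b = 0]. *)
have [N1|N1] := eqVneq N 1%N.
  have sE : s = 1 / 2 by rewrite /spin N1.
  exists (1 / 3), 0, (1 / 4), (1 / 12), 1.
  have -> : Delta_min_sq R N = 1 / 6 by rewrite /Delta_min_sq N1.
  have -> : r_min R N = 1 / 2 by rewrite /r_min N1.
  rewrite sE.
  split; first by split; try lra; field.
  split; first by split; try lra; field.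
  by move=> n; rewrite (_ : 4 * _ - 3 = 0); [rewrite mulr0 invr0 !mulr0 mul0r !addr0|field].
(* At spin 1 the saddle value $q=\sqrt5-1$ lies above $s^2=1$, so the constraint is active and all
   weight is on $m=s$. *)
have [N2|N2] := eqVneq N 2%N.
  have sE : s = 1 by rewrite /spin N2; field.
  exists (1 / 5), (1 / 5), 1, (5 / 8), 1.
  have -> : Delta_min_sq R N = 3 / 8 by rewrite /Delta_min_sq N2.
  have -> : r_min R N = 5 / 4 by rewrite /r_min N2.
  rewrite sE.
  split; first by split; try lra; field.
  split; first by split; try lra; field.
  by move=> n; field.
have N3 : (3 <= N)%N by case: (N) N_gt0 N1 N2 => [|[|[|]]].
pose t := Num.sqrt (2 * s + 3).
have s32 : 3 / 2 <= s by rewrite /spin ler_pM2r // ler_nat.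
have t2 : t ^+ 2 = 2 * s + 3 by rewrite sqr_sqrtr //; lra.
have t0 : 0 <= t by exact: sqrtr_ge0.
(* A rational lower bound for $t\ge\sqrt6$ at which $s^2-q$ has only positive Taylor coefficients in
   [t]. *)
have t24 : 7 / 3 <= t.
  by rewrite -(@ler_pXn2r _ 2) ?nnegrE // t2; lra.
have sE : s = (t ^+ 2 - 3) / 2 by rewrite t2; field.
pose q := (t ^+ 2 - 1) * (t - 1) / 4.
pose d := t * (t - 1) ^+ 2 / 4.
have u0 : 0 <= t - 7 / 3 by rewrite subr_ge0.
have q_le : q <= s ^+ 2.
  have h2 : 0 <= (t - 7 / 3) ^+ 2 by exact: exprn_ge0.
  have h3 : 0 <= (t - 7 / 3) ^+ 3 by exact: exprn_ge0.
  have h4 : 0 <= (t - 7 / 3) ^+ 4 by exact: exprn_ge0.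
  by rewrite sE /q; lra.
have q_ge : 1 / 4 <= q.
  have : 1 * 1 <= (t ^+ 2 - 1) * (t - 1) by apply: ler_pM => //; nra.
  by rewrite /q; lra.
have x1 : X = (t ^+ 2 - 3) * (t ^+ 2 - 1) / 4 by rewrite sE; field.
have x3 : 0 < 4 * X - 3 by nra.
have xp : 0 < X by exact: X_gt0.
pose b := 2 * (3 * q - X) / (X * (4 * X - 3)).
pose a := 1 / 3 - b * X / 3.
have aE : a = (1 - 2 * (3 * q - X) / (4 * X - 3)) / 3.
  by rewrite /a /b; apply: ab_reduce; rewrite gt_eqF.
pose p := (q - mag mid ^+ 2) / (s ^+ 2 - mag mid ^+ 2).
have m14 : 0 <= mag mid ^+ 2 <= 1 / 4.
  by rewrite magnetic_mid; case: (odd N) => /=; rewrite ?mulr1n ?mulr0n; lra.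
have sm : 0 < s ^+ 2 - mag mid ^+ 2 by nra.
exists a, b, q, d, p; split; [split|split; [split|]].
- rewrite aE divr_gt0 // subr_gt0 ltr_pdivrMr // mul1r.
  have : q < X - 1 / 2 by nra.
  lra.
- lra.
- by rewrite /d divr_gt0 // mulr_gt0 // ?exprn_gt0 //; lra.
- rewrite /a /b sE; apply: ab_key; rewrite gt_eqF //; nra.
- by rewrite /p; apply/andP; split; [rewrite divr_ge0|rewrite ler_pdivrMr]; lra.
- rewrite /p; move: (mag mid ^+ 2) sm => v sm.
  by field; rewrite gt_eqF.
- by rewrite /Delta_min_sq (negPf N1) (negPf N2) -/t /q /d sE; field.
- rewrite /r_min (negPf N1) (negPf N2) -/t sE; apply: ab_radius; rewrite gt_eqF //; nra.
- by move=> n; rewrite /a /b; apply: ab_affine; rewrite gt_eqF.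
Qed.

(** The inequality behind the lower bound: one weight [p] serves all [n] and [r] at once, and
    equality singles out the claimed parameters. *)
Lemma weighted_error : exists2 p : R, 0 <= p <= 1 & forall (n : 'I_N.+1) r, 0 <= r ->
  let G := p * e (@ord_max N) n r + (1 - p) * e mid n r in
  Delta_min_sq R N <= G /\ (G = Delta_min_sq R N -> n = ord_max /\ r = r_min R N).
Proof.
have [a [b [q [d [p [[a0 q0 d0 key] [[p01 qE qd rE] ab]]]]]]] := optimal_parameters.
have s0 := spin_gt0 R N_gt0; have x0 := X_gt0 R N_gt0.
exists p => // n r r0 G.
have GE : G = r ^+ 2 * (a + b * mag n ^+ 2) - 2 * r * q * mag n / X + q.
  by rewrite /G efun_affine magnetic_max -qE ab.
rewrite GE -qd; split; first by apply: (@optimum_ge _ a b q X d s) => //; exact: magnetic_sqr_le.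
move=> h.
have [h1 h2] : mag n = s /\ r = X * d / (q * s).
  by apply: (@optimum_eq _ a b q X d s) => //; [exact: magnetic_sqr_le|rewrite h].
by split; [exact: magnetic_eq_max|rewrite h2].
Qed.

End Optimum.

(** * Integration against the image of a measure with density *)

Section ImageDensity.
Local Open Scope ereal_scope.
Context d1 d2 (X : measurableType d1) (Y : measurableType d2) (R : realType).
Variables (mu : {measure set X -> \bar R}) (nu : {measure set Y -> \bar R}).
Variables (phi : X -> Y) (mphi : measurable_fun setT phi).
Variables (p : X -> R) (mp : measurable_fun setT p) (p0 : forall x, (0 <= p x)%R).
Hypothesis nuE : forall A, measurable A ->
  nu A = \int[mu]_x (\1_A (phi x) * p x)%:E.

Import HBNNSimple.

(** [nu] is the image under [phi] of the measure with density [p]. The formula is the hypothesis for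
    indicators, extended to simple functions and by monotone convergence. *)
Lemma ge0_integral_image (f : Y -> \bar R) :
  measurable_fun setT f -> (forall y, 0 <= f y) ->
  \int[nu]_y f y = \int[mu]_x (f (phi x) * (p x)%:E).
Proof.
move=> mf f0; pose h := nnsfun_approx measurableT mf.
have cvh y : (h n y)%:E @[n --> \oo] --> f y.
  by apply: cvg_nnsfun_approx.
transitivity (limn (fun n => \int[nu]_y (h n y)%:E)).
  rewrite -monotone_convergence//.
  - by apply: eq_integral => y _; apply/esym/cvg_lim.
  - by move=> n; exact/measurable_EFinP/measurable_funP.
  - by move=> n y _; rewrite lee_fin.
  - by move=> y _ m n mn; rewrite lee_fin; exact/lefP/nd_nnsfun_approx.
have mhp n : measurable_fun setT (fun x => (h n (phi x) * p x)%:E).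
  apply/measurable_EFinP; apply: measurable_funM => //.
  by apply: measurableT_comp => //; exact: measurable_funP.
transitivity (limn (fun n => \int[mu]_x (h n (phi x) * p x)%:E)); last first.
  rewrite -monotone_convergence//.
  - apply: eq_integral => x _; apply/cvg_lim => //.
    under eq_fun do rewrite EFinM.
    by apply: cvgeZr => //; exact: cvh.
  - by move=> n x _; rewrite lee_fin mulr_ge0.
  - move=> x _ m n mn; rewrite lee_fin ler_wpM2r //.
    by exact/lefP/nd_nnsfun_approx.
congr (limn _); apply/funext => n; move: (h n) => {cvh mhp}h.
rewrite integralT_nnsfun sintegralE.
have mA k : measurable (h @^-1` [set k]) by exact: measurable_sfunP.
transitivity (\sum_(k \in range h) k%:E * \int[mu]_x (\1_(h @^-1` [set k]) (phi x) * p x)%:E).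
  by apply: eq_fsbigr => k _; rewrite nuE.
have m1 k : measurable_fun setT (fun x => (\1_(h @^-1` [set k]) (phi x) * p x)%:E).
  apply/measurable_EFinP; apply: measurable_funM => //.
  by apply: measurableT_comp => //; exact: measurable_indic.
transitivity (\sum_(k \in range h) \int[mu]_x (k%:E * (\1_(h @^-1` [set k]) (phi x) * p x)%:E)).
  apply: eq_fsbigr => k; rewrite inE => -[y _ <-].
  by rewrite ge0_integralZl // => *; rewrite lee_fin ?mulr_ge0.
rewrite -ge0_integral_fsum //=.
- apply: eq_integral => x _; rewrite fimfunE EFinM -fsumEFin // ge0_mule_fsuml.
    by apply: eq_fsbigr => k _; rewrite !EFinM muleA.
  by move=> k; rewrite lee_fin; exact: nnfun_muleindic_ge0.
- by move=> k; exact: emeasurable_funM.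
- move=> k x _; have [kx|kx] := eqVneq (h (phi x)) k.
    by rewrite -kx mule_ge0 // lee_fin ?mulr_ge0.
  by rewrite indicE (_ : _ \in _ = false) ?mul0r ?mule0 // memNset //=; exact/eqP.
Qed.

End ImageDensity.

(** * The distance [D2] and the calibration error *)

Section Wasserstein.
Local Open Scope ereal_scope.
Variable R : realType.
Implicit Types (mu nu : probability R R) (gamma : probability (R * R)%type R).

Definition msd d (T : measurableType d) (P : {measure set T -> \bar R}) (f : T -> R) : \bar R :=
  \int[P]_x ((f x) ^+ 2)%:E.

Lemma msd_ge0 d (T : measurableType d) (P : {measure set T -> \bar R}) f :
  0 <= msd P f.
Proof. by apply: integral_ge0 => x _; rewrite lee_fin sqr_ge0. Qed.

Lemma Lnorm2E d (T : measurableType d) (P : {measure set T -> \bar R}) (f : T -> R) :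
  Lnorm P 2%:E (fun x => (f x)%:E) = (msd P f) `^ 2^-1.
Proof.
rewrite unlock /msd; congr (_ `^ _); apply: eq_integral => x _.
by rewrite abse_EFin poweR_EFin powR_mulrn // real_normK // num_real.
Qed.

Lemma msd_pushforward d (T : measurableType d) (P : {measure set T -> \bar R})
    d' (T' : measurableType d') (P' : {measure set T' -> \bar R}) (phi : T -> T') (f : T' -> R) :
  measurable_fun setT phi -> measurable_fun setT f ->
  (forall S, measurable S -> P' S = P (phi @^-1` S)) ->
  msd P' f = msd P (f \o phi).
Proof.
move=> mphi mf PE; rewrite /msd.
pose mx := isMeasurableFun.Build _ _ _ _ _ mphi.
pose psi : {mfun T >-> T'} := HB.pack phi mx.
transitivity (\int[pushforward P psi]_x ((f x) ^+ 2)%:E).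
  by apply: eq_measure_integral => S mS _; rewrite PE.
rewrite ge0_integral_pushforward //.
  by apply/measurable_EFinP; exact: measurable_funX.
by move=> y _; rewrite lee_fin sqr_ge0.
Qed.

Lemma measurable_subr (x : R) : measurable_fun setT (fun y : R => (y - x)%R).
Proof. by apply: measurable_funB => //; exact: measurable_cst. Qed.

Lemma coupling_fst mu nu gamma (x : R) : couplings mu nu gamma ->
  msd gamma (fun z : R * R => (z.1 - x)%R) = msd mu (fun y => (y - x)%R).
Proof.
move=> c; rewrite (@msd_pushforward _ _ gamma _ _ mu fst) //.
- exact: measurable_subr.
- move=> S mS; have [h _] := c S mS; apply: etrans (esym h) _; congr (gamma _).
  by apply/seteqP; split => z //= [].
Qed.

Lemma coupling_snd mu nu gamma (x : R) : couplings mu nu gamma ->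
  msd gamma (fun z : R * R => (z.2 - x)%R) = msd nu (fun y => (y - x)%R).
Proof.
move=> c; rewrite (@msd_pushforward _ _ gamma _ _ nu snd) //.
- exact: measurable_subr.
- move=> S mS; have [_ h] := c S mS; apply: etrans (esym h) _; congr (gamma _).
  by apply/seteqP; split => z //= [].
Qed.

(** All couplings with a point mass have the same cost, since their second coordinate is almost
    surely [x]; the product coupling shows that one exists. *)
Lemma D2_dirac mu (x : R) : D2 mu \d_x = (msd mu (fun y => (y - x)%R)) `^ 2^-1.
Proof.
have cE gamma : couplings mu \d_x gamma ->
    Lnorm gamma 2%:E (fun z : R * R => (z.1 - z.2)%:E) = (msd mu (fun y => (y - x)%R)) `^ 2^-1.
  move=> c; rewrite Lnorm2E -(coupling_fst x c); congr (_ `^ _).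
  apply: ae_eq_integral => //.
  - apply/measurable_EFinP; apply: measurable_funX; apply: measurable_funB => //.
  - apply/measurable_EFinP; apply: measurable_funX; apply: measurable_funB => //.
  - exists (setT `*` (~` [set x])); split.
    + by apply: measurableX => //; apply: measurableC.
    + have [_ h] := c (~` [set x]) (measurableC (measurable_set1 x)).
      apply: etrans h _; transitivity ((x \in ~` [set x])%:R%:E : \bar R).
        exact: diracE.
      by rewrite memNset //=; apply.
    + move=> [z1 z2] /= h; split => //= z2x; apply: h => _ /=.
      by rewrite z2x.
pose phi (y : R) := (y, x).
have mphi : measurable_fun setT phi.
  apply/measurable_fun_pairP; split.
    by rewrite (_ : fst \o phi = id) //; exact: measurable_id.
  by rewrite (_ : snd \o phi = cst x) //; exact: measurable_cst.
pose mx := isMeasurableFun.Build _ _ _ _ _ mphi.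
pose psi : {mfun R >-> (R * R)%type} := HB.pack phi mx.
pose g0 : probability (R * R)%type R := distribution mu psi.
have c0 : couplings mu \d_x g0.
  move=> S mS; split; rewrite /g0 /distribution /pushforward /=.
    by congr (mu _); apply/seteqP; split => y //= [].
  transitivity ((x \in S)%:R%:E : \bar R); last by apply: esym; exact: diracE.
  case: (boolP (x \in S)) => [/set_mem xS|/negP xS].
    transitivity (mu setT); last exact: probability_setT.
    by congr (mu _); apply/seteqP; split.
  transitivity (mu set0); last exact: measure0.
  congr (mu _); apply/seteqP; split => y //= [_ h].
  by apply: xS; exact/mem_set.
apply/eqP; rewrite eq_le; apply/andP; split.
  by rewrite -(cE _ c0); apply: ereal_inf_lbound; exists g0.
by apply: le_ereal_inf_tmp => _ [gamma c <-]; rewrite cE.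
Qed.

(** With a point mass as third measure no gluing of couplings is required: on any coupling of [mu]
    and [nu], Minkowski's inequality applies to $z_1-x=(z_1-z_2)+(z_2-x)$. *)
Lemma D2_triangle mu nu (x : R) : D2 mu \d_x <= D2 mu nu + D2 nu \d_x.
Proof.
have [->|cfin] := eqVneq (D2 nu \d_x) +oo.
  by rewrite addey ?leey // -ltNye (@lt_le_trans _ _ 0) // le_ereal_inf_tmp // => _ [g _ <-]; exact: Lnorm_ge0.
have c_fin : D2 nu \d_x \is a fin_num.
  by rewrite ge0_fin_numE ?ltey // D2_dirac poweR_ge0.
rewrite -leeBlDr //; apply: le_ereal_inf_tmp => _ [gamma c <-].
rewrite leeBlDr // !D2_dirac -(coupling_fst x c) -(coupling_snd x c) -!Lnorm2E.
have m1 : measurable_fun setT (fun z : R * R => (z.1 - z.2)%R).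
  by apply: measurable_funB.
have m2 : measurable_fun setT (fun z : R * R => (z.2 - x)%R).
  by apply: measurable_funB => //; exact: measurable_cst.
have := @minkowski_EFin _ _ _ gamma _ _ 2 m1 m2 (ler1n _ 2).
apply: le_trans; rewrite (_ : (fun z : R * R => (z.1 - x)%:E) =
  EFin \o ((fun z : R * R => (z.1 - z.2)%R) \+ (fun z : R * R => (z.2 - x)%R))%R) //.
by apply/funext => z /=; rewrite addrA subrK.
Qed.

Variable n : nat.
Implicit Types F E : observable R n R.

Lemma calibration_sup_le F E eps :
  ereal_sup [set D2 (outdist F p.1) \d_(p.2) | p in calibrated E eps]
    <= metric_error F E + eps%:E.
Proof.
apply: ge_ereal_sup => _ [[rho x] /= h <-].
apply: (le_trans (D2_triangle _ (outdist E rho) x)); apply: leeD => //.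
by apply: ereal_sup_ubound; exists rho.
Qed.

(** The supremum is monotone in [eps], so its limit at $0^+$ is an infimum. *)
Lemma calibration_errorE F E : calibration_error F E =
  ereal_inf [set ereal_sup [set D2 (outdist F p.1) \d_(p.2) | p in calibrated E eps]
            | eps in [set eps : R | (0 < eps < 1)%R]].
Proof.
apply/cvg_lim => //.
rewrite (_ : [set eps : R | (0 < eps < 1)%R] = [set` Interval (BRight 0%R) (BLeft 1%R)]).
  apply: (@nondecreasing_at_right_cvge R _ 0%R (BLeft 1%R)).
    by rewrite /= bnd_simp.
  move=> a b _ _ ab; apply: ereal_sup_le => _ [p pa <-]; exists p => //.
  by apply: le_trans pa _; rewrite lee_fin.
by apply/seteqP; split => e /=; rewrite in_itv.
Qed.

Lemma calibration_le_metric F E : calibration_error F E <= metric_error F E.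
Proof.
rewrite calibration_errorE; apply/lee_addgt0Pr => e e0.
pose d := Num.min e (1 / 2)%R.
have d01 : (0 < d < 1)%R.
  by rewrite lt_min e0 /= gt_min; apply/andP; split; [lra|apply/orP; right; lra].
apply: (@le_trans _ _ (metric_error F E + d%:E)); last first.
  by apply: leeD => //; rewrite lee_fin ge_min lexx.
apply: le_trans (calibration_sup_le F E d).
by apply: ereal_inf_lbound; exists d.
Qed.

(** An input on which [E] is sharp is admissible for every [eps], so it survives the limit. *)
Lemma calibration_ge F E rho (x : R) : D2 (outdist E rho) \d_x = 0 ->
  D2 (outdist F rho) \d_x <= calibration_error F E.
Proof.
move=> h; rewrite calibration_errorE; apply: le_ereal_inf_tmp => _ [e /andP[e0 _] <-].
apply: ereal_sup_ubound; exists (rho, x) => //=.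
by rewrite /calibrated /= h lee_fin ltW.
Qed.

End Wasserstein.

Opaque U J rotated.

(** * Spectral projections in a given eigenbasis *)

Section SpectralProjection.
Variables (R : realType) (n : nat) (H : 'M[R[i]]_n) (W : 'M[R[i]]_n) (m : 'I_n -> R).
Hypotheses (Hherm : H^t* = H) (Wu : W *m W^t* = 1%:M).
Hypothesis HW : H *m W = W *m diag_mx (\row_j (m j)%:C).

(** [spectralmx] is some diagonalising unitary, not the given [W]. The change of basis between them
    intertwines the two diagonal forms, so its entries vanish where the eigenvalues differ; hence it
    intertwines the indicator functions too. *)
Lemma spectral_projectionE S : spectral_projection H S =
  W *m diag_mx (\row_j (\1_S (m j))%:C) *m W^t*.
Proof.
set P := spectralmx H; set d := spectral_diag H.
have PPt : P *m P^t* = 1%:M by exact/unitarymxP/spectral_unitarymx.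
have HE : H = P^t* *m diag_mx d *m P.
  rewrite -invmx_unitary ?spectral_unitarymx //.
  by apply/orthomx_spectralP/normalmxP; rewrite Hherm.
have PH : P *m H = diag_mx d *m P by rewrite HE !mulmxA PPt mul1mx.
have E : spectral_projection H S *m W = W *m diag_mx (\row_j (\1_S (m j))%:C).
  suff : P *m (spectral_projection H S *m W) = P *m (W *m diag_mx (\row_j (\1_S (m j))%:C)).
    move=> /(congr1 (mulmx (P^t*))); rewrite !mulmxA (mulmx1C PPt) !mul1mx //.
  rewrite /spectral_projection -/P -/d !mulmxA PPt mul1mx -!mulmxA.
  rewrite mul_diag_mx mulmxA mul_mx_diag; apply/matrixP => i j.
  rewrite [LHS]mxE [RHS]mxE [X in X * _ = _]mxE [X in _ = _ * X]mxE.
  have [->|nz] := eqVneq ((P *m W) i j) 0; first by rewrite mulr0 mul0r.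
  suff -> : d 0 i = (m j)%:C by rewrite mulrC.
  have : diag_mx d *m (P *m W) = (P *m W) *m diag_mx (\row_j0 (m j0)%:C).
    by rewrite -mulmxA -HW !mulmxA PH.
  rewrite mul_diag_mx mul_mx_diag => /matrixP /(_ i j).
  move: (P *m W) nz => B nz h.
  have hB : d 0 i * B i j = B i j * (m j)%:C.
    have e1 : (\matrix_(a, b) (d 0 a * B a b)) i j = d 0 i * B i j by rewrite mxE.
    have e2 : (\matrix_(a, b) (B a b * (\row_j0 (m j0)%:C) 0 b)) i j = B i j * (m j)%:C.
      by rewrite mxE mxE.
    exact: etrans (esym e1) (etrans h e2).
  apply: (mulfI nz); apply: etrans hB; exact: mulrC.
rewrite -E -mulmxA Wu; exact: esym (mulmx1 _).
Qed.

End SpectralProjection.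

Lemma herm_lin3 (K : numClosedFieldType) n (A B D : 'M[K]_n) (x y z : K) :
  x^*%R = x -> y^*%R = y -> z^*%R = z -> A^t* = A -> B^t* = B -> D^t* = D ->
  (x *: A + y *: B + z *: D)^t* = x *: A + y *: B + z *: D.
Proof.
move=> hx hy hz hA hB hD.
by rewrite !linearD /= !map_mxD !linearZ /= !map_mxZ /= hA hB hD hx hy hz.
Qed.

Lemma herm_sandwich (K : numClosedFieldType) n (W A : 'M[K]_n) :
  A^t* = A -> (W *m A *m W^t*)^t* = W *m A *m W^t*.
Proof. by move=> hA; rewrite !trmx_mul !map_mxM trmxCK hA mulmxA. Qed.

Lemma sandwich_eigen (K : numClosedFieldType) n (W V u D : 'M[K]_n) :
  W^t* *m W = 1%:M -> u *m D = V *m u -> W *m V *m W^t* *m (W *m u) = W *m u *m D.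
Proof.
by move=> hW h; rewrite mulmxA -(mulmxA (W *m V)) hW mulmx1 -!mulmxA h.
Qed.

Lemma unsandwich (K : numClosedFieldType) n (W D : 'M[K]_n) :
  W^t* *m W = 1%:M -> W^t* *m (W *m D *m W^t*) *m W = D.
Proof. by move=> hW; rewrite !mulmxA hW mul1mx -mulmxA hW mulmx1. Qed.

(** * Rotated eigenbases as calibration inputs *)

Section Frames.
Variables (R : realType) (N : nat) (Q : spin_system R N).
Local Notation C := R[i].
Local Notation mag := (magnetic R).
Implicit Types (F : observable R N.+1 (3.-tuple R)) (k : su2 R).

(** Its columns are the vectors $U_k|m\rangle$, eigenvectors of the angular momentum along [axis k]
    ([frame_eigen]). *)
Definition frame k : 'M[C]_N.+1 := rep Q k *m ketmx Q.

Lemma frameU k : frame k *m (frame k)^t* = 1%:M.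
Proof.
rewrite /frame trC_mul !mulmxA -(mulmxA _ (ketmx Q)) ketmxK mulmx1.
exact/unitarymxP/rep_unitary.
Qed.

Lemma frameUC k : (frame k)^t* *m frame k = 1%:M.
Proof. exact: mulmx1C (frameU k). Qed.

Lemma frame_ket k : frame k = ketmx Q *m U Q k.
Proof.
Transparent U.
rewrite /U /inket !mulmxA ketmxK mul1mx //.
Opaque U.
Qed.

Definition axis k : 3.-tuple R := rotation k (north R).

Lemma axis_unit k : unit_vector (axis k).
Proof. exact: rotation_unit (@unit_north R). Qed.

Lemma vdot_ket e : vdot e (angmom Q) = ketmx Q *m vdot e (J Q) *m (ketmx Q)^t*.
Proof.
by rewrite -inket_vdot /inket !mulmxA ketmxK mul1mx -mulmxA ketmxK mulmx1.
Qed.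

Lemma vdot_angmom_herm e : (vdot e (angmom Q))^t* = vdot e (angmom Q).
Proof.
rewrite vdot_ket; apply: herm_sandwich; rewrite vdotE.
by apply: herm_lin3; solve [exact: conjc_real | exact: J_herm].
Qed.

Lemma frame_eigen k : vdot (axis k) (angmom Q) *m frame k =
  frame k *m diag_mx (\row_j (mag j)%:C).
Proof.
have JE : J Q o2 = diag_mx (\row_j (mag j)%:C).
  apply/matrixP => i j; rewrite J_diagm [RHS]mxE [X in _ = X *+ _]mxE.
  by case: eqP => [->|].
rewrite vdot_ket frame_ket -JE; apply: sandwich_eigen; first exact: ketmx_tCK.
by rewrite -(vdot_bvec (J Q) o2) (U_J Q k (bvec R o2)) -north_bvec.
Qed.

Lemma spectral_axis k S : spectral_projection (vdot (axis k) (angmom Q)) S =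
  frame k *m diag_mx (\row_j (\1_S (mag j))%:C) *m (frame k)^t*.
Proof.
exact: spectral_projectionE (vdot_angmom_herm _) (frameU k) (frame_eigen k) S.
Qed.

Lemma frame_col_norm k j : (col j (frame k))^t* *m col j (frame k) = 1%:M.
Proof.
have /matrixP /(_ j j) := frameUC k; rewrite mxE [RHS]mxE eqxx => h.
apply/matrixP => a b; rewrite !ord1 [RHS]mxE eqxx; apply: etrans h.
rewrite mxE; apply: eq_bigr => l _; rewrite !mxE //.
Qed.

Definition frame_state k j : state R N.+1 := pure_state (frame_col_norm k j).

Lemma outfun_pure d (T : measurableType d) (F : observable R N.+1 T) (v : 'cV[C]_N.+1) (v1 : v^t* *m v = 1%:M) S :
  outfun F (pure_state v1) S = vecfun F v S.
Proof.
rewrite /outfun /vecfun /= mxtrace_mulC mulmxA mxtrace_mulC mulmxA.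
by rewrite /mxtrace big_ord1.
Qed.

Lemma frame_colE k j (A : 'M[C]_N.+1) :
  ((col j (frame k))^t* *m A *m col j (frame k)) 0 0 = ((frame k)^t* *m A *m frame k) j j.
Proof.
rewrite !mxE; apply: eq_bigr => a _; rewrite !mxE; congr (_ * _).
by apply: eq_bigr => b _; rewrite !mxE.
Qed.

Lemma outdist_spectral_frame k j S :
  outdist (spectral_measure (vdot (axis k) (angmom Q))) (frame_state k j) S =
  (\1_S (mag j))%:E.
Proof.
transitivity (outfun (spectral_measure (vdot (axis k) (angmom Q))) (frame_state k j) S) => //.
rewrite /frame_state outfun_pure /vecfun /= spectral_axis frame_colE.
by rewrite (unsandwich _ (frameUC k)) !mxE eqxx mulr1n.
Qed.

(** The mean square error of the marginal along [axis k] on its eigenstate number [j]; the lower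
    bound averages it over [k]. *)
Definition cal F k j : \bar R :=
  msd (outdist F (frame_state k j)) (fun x => dot (axis k) x - mag j).

Lemma D2_marginal_frame F k j :
  D2 (outdist (marginal F (axis k)) (frame_state k j)) \d_(mag j) =
  ((cal F k j) `^ 2^-1)%E.
Proof.
rewrite D2_dirac /cal; congr (_ `^ _)%E.
rewrite (@msd_pushforward _ _ _ (outdist F (frame_state k j)) _ _ _ (dot (axis k))) //.
- exact: measurable_dot.
- exact: measurable_subr.
Qed.

(** In an eigenstate the spectral measure outputs exactly the point mass at [mag j], so
    [calibration_ge] applies. *)
Lemma cal_le_Delta_max F k j : ((cal F k j) `^ 2^-1 <= Delta_max Q F)%E.
Proof.
rewrite -D2_marginal_frame.
apply: (@le_trans _ _ (calibration_error (marginal F (axis k))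
  (spectral_measure (vdot (axis k) (angmom Q))))).
  apply: calibration_ge; rewrite D2_dirac.
  rewrite (_ : msd _ _ = 0%E) ?poweR0r // ?invr_neq0 //.
  rewrite /msd (@eq_measure_integral _ _ _ _ (\d_(mag j))); last first.
    move=> A mA _; apply: etrans (outdist_spectral_frame k j A) _.
    by apply: esym; rewrite indicE; exact: diracE.
  rewrite integral_dirac //; last first.
    by apply/measurable_EFinP; apply: measurable_funX; exact: measurable_subr.
  by rewrite subrr expr0n mule0.
apply: ereal_sup_ubound; exists (axis k) => //; exact: axis_unit.
Qed.

Lemma Delta_max_le_D_max F : (Delta_max Q F <= D_max Q F)%E.
Proof.
apply: ge_ereal_sup => _ [e e1 <-]; apply: (le_trans (calibration_le_metric _ _)).
by apply: ereal_sup_ubound; exists e.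
Qed.

End Frames.

Opaque U J rotated frame.

(** * Quadratic forms, polarisation and positivity *)

Section QuadraticForm.
Variables (K : numClosedFieldType) (n : nat).
Implicit Types (A : 'M[K]_n) (v w : 'cV[K]_n).

Lemma sesqE A v w :
  (v^t* *m A *m w) 0 0 = \sum_i \sum_j ((v i 0)^*%R * w j 0) * A i j.
Proof.
rewrite exchange_big mxE; apply: eq_bigr => j _; rewrite mxE mulr_suml.
by apply: eq_bigr => i _; rewrite !mxE mulrAC.
Qed.

Lemma delta_sesq A i j :
  ((delta_mx i 0 : 'cV[K]_n)^t* *m A *m (delta_mx j 0 : 'cV[K]_n)) 0 0 = A i j.
Proof.
rewrite sesqE (bigD1 i) //= [X in _ + X]big1 ?addr0 => [|k ki]; last first.
  by apply: big1 => l _; rewrite mxE (negPf ki) conjC0 !mul0r.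
rewrite (bigD1 j) //= [X in _ + X]big1 ?addr0 => [|k kj]; last first.
  by rewrite [X in _ * X * _]mxE (negPf kj) mulr0 mul0r.
by rewrite !mxE !eqxx conjC1 !mul1r.
Qed.

Lemma polar A i j (c : K) (v := delta_mx i 0 + c *: delta_mx j 0 : 'cV[K]_n) :
  (v^t* *m A *m v) 0 0 = A i i + c * A i j + (c^*%R * A j i + c^*%R * c * A j j).
Proof.
have -> : v^t* = (delta_mx i 0)^t* + c^*%R *: (delta_mx j 0)^t*.
  by rewrite /v linearD /= map_mxD linearZ /= map_mxZ.
rewrite /v !mulmxDl !mulmxDr -!scalemxAl -!scalemxAr -?scalemxAl.
rewrite -(delta_sesq A i i) -(delta_sesq A i j) -(delta_sesq A j i) -(delta_sesq A j j).
move: (_ *m _) (_ *m _) (_ *m _) (_ *m _) => x y z t; rewrite !mxE; ring.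
Qed.

Lemma psd_tr0 A : A^t* = A -> (forall v, 0 <= (v^t* *m A *m v) 0 0) ->
  \tr A = 0 -> A = 0.
Proof.
move=> hA pA trA.
have d0 i : 0 <= A i i by rewrite -(delta_sesq A); exact: pA.
have Aii i : A i i = 0.
  have /eqP := trA; rewrite /mxtrace psumr_eq0; last by move=> *; exact: d0.
  by move=> /allP /(_ i (mem_index_enum _)) /eqP.
apply/matrixP => i j; rewrite [RHS]mxE; apply/eqP; rewrite -normr_eq0.
have Aji : A j i = (A i j)^*%R by rewrite -[in LHS]hA !mxE.
(* With zero diagonal this vector gives the form the value $-2|A_{ij}|^2$. *)
have := pA (delta_mx i 0 + (- (A i j)^*%R) *: delta_mx j 0).
rewrite polar !Aii Aji mulr0 add0r addr0 rmorphN /= conjCK !mulNr.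
rewrite -opprD oppr_ge0 [(A i j)^*%R * A i j]mulrC -mulr2n -normCK pmulrn_lle0 // => h.
by rewrite -sqrf_eq0 eq_le h exprn_ge0.
Qed.

End QuadraticForm.

(** * Positivity tested on countably many vectors *)

Section RealForm.
Variables (R : realType) (n : nat).
Local Notation C := R[i].
Implicit Types (A : 'M[C]_n) (v : 'cV[C]_n) (x y : 'I_n -> R).

Definition qf v A : R := complex.Re ((v^t* *m A *m v) 0 0).

Definition rform x y A : R := \sum_i \sum_j
  ((x i * x j + y i * y j) * complex.Re (A i j)
   - (x i * y j - y i * x j) * complex.Im (A i j)).

Lemma qf_rform v A :
  qf v A = rform (fun i => complex.Re (v i 0)) (fun i => complex.Im (v i 0)) A.
Proof.
rewrite /qf sesqE (raddf_sum (@complex.Re R : {additive _ -> _})); apply: eq_bigr => i _.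
rewrite (raddf_sum (@complex.Re R : {additive _ -> _})); apply: eq_bigr => j _.
by case: (v i 0) (v j 0) (A i j) => [a b] [c d] [e f] /=; ring.
Qed.

Lemma rformZ (c : R) x y A :
  rform (fun i => c * x i) (fun i => c * y i) A = c ^+ 2 * rform x y A.
Proof.
rewrite /rform mulr_sumr; apply: eq_bigr => i _; rewrite mulr_sumr.
by apply: eq_bigr => j _; ring.
Qed.

Lemma floor_approx (x : R) : (Num.floor (k.+1%:R * x))%:~R / k.+1%:R @[k --> \oo] --> x.
Proof.
have h : (x - k.+1%:R^-1) @[k --> \oo] --> x.
  rewrite -[X in _ --> X]subr0; apply: cvgB; first exact: cvg_cst.
  exact: cvg_harmonic.
apply: (squeeze_cvgr _ h (cvg_cst x)); near=> k.
have k0 : (0 : R) < k.+1%:R by rewrite ltr0n.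
have /andP[a b] := floor_itv (k.+1%:R * x); rewrite ler_pdivlMr // ler_pdivrMr //.
rewrite mulrBl mulVf ?gt_eqF // [x * _]mulrC a andbT lerBlDr.
by move: b; rewrite intrD => /ltW.
Unshelve. all: by end_near. Qed.

Definition gauss (p : {ffun 'I_n -> int * int}) : 'cV[C]_n :=
  \col_i ((p i).1%:~R +i* (p i).2%:~R).

(** The form is homogeneous of degree 2 and continuous, and every vector is a limit of scaled
    Gaussian-integer vectors. A countable test family is what allows positivity to hold almost
    everywhere simultaneously. *)
Lemma qf_dense A : (forall p, 0 <= qf (gauss p) A) -> forall v, 0 <= qf v A.
Proof.
move=> h v; rewrite qf_rform.
pose fl k (x : R) : R := (Num.floor (k.+1%:R * x))%:~R / k.+1%:R.
have c : rform (fun i => fl k (complex.Re (v i 0))) (fun i => fl k (complex.Im (v i 0))) A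
    @[k --> \oo] --> rform (fun i => complex.Re (v i 0)) (fun i => complex.Im (v i 0)) A.
  apply: cvg_big => [|i _]; first exact: add_continuous.
  apply: cvg_big => [|j _]; first exact: add_continuous.
  by apply: cvgB; apply: cvgMl; [apply: cvgD|apply: cvgB]; apply: cvgM; exact: floor_approx.
apply: cvgr_to_ge c _; near=> k.
have e (x : R) : fl k x = k.+1%:R^-1 * (Num.floor (k.+1%:R * x))%:~R by rewrite mulrC.
under [X in rform X _]eq_fun do rewrite e.
under [X in rform _ X]eq_fun do rewrite e.
rewrite rformZ mulr_ge0 ?sqr_ge0 //.
have := h [ffun i => (Num.floor (k.+1%:R * complex.Re (v i 0)),
                      Num.floor (k.+1%:R * complex.Im (v i 0)))].
rewrite qf_rform; congr (0 <= rform _ _ A); apply/funext => i; by rewrite mxE ffunE.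
Unshelve. all: by end_near. Qed.

End RealForm.

(** * Signed real densities with respect to a probability *)

Section RealDensity.
Context d (T : measurableType d) (R : realType) (mu : probability T R).
Implicit Types (c : set T -> R) (f : T -> R).

Definition has_density c f := mu.-integrable setT (EFin \o f) /\
  forall S, measurable S -> c S = \int[mu]_(x in S) f x.

Lemma has_densityS c f S : has_density c f -> measurable S -> mu.-integrable S (EFin \o f).
Proof. by move=> [h _] mS; apply: integrableS h. Qed.

Lemma has_density_measurable c f : has_density c f -> measurable_fun setT f.
Proof. by move=> [/measurable_int h _]; exact/measurable_EFinP. Qed.

Lemma has_densityE c f S : has_density c f -> measurable S ->
  (c S)%:E = (\int[mu]_(x in S) (f x)%:E)%E.
Proof.
move=> h mS; rewrite h.2 // /Rintegral fineK //.
exact: integrable_fin_num (has_densityS h mS).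
Qed.

Lemma has_density_eq c c' f f' : c =1 c' -> f =1 f' -> has_density c f -> has_density c' f'.
Proof. by move=> /funext -> /funext ->. Qed.

Lemma has_densityD c c' f f' : has_density c f -> has_density c' f' ->
  has_density (fun S => c S + c' S) (fun x => f x + f' x).
Proof.
move=> h h'; split.
  by have := integrableD measurableT h.1 h'.1; apply: eq_integrable.
move=> S mS; rewrite h.2 // h'.2 // RintegralD //; [exact: has_densityS h mS|exact: has_densityS h' mS].
Qed.

Lemma has_densityZ (a : R) c f : has_density c f ->
  has_density (fun S => a * c S) (fun x => a * f x).
Proof.
move=> h; split.
  by have := integrableZl measurableT a h.1; apply: eq_integrable.
move=> S mS; rewrite h.2 // RintegralZl //; exact: has_densityS h mS.
Qed.

Lemma has_density0 : has_density (fun=> 0) (fun=> 0).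
Proof. by split=> [|S mS]; [exact: integrable0|rewrite Rintegral_cst // mul0r]. Qed.

Lemma has_density_sum I (r : seq I) (c : I -> set T -> R) (f : I -> T -> R) : (forall i, has_density (c i) (f i)) ->
  has_density (fun S => \sum_(i <- r) c i S) (fun x => \sum_(i <- r) f i x).
Proof.
move=> h; elim: r => [|i r IH].
  by apply: has_density_eq has_density0 => ?; rewrite big_nil.
by apply: has_density_eq (has_densityD (h i) IH) => ?; rewrite big_cons.
Qed.

Lemma has_density_cst (a : R) : has_density (fun S => a * fine (mu S)) (fun=> a).
Proof.
split=> [|S mS]; last by rewrite Rintegral_cst.
exact: finite_measure_integrable_cst.
Qed.

Lemma has_density_unique c f f' : has_density c f -> has_density c f' ->
  \forall x \ae mu, f x = f' x.
Proof.
move=> h h'; have := @integral_ae_eq _ _ _ mu setT measurableT (EFin \o f') (EFin \o f) h.1.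
move=> /(_ (measurable_int _ h'.1)).
have E A : A `<=` setT -> measurable A ->
    (\int[mu]_(x in A) (EFin \o f) x = \int[mu]_(x in A) (EFin \o f') x)%E.
  by move=> _ mA; apply: etrans (esym (has_densityE h mA)) (has_densityE h' mA).
move=> /(_ E); apply: filterS => x /(_ Logic.I) /=; exact: EFin_inj.
Qed.

Lemma has_density_ae c f f' : has_density c f -> measurable_fun setT f' ->
  (\forall x \ae mu, f x = f' x) -> has_density c f'.
Proof.
move=> h mf' e; have mf := has_density_measurable h.
have E S : measurable S -> (\int[mu]_(x in S) (f x)%:E = \int[mu]_(x in S) (f' x)%:E)%E.
  move=> mS; apply: ae_eq_integral => //; try exact/measurable_EFinP/measurable_funTS.
  by apply: filterS e => x ->.
split; last by move=> S mS; rewrite h.2 // /Rintegral E.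
apply/integrableP; split; first exact/measurable_EFinP.
have /integrableP[_] := h.1.
have mabs (g : T -> R) : measurable_fun setT g -> measurable_fun setT (fun x => `|(EFin \o g) x|%E).
  by move=> mg; apply: (measurableT_comp (f := abse)) => //; exact/measurable_EFinP.
rewrite (ae_eq_integral (fun x => `|(EFin \o f') x|%E)) //; [exact: mabs|exact: mabs|].
by apply: filterS e => x h' _ /=; rewrite h'.
Qed.

End RealDensity.

Lemma qf_ge0 (R : realType) n (A : 'M[R[i]]_n) v : psd A -> 0 <= qf v A.
Proof. by case=> _ /(_ v); rewrite lecE => /andP[]. Qed.

Lemma psd1 (R : realType) n : psd (1%:M : 'M[R[i]]_n).
Proof.
split=> [|v]; first by rewrite trmx1 map_mx1.
rewrite mulmx1 mxE sumr_ge0 // => i _.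
by rewrite !mxE mulrC mul_conjC_ge0.
Qed.

Lemma psd_qf (R : realType) n (A : 'M[R[i]]_n) : A^t* = A ->
  (forall v, 0 <= qf v A) -> psd A.
Proof.
move=> hA h; split=> // v; rewrite lecE [X in _ && X](h v) andbT.
have : ((v^t* *m A *m v) 0 0)^*%R = (v^t* *m A *m v) 0 0.
  have {2}<- : (v^t* *m A *m v)^t* = v^t* *m A *m v.
    by rewrite !trC_mul trmxCK hA mulmxA.
  by rewrite [RHS]mxE [X in _ = _ X]mxE.
case: (_ 0 0) => a b [] /eqP; rewrite eq_sym -subr_eq0 opprK -mulr2n mulrn_eq0 /=.
by move=> /eqP ->.
Qed.

Lemma Re_polar (R : realType) n (A : 'M[R[i]]_n) i j : A^t* = A ->
  complex.Re (A i j) = 2^-1 * (qf (delta_mx i 0 + 1 *: delta_mx j 0) A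
    + (-1) * (qf (delta_mx i 0) A + qf (delta_mx j 0) A)).
Proof.
move=> hA; rewrite /qf polar !delta_sesq conjC1 !mul1r.
have -> : A j i = (A i j)^*%R by rewrite -[in LHS]hA !mxE.
by case: (A i i) (A j j) (A i j) => [? ?] [? ?] [? ?] /=; field.
Qed.

Lemma Im_polar (R : realType) n (A : 'M[R[i]]_n) i j : A^t* = A ->
  complex.Im (A i j) = - 2^-1 * (qf (delta_mx i 0 + 'i *: delta_mx j 0) A
    + (-1) * (qf (delta_mx i 0) A + qf (delta_mx j 0) A)).
Proof.
move=> hA; rewrite /qf polar !delta_sesq conjCi.
have -> : A j i = (A i j)^*%R by rewrite -[in LHS]hA !mxE.
by case: (A i i) (A j j) (A i j) => [? ?] [? ?] [? ?] /=; field.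
Qed.

(** * The operator density of an observable with respect to its trace *)

Section OperatorDensity.
Context d (T : measurableType d) (R : realType) (n : nat).
Local Notation C := R[i].
Local Notation M := 'M[C]_n.
Variables (F : observable R n T) (mu : probability T R).
Hypothesis muF : forall S, measurable S -> complex.Re (\tr (F S)) = n%:R * fine (mu S).

Let fin v : fin_num_fun (vecfun F v). Proof. by []. Qed.
HB.instance Definition _ v := Measure_isFinite.Build _ _ _ (vecfun F v) (@fin v).

Lemma dominated_by_trace S : measurable S -> mu S = 0%E -> F S = 0.
Proof.
move=> mS S0; have [hF pF] := povm_psd F S; apply: psd_tr0 => //.
have := muF mS; rewrite S0 mulr0 => re0.
have d0 i : 0 <= F S i i by rewrite -(delta_sesq (F S)); exact: pF.
have : 0 <= \tr (F S) by rewrite sumr_ge0.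
by rewrite lecE => /andP[/eqP im0 _]; apply: complex_eq.
Qed.

Lemma qf_density v : exists f : T -> R, (forall x, 0 <= f x) /\
  has_density mu (fun S => qf v (F S)) f.
Proof.
have dom : vecfun F v `<< mu.
  apply/null_content_dominatesP => S mS S0.
  by rewrite /vecfun dominated_by_trace // mulmx0 mul0mx mxE.
have [f [f0 ffin fint fE]] := radon_nikodym_sigma_finite dom.
exists (fine \o f); split=> [x|]; first exact: fine_ge0.
have e x : (fine (f x))%:E = f x by rewrite fineK.
split; first by apply: eq_integrable fint => // x _ /=.
move=> S mS; rewrite /Rintegral; under eq_integral do rewrite /= e.
by rewrite -fE.
Qed.

Lemma entry_density i j : exists XY : (T -> R) * (T -> R),
  has_density mu (fun S => complex.Re (F S i j)) XY.1 /\
  has_density mu (fun S => complex.Im (F S i j)) XY.2.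
Proof.
have [a [_ ha]] := qf_density (delta_mx i 0).
have [b [_ hb]] := qf_density (delta_mx j 0).
have [c [_ hc]] := qf_density (delta_mx i 0 + 1 *: delta_mx j 0).
have [e [_ he]] := qf_density (delta_mx i 0 + 'i *: delta_mx j 0).
have hD (f : T -> R) (g : set T -> R) : has_density mu g f ->
    has_density mu (fun S => g S + (-1) * (qf (delta_mx i 0) (F S) + qf (delta_mx j 0) (F S)))
      (fun x => f x + (-1) * (a x + b x)).
  by move=> hf; apply: has_densityD => //; apply: has_densityZ; apply: has_densityD.
exists (fun x => 2^-1 * (c x + (-1) * (a x + b x)), fun x => - 2^-1 * (e x + (-1) * (a x + b x))).
split.
  apply: has_density_eq (has_densityZ 2^-1 (hD _ _ hc)) => // S.
  by rewrite (Re_polar i j (povm_psd F S).1).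
apply: has_density_eq (has_densityZ (- 2^-1) (hD _ _ he)) => // S.
by rewrite (Im_polar i j (povm_psd F S).1).
Qed.

(** Radon-Nikodym gives a density for each quadratic form; polarisation gives densities of the
    entries, and symmetrising them makes the matrix Hermitian at every point. *)
Lemma operator_density_ae : exists D : T -> M, (forall x, (D x)^t* = D x) /\
  forall v, has_density mu (fun S => qf v (F S)) (fun x => qf v (D x)).
Proof.
have [XY hXY] := boolp.choice (fun p : 'I_n * 'I_n => entry_density p.1 p.2).
pose X i j x := 2^-1 * ((XY (i, j)).1 x + (XY (j, i)).1 x).
pose Y i j x := 2^-1 * ((XY (i, j)).2 x + (-1) * (XY (j, i)).2 x).
have hF S i j : F S j i = (F S i j)^*%R by rewrite -[in LHS](povm_psd F S).1 !mxE.
have hX i j : has_density mu (fun S => complex.Re (F S i j)) (X i j).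
  apply: has_density_eq (has_densityZ 2^-1 (has_densityD (hXY (i, j)).1 (hXY (j, i)).1)) => // S /=.
  by rewrite (hF S i j); case: (F S i j) => a b /=; field.
have hY i j : has_density mu (fun S => complex.Im (F S i j)) (Y i j).
  apply: has_density_eq (has_densityZ 2^-1 (has_densityD (hXY (i, j)).2
    (has_densityZ (-1) (hXY (j, i)).2))) => // S /=.
  by rewrite (hF S i j); case: (F S i j) => a b /=; field.
exists (fun x => \matrix_(i, j) (X i j x +i* Y i j x)); split=> [x|v].
  apply/matrixP => i j; rewrite !mxE; apply: complex_eq => /=; rewrite /X /Y.
    by rewrite addrC.
  ring.
apply: (@has_density_eq _ _ _ _
  (fun S => rform (fun i => complex.Re (v i 0)) (fun i => complex.Im (v i 0)) (F S)) _
  (fun x => rform (fun i => complex.Re (v i 0)) (fun i => complex.Im (v i 0))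
    (\matrix_(i, j) (X i j x +i* Y i j x)))) => [S|x|]; try exact/esym/qf_rform.
rewrite /rform; apply: has_density_sum => i; apply: has_density_sum => j.
set a := _ + _; set b := _ - _.
apply: has_density_eq (has_densityD (has_densityZ a (hX i j)) (has_densityZ (- b) (hY i j))).
  by move=> S; rewrite mulNr.
by move=> x; rewrite mulNr mxE.
Qed.

Lemma qf_tr A : complex.Re (\tr A) = \sum_i qf (delta_mx i 0) (A : M).
Proof.
rewrite /mxtrace (raddf_sum (@complex.Re R : {additive _ -> _})).
by apply: eq_bigr => i _; rewrite /qf delta_sesq.
Qed.

(** Outside one null set the form is nonnegative on all Gaussian-integer vectors and the trace is
    right; [qf_dense] then yields positivity. *)
Lemma operator_density : exists D : T -> M, [/\ forall x, psd (D x),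
  forall x, \tr (D x) = n%:R &
  forall v, has_density mu (fun S => qf v (F S)) (fun x => qf v (D x))].
Proof.
have [D [hD dD]] := operator_density_ae.
have pos : \forall x \ae mu, forall k, if @unpickle {ffun 'I_n -> int * int} k is Some p
    then 0 <= qf (gauss R p) (D x) else true.
  apply: ae_foralln => k; case: unpickle => [p|]; last exact: aeW.
  have [f [f0 df]] := qf_density (gauss R p).
  by apply: filterS (has_density_unique (dD _) df) => x ->.
have tr1 : \forall x \ae mu, complex.Re (\tr (D x)) = n%:R.
  apply: (@has_density_unique _ _ _ _ (fun S => complex.Re (\tr (F S)))).
    apply: has_density_eq (has_density_sum (index_enum 'I_n) (fun i => dD (delta_mx i 0))).
      by move=> S; rewrite qf_tr.
    by move=> x; rewrite qf_tr.
  have [h1 h2] := has_density_cst mu n%:R; split=> // S mS.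
  by rewrite muF // h2.
have [B [mB B0 sB]] : exists B, [/\ measurable B, mu B = 0%E & forall x, ~ B x ->
    psd (D x) /\ \tr (D x) = n%:R].
  have [B [mB B0 sB]] := filterI pos tr1; exists B; split=> // x nBx.
  have [h1 h2] : (forall k, if @unpickle {ffun 'I_n -> int * int} k is Some p
      then 0 <= qf (gauss R p) (D x) else true) /\ complex.Re (\tr (D x)) = n%:R.
    by apply: contrapT => h; apply: nBx; exact: sB.
  have pD : psd (D x).
    apply: psd_qf => // v; apply: qf_dense => p.
    by have := h1 (pickle p); rewrite pickleK.
  split=> //; apply: complex_eq => //.
    by rewrite h2 -(rmorph_nat (@real_complex R) n).
  have : 0 <= \tr (D x).
    by rewrite sumr_ge0 // => i _; rewrite -(delta_sesq (D x)); exact: pD.2.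
  by rewrite lecE => /andP[/eqP -> _]; rewrite -(rmorph_nat (@real_complex R) n).
(* On the null set the density is reset to the identity, which is positive with trace [n]. *)
exists (fun x => if x \in B then 1%:M else D x); split=> [x|x|v].
- by case: ifPn => [_|/negP xB]; [exact: psd1|case: (sB x) => // /mem_set].
- case: ifPn => [_|/negP xB]; last by case: (sB x) => // /mem_set.
  by rewrite mxtrace1.
apply: has_density_ae (dD v) _ _.
  rewrite (_ : (fun x => _) = (fun x => if x \in B then qf v 1%:M else qf v (D x))); last first.
    by apply/funext => x; case: ifP.
  apply: measurable_fun_ifT => //; last exact: has_density_measurable (dD v).
  by apply: (measurable_fun_bool true); rewrite setTI preimage_mem_true.
exists B; split=> // x /= h; apply: contrapT => xB; apply: h.
by rewrite ifN //; apply/negP => /set_mem.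
Qed.

End OperatorDensity.

(** * Averages with a weight depending only on the polar angle *)

Section AxisRotation.
Variable R : realType.

Lemma rotation_axis_north t (g := axis_rotation t (@unit_north R)) j :
  rotation_mx g j o2 = (j == o2)%:R.
Proof.
rewrite (@rotation_mxE R g _ _ _ _ (axis_mxq (north R) t)) !tnth_north /=.
have := cos2Dsin2 (t / 2).
move: (cos _) (sin _) => c s h.
move: j; apply: I3_ind; rewrite /rotq /= ?mulr0n ?mulr1n; try ring.
by apply: etrans h; ring.
Qed.

End AxisRotation.

Section Averages.
Variables (R : realType) (N : nat) (Q : spin_system R N).
Variables (H : probability (SU2 R) R) (Hinv : haar_measure H) (N_gt0 : (0 < N)%N).
Local Notation C := R[i].
Local Notation M := 'M[C]_N.+1.
Local Notation T := (SU2 R).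
Local Notation U := (U Q).
Local Notation J := (J Q).
Local Notation mag := (magnetic R).
Local Notation X := (spin R N * (spin R N + 1)).
Local Notation trans := (trans Q).

(** Rotations about the third axis leave the weight unchanged, so the average commutes with $J_3$,
    whose spectrum is simple. *)
Lemma avg_zonal_diag (E : M) (p : R -> R) i j : bmf (fun g : T => p (ez o2 g)) -> i != j ->
  avg Q H E (fun g => p (ez o2 g)) i j = 0.
Proof.
move=> hp ij; apply: (commute_J2_diag (J_diag Q) _ ij).
rewrite -(vdot_bvec J o2) -north_bvec.
apply: (comm_U_ad (e1 := @unit_north R)) => t; apply: conj_eq.
apply: etrans (avg_conj Q Hinv E _ hp) _.
apply: (congr1 (avg Q H E)); apply/funext => g; apply: (congr1 p).
rewrite ez_inv (bigD1 o2) //= rotation_axis_north eqxx mul1r big1 ?addr0 // => k ko.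
by rewrite rotation_axis_north (negPf ko) mul0r.
Qed.

Lemma avg_zonal_trace (A : M) m (p : R -> R) : bmf (fun g : T => p (ez o2 g)) ->
  \int[H]_g (p (ez o2 g) * complex.Re (\tr (A *m rotated Q (delta_mx m m) g))) =
  \sum_n complex.Re (A n n) * \int[H]_g (p (ez o2 g) * trans n m g).
Proof.
move=> hp; have := avg_trace Q H (delta_mx m m) A hp.
move=> /(congr1 (@complex.Re R)) h; transitivity (complex.Re (\tr (A *m avg Q H (delta_mx m m) (fun g => p (ez o2 g))))).
  rewrite h /cint /=; apply: eq_Rintegral => g _.
  by case: (\tr _) => a b /=; rewrite mul0r subr0.
rewrite /mxtrace (raddf_sum (@complex.Re R : {additive _ -> _})); apply: eq_bigr => n _.
rewrite mxE (bigD1 n) //= big1 ?addr0 => [|k kn]; last by rewrite avg_zonal_diag ?mulr0.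
by rewrite avg_delta; case: (A n n) => a b /=; rewrite mulr0 subr0.
Qed.

Lemma sqr_err_expand (K : comNzRingType) (r m e t : K) : (r * e - m) ^+ 2 * t =
  r ^+ 2 * (e ^+ 2 * t) + (- (2 * r * m) * (e * t) + m ^+ 2 * t).
Proof. ring. Qed.

Lemma int_err m n k r : \int[H]_g ((r * ez o2 g - k) ^+ 2 * trans n m g) =
  r ^+ 2 * \int[H]_g (ez o2 g ^+ 2 * trans n m g)
  - 2 * r * k * (mag m * mag n) / (X * N.+1%:R) + k ^+ 2 / N.+1%:R.
Proof.
have b0 := bmf_trans Q n m; have b1 := bmfM (@bmf_ez R o2) b0.
have b2 := bmfM (bmfX 2 (@bmf_ez R o2)) b0.
under eq_Rintegral do rewrite sqr_err_expand.
have c2 := bmfM (@bmf_cst _ T R (r ^+ 2)) b2.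
have c1 := bmfM (@bmf_cst _ T R (- (2 * r * k))) b1.
have c0 := bmfM (@bmf_cst _ T R (k ^+ 2)) b0.
rewrite (bintD _ c2 (bmfD c1 c0)) (bintD _ c1 c0).
rewrite !bintZ // int_trans1 // int_trans0 //.
move: (_^-1) (_^-1) (Rintegral _ _ _) => u v w; ring.
Qed.

Lemma int_err_col m n r :
  \int[H]_g ((r * ez o2 g - mag m) ^+ 2 * trans n m g) = efun X (mag m) (mag n) r / N.+1%:R.
Proof.
rewrite int_err (int_trans2 Q Hinv N_gt0) // /efun.
have X0 : X != 0 by rewrite gt_eqF // X_gt0.
have N0 : (N.+1%:R : R) != 0 by rewrite pnatr_eq0.
move: (mag m) (mag n) (X) (N.+1%:R : R) X0 N0 => a b x y x0 y0.
move: (x * (4 * x - 3))^-1 => v; field; rewrite ?x0 ?y0 //.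
Qed.

(** The moments are symmetric in [m] and [n]. [int_err_col] serves the lower bound, where the
    calibration state is the rotated vector; this form serves the coherent observable, where the
    effect is rotated. *)
Lemma int_err_row m n r :
  \int[H]_g ((r * ez o2 g - mag n) ^+ 2 * trans n m g) = efun X (mag n) (mag m) r / N.+1%:R.
Proof.
rewrite int_err (int_trans2 Q Hinv N_gt0) // /efun.
have X0 : X != 0 by rewrite gt_eqF // X_gt0.
have N0 : (N.+1%:R : R) != 0 by rewrite pnatr_eq0.
move: (mag m) (mag n) (X) (N.+1%:R : R) X0 N0 => a b x y x0 y0.
move: (x * (4 * x - 3))^-1 => v; field; rewrite ?x0 ?y0 //.
Qed.

End Averages.

(** * The maximally mixed state and polar coordinates of outcomes *)

Section MixedState.
Variables (R : realType) (N : nat).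
Local Notation C := R[i].
Local Notation M := 'M[C]_N.+1.

Lemma psd_mixed : psd ((N.+1%:R^-1)%:M : M).
Proof.
have [h1 h2] := @psd1 R N.+1; split=> [|v].
  by rewrite tr_scalar_mx map_scalar_mx; congr (_%:M); rewrite fmorphV /= rmorph_nat.
rewrite mul_mx_scalar -scalemxAl mxE mulr_ge0 ?invr_ge0 ?ler0n //.
by have := h2 v; rewrite mulmx1.
Qed.

Lemma mixed_tr : \tr ((N.+1%:R^-1)%:M : M) = 1.
Proof. by rewrite mxtrace_scalar -[LHS]mulr_natr mulVf ?pnatr_eq0. Qed.

Definition mixed : state R N.+1 := State psd_mixed mixed_tr.

Lemma outdist_mixed d (T : measurableType d) (F : observable R N.+1 T) S :
  complex.Re (\tr (F S)) = N.+1%:R * fine (outdist F mixed S).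
Proof.
have -> : fine (outdist F mixed S) = complex.Re (\tr (mixed *m F S)) by [].
rewrite /= mul_scalar_mx mxtraceZ -(rmorph_nat (@real_complex R)) -fmorphV /=.
case: (\tr _) => a b /=; rewrite mul0r subr0 mulrA divff ?mul1r ?pnatr_eq0 //.
Qed.

End MixedState.

Section Polar.
Variable R : realType.

Lemma dot_scale3 (e x : 3.-tuple R) r : dot e (scale3 r x) = r * dot e x.
Proof. by rewrite !dotE !tnth_mktuple; ring. Qed.

Lemma polar_coordinates (x : 3.-tuple R) : exists k r, 0 <= r /\ x = scale3 r (axis k).
Proof.
have d0 : 0 <= dot x x.
  by rewrite dotE -!expr2 !addr_ge0 ?sqr_ge0.
have [x0|x0] := eqVneq (dot x x) 0.
  exists (su2_one R), 0; split=> //; apply: tuple3_eq => j; rewrite tnth_mktuple mul0r.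
  move: x0; rewrite dotE -!expr2 => x0.
  by move: j; apply: I3_ind; apply/eqP; rewrite -sqrf_eq0; apply/eqP; nra.
pose r := Num.sqrt (dot x x).
have r0 : r != 0 by rewrite sqrtr_eq0 -ltNge lt_neqAle eq_sym x0.
have [|k hk] := @rotation_transitive R (scale3 r^-1 x).
  rewrite /unit_vector dot_scale3 dotE !tnth_mktuple.
  have := sqr_sqrtr d0; rewrite -/r dotE => h.
  rewrite -!mulrA -!mulrDr -h; field; exact: r0.
exists k, r; split; first exact: sqrtr_ge0.
by rewrite /axis hk; apply: tuple3_eq => j; rewrite !tnth_mktuple mulrA divff // mul1r.
Qed.

Lemma axisM (g h : su2 R) : axis (su2_mul g h) = rotation g (axis h).
Proof. exact: rotationM. Qed.

Lemma dot_axis_north (g : su2 R) : dot (axis g) (north R) = ez o2 g.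
Proof. by rewrite dotE !tnth_rotation_north !tnth_north /= /ez; ring. Qed.

Lemma dot_axisM (k g : su2 R) r :
  dot (axis (su2_mul k g)) (scale3 r (axis k)) = r * ez o2 g.
Proof. by rewrite dot_scale3 axisM dot_rotation dot_axis_north. Qed.

End Polar.

(** * The error at a fixed outcome, averaged over directions *)

Section Inner.
Variables (R : realType) (N : nat) (Q : spin_system R N).
Variables (H : probability (SU2 R) R) (Hinv : haar_measure H) (N_gt0 : (0 < N)%N).
Local Notation C := R[i].
Local Notation M := 'M[C]_N.+1.
Local Notation T := (SU2 R).
Local Notation mag := (magnetic R).
Local Notation X := (spin R N * (spin R N + 1)).

Definition in_frame k (A : M) : M := (frame Q k)^t* *m A *m frame Q k.

Lemma frameM k g : frame Q (su2_mul k g) = frame Q k *m U Q g.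
Proof. by rewrite !frame_ket U_mul; move: (U Q k) (U Q g) => a b; rewrite mulmxA. Qed.

Lemma qf_frame k j A : qf (col j (frame Q k)) A = complex.Re (in_frame k A j j).
Proof. by rewrite /qf frame_colE. Qed.

Lemma in_frameM k g A : in_frame (su2_mul k g) A = (U Q g)^t* *m in_frame k A *m U Q g.
Proof.
rewrite /in_frame frameM; move: (frame Q k) (U Q g) => a b.
by rewrite trC_mul !mulmxA.
Qed.

Lemma bmf_qf_frame j A : bmf (fun g : T => qf (col j (frame Q g)) A).
Proof.
have -> : (fun g : T => qf (col j (frame Q g)) A) = fun g : T => complex.Re
    (((U Q g)^t* *m in_frame (su2_one R) A *m U Q g) j j).
  by apply/funext => g; rewrite qf_frame -in_frameM su2_1mul.
apply: (proj1 _); apply: cbmf_mx_mul; last exact: cbmf_U.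
by apply: cbmf_mx_mul; [exact: cbmf_UtC|move=> *; exact: cbmf_cst].
Qed.

Lemma bmf_dot_axis x : bmf (fun g : T => dot (axis g) x).
Proof.
by apply: bmf_sum => j; apply: bmfM; [|exact: bmf_cst]; under eq_fun do rewrite tnth_rotation_north;
  exact: bmf_ez.
Qed.

(** The contribution of outcome [x], with operator density [A] there, to the error of eigenstate [j]
    along [axis g]. *)
Definition local_error j A x (g : T) : R :=
  qf (col j (frame Q g)) A * (dot (axis g) x - mag j) ^+ 2.

Lemma bmf_local_error j A x : bmf (local_error j A x).
Proof.
apply: bmfM; first exact: bmf_qf_frame.
by apply: bmfX; apply: bmfB; [exact: bmf_dot_axis|exact: bmf_cst].
Qed.

(** Substituting $kg$ for $g$ turns the direction of [x] into the north pole. The weight is then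
    zonal, so only the diagonal of [A] in the frame [k] contributes. *)
Lemma int_local_error k r j A : \int[H]_g local_error j A (scale3 r (axis k)) g =
  \sum_n complex.Re (in_frame k A n n) * (efun X (mag j) (mag n) r / N.+1%:R).
Proof.
rewrite -(haar_int Hinv k (bmf_local_error _ _ _)).
have hp : bmf (fun g : T => (r * ez o2 g - mag j) ^+ 2).
  by apply: bmfX; apply: bmfB; [apply: bmfM; [exact: bmf_cst|exact: bmf_ez]|exact: bmf_cst].
transitivity (\int[H]_g ((r * ez o2 g - mag j) ^+ 2 *
    complex.Re (\tr (in_frame k A *m rotated Q (delta_mx j j) g)))).
  apply: eq_Rintegral => g _; rewrite /local_error qf_frame in_frameM dot_axisM.
  by rewrite mulrC trace_rotated_delta.
apply: etrans (@avg_zonal_trace R N Q H Hinv (in_frame k A) j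
  (fun e => (r * e - mag j) ^+ 2) hp) _.
by apply: eq_bigr => n _; rewrite int_err_col.
Qed.

End Inner.

Lemma psd_conj (R : realType) n (W A : 'M[R[i]]_n) : psd A -> psd (W^t* *m A *m W).
Proof.
move=> [hA pA]; split=> [|v]; first by rewrite !trC_mul trmxCK hA mulmxA.
by have := pA (W *m v); rewrite trC_mul !mulmxA.
Qed.

(** Tested on $e_m-t\bar b\,e_i$ with $t=1/(1+a)$, the form equals $|b|^2t(ta-2)$, where $ta<1$. *)
Lemma psd_row0 (K : numClosedFieldType) n (A : 'M[K]_n) m i : A^t* = A ->
  (forall v : 'cV[K]_n, 0 <= (v^t* *m A *m v) 0 0) -> A m m = 0 -> A m i = 0.
Proof.
move=> hA pA m0; pose a := A i i; pose b := A m i.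
have a0 : 0 <= a by rewrite /a -(delta_sesq A); exact: pA.
have a1 : 0 < 1 + a by rewrite ltr_wpDr.
have bi : A i m = b^*%R by rewrite -[in LHS]hA !mxE.
pose t := (1 + a)^-1; have t0 : 0 < t by rewrite invr_gt0.
have tr : t^*%R = t by apply: CrealP; exact: gtr0_real.
have := pA (delta_mx m 0 + (- (t * b^*%R)) *: delta_mx i 0 : 'cV[K]_n).
rewrite polar m0 bi -/a -/b rmorphN rmorphM /= conjCK tr add0r => h.
have ta : t * a - 2 < 0.
  by rewrite subr_lt0 mulrC ltr_pdivrMr // mulrDr mulr1 mulr_natl mulr2n addrA ltrDr ltr_wpDr // ltr0n.
have : 0 <= (b * b^*%R) * (t * (t * a - 2)).
  by apply: le_trans h _; rewrite le_eqVlt; apply/orP; left; apply/eqP; ring.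
rewrite -normCK nmulr_lge0; last by rewrite pmulr_rlt0.
move=> b0; apply/eqP; rewrite -normr_eq0 -sqrf_eq0 eq_le b0 exprn_ge0 //.
Qed.

Lemma psd_diag_single (R : realType) n (A : 'M[R[i]]_n) j : psd A ->
  (forall m, m != j -> complex.Re (A m m) = 0) -> A = \tr A *: delta_mx j j.
Proof.
move=> [hA pA] h.
have d0 i : 0 <= A i i by rewrite -(delta_sesq A); exact: pA.
have Amm m : m != j -> A m m = 0.
  by move=> /h e; have := d0 m; rewrite lecE => /andP[/eqP im _]; exact: complex_eq.
have row0 m i : m != j -> A m i = 0 by move=> mj; exact: (@psd_row0 _ _ _ m i hA pA (Amm m mj)).
apply/matrixP => a b; rewrite [RHS]mxE [delta_mx _ _ _ _]mxE.
have [->|aj] := eqVneq a j; last by rewrite row0 // mulr0.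
have [->|bj] := eqVneq b j; rewrite ?mulr1 ?mulr0.
  by rewrite /mxtrace (bigD1 j) //= big1 ?addr0 // => m /Amm.
by rewrite -[A]hA !mxE row0 // conjC0.
Qed.

Lemma Delta_min_sq_ge0 (R : realType) N : 0 <= Delta_min_sq R N.
Proof.
rewrite /Delta_min_sq; case: ifP => _; first by lra.
case: ifP => _; first by lra.
have s0 : 0 <= spin R N by rewrite /spin divr_ge0 ?ler0n.
set s := spin R N in s0 *; have h : 0 <= 2 * s + 3 by lra.
have := sqr_sqrtr h; have := sqrtr_ge0 (2 * s + 3); set t := Num.sqrt _ => t0 tE.
by apply: divr_ge0 => //; nra.
Qed.

(** * The lower bound and its equality case *)

Section LowerBound.
Variables (R : realType) (N : nat) (Q : spin_system R N).
Variables (H : probability (SU2 R) R) (Hinv : haar_measure H) (N_gt0 : (0 < N)%N).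
Local Notation C := R[i].
Local Notation M := 'M[C]_N.+1.
Local Notation T := (SU2 R).
Local Notation X3 := (3.-tuple R).
Local Notation mag := (magnetic R).
Local Notation X := (spin R N * (spin R N + 1)).
Variables (F : observable R N.+1 X3) (mu : probability X3 R) (D : X3 -> M).
Hypothesis psdD : forall x, psd (D x).
Hypothesis trD : forall x, \tr (D x) = N.+1%:R.
Hypothesis densD : forall v, has_density mu (fun S => qf v (F S)) (fun x => qf v (D x)).

Lemma measurable_entries i j :
  measurable_fun setT (fun x => complex.Re (D x i j)) /\
  measurable_fun setT (fun x => complex.Im (D x i j)).
Proof.
have mq v : measurable_fun setT (fun x => qf v (D x)).
  exact: has_density_measurable (densD v).
split.
  under eq_fun do rewrite (Re_polar _ _ (psdD _).1).
  by apply: measurable_funM => //; apply: measurable_funD => //; apply: measurable_funM => //;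
    apply: measurable_funD.
under eq_fun do rewrite (Im_polar _ _ (psdD _).1).
by apply: measurable_funM => //; apply: measurable_funD => //; apply: measurable_funM => //;
  apply: measurable_funD.
Qed.

Lemma measurable_local_error j :
  measurable_fun setT (fun z : T * X3 => local_error Q j (D z.2) z.2 z.1).
Proof.
have m1 (f : T -> R) : bmf f -> measurable_fun setT (fun z : T * X3 => f z.1).
  by move=> [mf _]; apply: (measurableT_comp mf) => //; exact: measurable_fst.
have m2 (f : X3 -> R) : measurable_fun setT f -> measurable_fun setT (fun z : T * X3 => f z.2).
  by move=> mf; apply: (measurableT_comp mf) => //; exact: measurable_snd.
have cf i : cbmf (fun g : T => col j (frame Q g) i 0).
  under eq_fun do rewrite mxE frame_ket.
  by apply: cbmf_mx_mul; [move=> *; exact: cbmf_cst|exact: cbmf_U].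
apply: measurable_funM.
  under eq_fun do rewrite qf_rform.
  apply: measurable_sum => i; apply: measurable_sum => k.
  have [a1 a2] := cf i; have [b1 b2] := cf k; have [c1 c2] := measurable_entries i k.
  apply: measurable_funB; apply: measurable_funM.
  - exact: (m1 _ (bmfD (bmfM a1 b1) (bmfM a2 b2))).
  - exact: (m2 _ c1).
  - exact: (m1 _ (bmfB (bmfM a1 b2) (bmfM a2 b1))).
  - exact: (m2 _ c2).
suff md : measurable_fun setT (fun z : T * X3 => dot (axis z.1) z.2).
  exact: (measurable_funX 2 (measurable_funB md (measurable_cst (mag j)))).
apply: measurable_sum => i; apply: measurable_funM; last first.
  exact: (m2 (fun x => tnth x i) (measurable_tnth i)).
under eq_fun do rewrite tnth_rotation_north.
exact: (m1 (fun g => ez i g) (@bmf_ez R i)).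
Qed.

Lemma emeasurable_local_error j :
  measurable_fun setT (fun z : T * X3 => (local_error Q j (D z.2) z.2 z.1)%:E).
Proof. by apply/measurable_EFinP; exact: measurable_local_error. Qed.

Lemma local_error_ge0 j x g : 0 <= local_error Q j (D x) x g.
Proof. by rewrite mulr_ge0 ?sqr_ge0 ?qf_ge0. Qed.

Lemma cal_density k j : cal Q F k j = (\int[mu]_x (local_error Q j (D x) x k)%:E)%E.
Proof.
rewrite /cal /msd.
rewrite (@ge0_integral_image _ _ _ _ _ mu _ id _ (fun x => qf (col j (frame Q k)) (D x))) //=.
- by apply: eq_integral => x _; rewrite -EFinM mulrC.
- exact: has_density_measurable (densD _).
- by move=> x; exact: qf_ge0.
- move=> A mA; transitivity (outfun F (frame_state Q k j) A) => //.
  rewrite /frame_state outfun_pure -[LHS]/((qf (col j (frame Q k)) (F A))%:E).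
  rewrite (has_densityE (densD _) mA) integral_mkcond; apply: eq_integral => x _.
  by rewrite epatch_indic EFinM muleC.
- apply/measurable_EFinP; apply: measurable_funX; apply: measurable_funB => //.
  exact: measurable_dot.
- by move=> y; rewrite lee_fin sqr_ge0.
Qed.

Definition mean_error j x : R := \int[H]_g local_error Q j (D x) x g.

Lemma mean_errorE j x : (\int[H]_g (local_error Q j (D x) x g)%:E)%E = (mean_error j x)%:E.
Proof.
rewrite /mean_error /Rintegral fineK //; apply: integrable_fin_num => //.
exact: (bmf_integrable H (bmf_local_error Q j (D x) x)).
Qed.

Lemma measurable_mean_error j : measurable_fun setT (mean_error j).
Proof.
apply/measurable_EFinP.
have := @measurable_fun_fubini_tonelli_G _ _ _ _ _ H
  (fun z : T * X3 => (local_error Q j (D z.2) z.2 z.1)%:E)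
  (emeasurable_local_error j) (fun z => local_error_ge0 j z.2 z.1).
by rewrite /fubini_G; under eq_fun do rewrite /= mean_errorE; exact.
Qed.

(** Tonelli: the Haar average of the calibration errors becomes an integral over outcomes, which can
    be minimised outcome by outcome. *)
Lemma int_mean_error j :
  (\int[mu]_x (mean_error j x)%:E = \int[H]_g cal Q F g j)%E.
Proof.
under [RHS]eq_integral do rewrite cal_density.
under [LHS]eq_integral do rewrite -mean_errorE.
rewrite (@fubini_tonelli _ _ _ _ _ H mu (fun z => (local_error Q j (D z.2) z.2 z.1)%:E)) //.
- exact: emeasurable_local_error.
- by move=> z; exact: local_error_ge0.
Qed.

Lemma int_mean_error_le j (B : R) : (forall k, cal Q F k j <= B%:E)%E ->
  (\int[mu]_x (mean_error j x)%:E <= B%:E)%E.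
Proof.
move=> h; rewrite int_mean_error.
apply: (@le_trans _ _ (\int[H]_g (cst B%:E g))%E).
  apply: ge0_le_integral => //.
  - by move=> g _; exact: msd_ge0.
  - by under eq_fun do rewrite cal_density; exact: (@measurable_fun_fubini_tonelli_F _ _ _ _ _ mu
      (fun z : T * X3 => (local_error Q j (D z.2) z.2 z.1)%:E)
      (emeasurable_local_error j) (fun z => local_error_ge0 j z.2 z.1)).
rewrite (integral_cst H measurableT B%:E).
have h1 : H setT = 1%E := probability_setT H.
have e : (B%:E * H setT = B%:E)%E := etrans (congr1 (mule B%:E) h1) (mule1 _).
by apply: etrans (lexx B%:E); congr (_ <= _)%E; exact: e.
Qed.

Lemma in_frame_ge0 k x n : 0 <= complex.Re (in_frame Q k (D x) n n).
Proof. by rewrite -qf_frame; exact: qf_ge0. Qed.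

Lemma sum_in_frame k x : \sum_n complex.Re (in_frame Q k (D x) n n) = N.+1%:R.
Proof.
transitivity (complex.Re (\tr (in_frame Q k (D x)))).
  by rewrite /mxtrace (raddf_sum (@complex.Re R : {additive _ -> _})).
rewrite /in_frame mxtrace_mulC mulmxA (frameU Q k) mul1mx trD.
by rewrite -(rmorph_nat (@real_complex R)).
Qed.

Definition pure_at k x := in_frame Q k (D x) = N.+1%:R *: delta_mx ord_max ord_max.

(** All [k] in the second clause, because the polar representation of [x] is not unique and two
    densities must be comparable in a common frame. *)
Definition on_optimal_sphere x :=
  (exists k, x = scale3 (r_min R N) (axis k)) /\
  forall k, x = scale3 (r_min R N) (axis k) -> pure_at k x.

(** The diagonal of the density in the frame of [x], divided by the trace, is a probability on [n],
    so the error is an average of values bounded by [weighted_error]. Equality leaves only the entry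
    [ord_max], and a positive matrix with a single nonzero diagonal entry has no other entries. *)
Lemma mean_error_bound : exists2 p : R, 0 <= p <= 1 & forall x,
  let G := p * mean_error ord_max x + (1 - p) * mean_error (mid N) x in
  Delta_min_sq R N <= G /\ (G = Delta_min_sq R N -> on_optimal_sphere x).
Proof.
have [p p01 hp] := weighted_error R N_gt0; exists p => // x G.
suff main k r : 0 <= r -> x = scale3 r (axis k) -> Delta_min_sq R N <= G /\
    (G = Delta_min_sq R N -> r = r_min R N /\ pure_at k x).
  have [k [r [r0 xE]]] := polar_coordinates x; have [h1 h2] := main k r r0 xE.
  split=> // /[dup] h /h2[rE _]; split; first by exists k; rewrite -rE.
  have rm : 0 <= r_min R N by rewrite -rE.
  by move=> k' xE'; exact: ((main k' _ rm xE').2 h).2.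
move=> r0 xE.
pose c n := complex.Re (in_frame Q k (D x) n n) / N.+1%:R.
pose g (n : 'I_N.+1) := p * efun X (mag (@ord_max N)) (mag n) r + (1 - p) * efun X (mag (mid N)) (mag n) r.
have N0 : (N.+1%:R : R) != 0 by rewrite pnatr_eq0.
have c0 n : 0 <= c n by rewrite mulr_ge0 ?in_frame_ge0 ?invr_ge0 ?ler0n.
have c1 : \sum_n c n = 1 by rewrite -mulr_suml sum_in_frame divff.
have GE : G = \sum_n c n * g n.
  have ME j : mean_error j x = \sum_n complex.Re (in_frame Q k (D x) n n) *
      (efun X (mag j) (mag n) r / N.+1%:R).
    by rewrite /mean_error {2}xE int_local_error.
  rewrite /G !ME !mulr_sumr -big_split /=.
  apply: eq_bigr => n _; rewrite /c /g.
  move: (complex.Re _) (efun _ _ _ _) (efun _ _ _ _) (N.+1%:R^-1) => a b d e; ring.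
have dE : Delta_min_sq R N = \sum_n c n * Delta_min_sq R N by rewrite -mulr_suml c1 mul1r.
have le n : c n * Delta_min_sq R N <= c n * g n by rewrite ler_wpM2l //; exact: (hp n r r0).1.
split; first by rewrite GE [X in X <= _]dE; apply: ler_sum => n _.
move=> Geq; have eq0 n : c n * g n = c n * Delta_min_sq R N.
  apply/eqP; rewrite -subr_eq0; have : \sum_n (c n * g n - c n * Delta_min_sq R N) == 0.
    by rewrite sumrB -dE -GE Geq subrr.
  rewrite psumr_eq0 => [/allP /(_ n (mem_index_enum _)) //|i _].
  by rewrite subr_ge0.
have nz n : c n != 0 -> n = ord_max /\ r = r_min R N.
  by move=> cn; apply: (hp n r r0).2; apply: (mulfI cn); exact: eq0.
have [n cn] : exists n, c n != 0.
  apply: contrapT => h; have : \sum_n c n = 0.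
    by apply: big1 => n _; apply/eqP/negPn/negP => cn; apply: h; exists n.
  by rewrite c1 => /eqP; rewrite oner_eq0.
have [_ rE] := nz n cn; split=> //.
have pA : psd (in_frame Q k (D x)) := psd_conj (frame Q k) (psdD x).
have trA : \tr (in_frame Q k (D x)) = N.+1%:R.
  by rewrite /in_frame mxtrace_mulC mulmxA (frameU Q k) mul1mx trD.
rewrite /pure_at -trA; apply: psd_diag_single => //.
  move=> m mN; have : c m == 0 by apply/negPn/negP => /nz[] h; rewrite h eqxx in mN.
by rewrite mulf_eq0 invr_eq0 (negPf N0) orbF => /eqP.
Qed.

(** Integrates the pointwise bound over the probability [mu]. If [B] is the minimum, the excess is
    nonnegative with integral 0, hence vanishes almost everywhere. *)
Lemma error_lower_bound (B : R) : (forall k j, cal Q F k j <= B%:E)%E ->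
  Delta_min_sq R N <= B /\ (B = Delta_min_sq R N -> \forall x \ae mu,
    on_optimal_sphere x).
Proof.
move=> h; have [p /andP[p0 p1] hp] := mean_error_bound.
pose G x := p * mean_error ord_max x + (1 - p) * mean_error (mid N) x.
have q0 : 0 <= 1 - p by rewrite subr_ge0.
have me0 j x : (0 <= (mean_error j x)%:E)%E.
  by rewrite lee_fin; apply: Rintegral_ge0 => g _; exact: local_error_ge0.
have mm j : measurable_fun setT (fun x => (mean_error j x)%:E).
  by apply/measurable_EFinP; exact: measurable_mean_error.
have mG : measurable_fun setT G.
  by apply: measurable_funD; apply: measurable_funM => //; exact: measurable_mean_error.
have intG : (\int[mu]_x (G x)%:E <= B%:E)%E.
  under eq_integral do rewrite EFinD !EFinM.
  rewrite ge0_integralD //; last 4 first.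
  - by move=> x _; rewrite mule_ge0 // lee_fin.
  - by apply: emeasurable_funM.
  - by move=> x _; rewrite mule_ge0 // lee_fin.
  - by apply: emeasurable_funM.
  rewrite !ge0_integralZl //; try by move=> *; exact: me0.
  have -> : B%:E = (p%:E * B%:E + (1 - p)%:E * B%:E)%E.
    by rewrite -!EFinM -EFinD; congr EFin; ring.
  by apply: leeD; apply: lee_wpmul2l; rewrite ?lee_fin //; apply: int_mean_error_le.
have D0 x : 0 <= G x - Delta_min_sq R N by rewrite subr_ge0; exact: (hp x).1.
have intD : (\int[mu]_x (G x - Delta_min_sq R N)%:E <= (B - Delta_min_sq R N)%:E)%E.
  have E : (\int[mu]_x (G x)%:E =
      \int[mu]_x (G x - Delta_min_sq R N)%:E + (Delta_min_sq R N)%:E)%E.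
    under eq_integral do rewrite -[G _](subrK (Delta_min_sq R N)) EFinD.
    rewrite ge0_integralD //.
    - congr (_ + _)%E; rewrite (integral_cst mu measurableT).
      have h1 : mu setT = 1%E := probability_setT mu.
      exact: etrans (congr1 (mule (Delta_min_sq R N)%:E) h1) (mule1 _).
    - by move=> x _; rewrite lee_fin.
    - by apply/measurable_EFinP; apply: measurable_funB.
    - by move=> x _; rewrite lee_fin Delta_min_sq_ge0.
  by rewrite EFinB leeBrDr // -E.
split.
  by rewrite -subr_ge0 -lee_fin; apply: le_trans intD; apply: integral_ge0 => x _; rewrite lee_fin.
move=> BE; have : (\int[mu]_x `|(G x - Delta_min_sq R N)%:E| = 0)%E.
  apply/eqP; rewrite eq_le integral_ge0 ?andbT //.
  under eq_integral do rewrite gee0_abs ?lee_fin //.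
  by move: intD; rewrite BE subrr.
move=> /(ae_eq_integral_abs mu measurableT _) hae.
have mGD : measurable_fun setT (fun x => (G x - Delta_min_sq R N)%:E).
  by apply/measurable_EFinP; apply: measurable_funB.
apply: filterS (hae mGD) => x /(_ Logic.I) [] /eqP; rewrite subr_eq0 => /eqP.
exact: (hp x).2.
Qed.

End LowerBound.

Lemma tC_mxE (K : numClosedFieldType) n (A : 'M[K]_n) i j : (A^t*) i j = (A j i)^*%R.
Proof. by rewrite !mxE. Qed.

Lemma cvg_eq (R : realType) (u u' : nat -> \bar R) (l l' : \bar R) :
  u =1 u' -> l = l' -> u' @ \oo --> l' -> u @ \oo --> l.
Proof. by move=> /funext -> ->. Qed.

(** * Weighted image measures and the map from SU(2) to a sphere *)

Section WeightedImage.
Local Open Scope ereal_scope.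
Context d1 d2 (X : measurableType d1) (Y : measurableType d2) (R : realType).
Variables (mu : {measure set X -> \bar R}) (phi : X -> Y) (f : X -> \bar R).

Lemma semi_sigma_additive_image : measurable_fun setT phi -> measurable_fun setT f ->
  (forall x, 0 <= f x) -> semi_sigma_additive (fun S => \int[mu]_(x in phi @^-1` S) f x).
Proof.
move=> mphi mf f0 S mS tS mUS; rewrite preimage_bigcup.
have mpre A : measurable A -> measurable (phi @^-1` A).
  by move=> mA; rewrite -[_ @^-1` _]setTI; exact: mphi.
apply: (semi_sigma_additive_nng_induced mf f0 (F := fun k => phi @^-1` S k)).
- by move=> k; exact: mpre.
- by apply/trivIsetP => i j _ _ ij; rewrite -preimage_setI;
    move/trivIsetP : tS => /(_ i j Logic.I Logic.I ij) ->; rewrite preimage_set0.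
- by rewrite -preimage_bigcup; exact: mpre.
Qed.

End WeightedImage.

Section Rotations.
Variable R : realType.

Lemma rotation_scale3 (g : su2 R) r x : rotation g (scale3 r x) = scale3 r (rotation g x).
Proof.
apply: tuple3_eq => j; rewrite tnth_rotation [RHS]tnth_mktuple tnth_rotation !sumI3 !tnth_mktuple; ring.
Qed.

Lemma measurable_rotation (g : su2 R) : measurable_fun setT (rotation g).
Proof.
apply/measurable_fun_tnthP => j.
rewrite (_ : _ \o _ = fun x => \sum_k rotation_mx g j k * tnth x k); last first.
  by apply/funext => x; exact: tnth_rotation.
by apply: measurable_sum => k; apply: measurable_funM => //; exact: measurable_tnth.
Qed.

Definition sphere_point (r : R) (g : SU2 R) : 3.-tuple R := scale3 r (axis g).

Lemma measurable_sphere_point r : measurable_fun setT (sphere_point r).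
Proof.
apply/measurable_fun_tnthP => j.
rewrite (_ : _ \o _ = fun g => r * rotation_mx g j o2); last first.
  by apply/funext => g; rewrite /= tnth_mktuple tnth_rotation_north.
by apply: measurable_funM => //; exact: (@bmf_ez R j).1.
Qed.

Lemma sphere_pointM r (g h : su2 R) :
  sphere_point r (su2_mul g h) = rotation g (sphere_point r h).
Proof. by rewrite /sphere_point axisM rotation_scale3. Qed.

Lemma dot_sphere_pointM r (k g : su2 R) : dot (axis k) (sphere_point r (su2_mul k g)) = r * ez o2 g.
Proof.
by rewrite /sphere_point dot_scale3 axisM dot_rotation dotE !tnth_north !tnth_rotation_north /ez /=; ring.
Qed.

Lemma preimage_measurable d (T : measurableType d) d' (T' : measurableType d') (f : T -> T') S :
  measurable_fun setT f -> measurable S -> measurable (f @^-1` S).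
Proof. by move=> mf mS; rewrite -[_ @^-1` _]setTI; exact: mf. Qed.

End Rotations.

(** * Construction of the coherent-state observable of radius [r] *)

Section Optimal.
Variables (R : realType) (N : nat) (Q : spin_system R N).
Variables (H : probability (SU2 R) R) (Hinv : haar_measure H) (N_gt0 : (0 < N)%N).
Local Notation C := R[i].
Local Notation M := 'M[C]_N.+1.
Local Notation T := (SU2 R).
Local Notation X3 := (3.-tuple R).
Local Notation mag := (magnetic R).
Local Notation X := (spin R N * (spin R N + 1)).
Local Notation K := (ketmx Q).
Local Notation Es := (delta_mx ord_max ord_max : M).
Variable r : R.

Lemma bmf_sphere_indic S : measurable S -> bmf (fun g : T => \1_S (sphere_point r g) : R).
Proof.
move=> mS; rewrite (_ : (fun g => _) = \1_(sphere_point r @^-1` S)).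
  exact: bmf_indic (preimage_measurable (@measurable_sphere_point R r) mS).
by apply/funext => g; rewrite !indicE; congr (_%:R).
Qed.

(** [avg] lives in the [ket] basis, hence the conjugation by [ketmx Q]. Non-measurable sets get 0,
    which is positive as required of every set. *)
Definition coherent_povm (S : set X3) : M :=
  if `[< measurable S >] then
    N.+1%:R *: (K *m avg Q H Es (fun g => \1_S (sphere_point r g)) *m K^t*)
  else 0.

(** The Husimi function $\langle s|U_g^*AU_g|s\rangle$, computed in the [ket] basis. *)
Definition overlap (A : M) (g : T) : R := complex.Re (\tr (inket Q A *m rotated Q Es g)).

Lemma cbmf_overlap A : cbmf (fun g : T => \tr (inket Q A *m rotated Q Es g)).
Proof.
apply: cbmf_sum => i.
by apply: cbmf_mx_mul; [move=> *; exact: cbmf_cst|exact: cbmf_rotated].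
Qed.

Lemma bmf_overlap A : bmf (overlap A).
Proof. exact: (cbmf_overlap A).1. Qed.

Lemma coherent_trace A S : measurable S -> complex.Re (\tr (A *m coherent_povm S)) =
  \int[H]_g (\1_S (sphere_point r g) * (N.+1%:R * overlap A g)).
Proof.
move=> mS; rewrite /coherent_povm asboolT // -scalemxAr mxtraceZ.
have hp := bmf_sphere_indic mS.
have -> : \tr (A *m (K *m avg Q H Es (fun g => \1_S (sphere_point r g)) *m K^t*)) =
    \tr (inket Q A *m avg Q H Es (fun g => \1_S (sphere_point r g))).
  by rewrite /inket !mulmxA mxtrace_mulC !mulmxA.
rewrite (avg_trace _ _ _ _ hp) -(rmorph_nat (@real_complex R)).
transitivity (N.+1%:R * \int[H]_g (\1_S (sphere_point r g) * overlap A g)).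
  rewrite /cint /= mul0r subr0; congr (_ * _); apply: eq_Rintegral => g _.
  by rewrite /overlap; case: (\tr _) => a b /=; rewrite mul0r subr0.
rewrite -bintZ; last by apply: bmfM => //; exact: bmf_overlap.
by apply: eq_Rintegral => g _; rewrite mulrCA.
Qed.

Lemma rotated_herm g : (rotated Q Es g)^t* = rotated Q Es g.
Proof.
by rewrite -rotatedE; apply: herm_sandwich; rewrite trmx_delta map_delta_mx.
Qed.

Lemma avg_herm p : bmf p -> (avg Q H Es p)^t* = avg Q H Es p.
Proof.
move=> hp; apply/matrixP => i j; rewrite tC_mxE [in LHS]mxE [RHS]mxE.
have hc g : rotated Q Es g i j = (rotated Q Es g j i)^*%R.
  by rewrite -[in LHS](rotated_herm g) tC_mxE.
have hb : bmf (fun g : T => complex.Im ((p g)%:C * rotated Q Es g j i)).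
  by apply: (proj2 _); apply: cbmfM; [exact: cbmf_real|exact: cbmf_rotated].
apply: complex_eq => /=.
  by apply: eq_Rintegral => g _; rewrite hc; case: (rotated Q Es g j i) => a b /=; ring.
rewrite -bintN //; apply: eq_Rintegral => g _.
by rewrite hc; case: (rotated Q Es g j i) => a b /=; ring.
Qed.

Lemma qf_tr_proj v (A : M) : qf v A = complex.Re (\tr ((v *m v^t*) *m A)).
Proof. by rewrite /qf -[in RHS]mulmxA [in RHS]mxtrace_mulC [in RHS]/mxtrace big_ord1. Qed.

Lemma qf_coherent v S : measurable S -> qf v (coherent_povm S) =
  \int[H]_g (\1_S (sphere_point r g) * (N.+1%:R * overlap (v *m v^t*) g)).
Proof. by move=> mS; rewrite qf_tr_proj coherent_trace. Qed.

Lemma overlap_ge0 (A : M) g : psd A -> 0 <= overlap A g.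
Proof.
move=> pA; rewrite /overlap trace_rotated_delta -(delta_sesq _ ord_max).
by apply: qf_ge0; apply: psd_conj; apply: psd_conj.
Qed.

Lemma weight_ge0 (v : 'cV[C]_N.+1) g : 0 <= N.+1%:R * overlap (v *m v^t*) g.
Proof. by rewrite mulr_ge0 // overlap_ge0 //; exact: psd_proj. Qed.

Lemma bmf_weight A : bmf (fun g : T => N.+1%:R * overlap A g).
Proof. by apply: bmfM; [exact: bmf_cst|exact: bmf_overlap]. Qed.

Lemma int_indicE (p : T -> R) S : measurable S -> bmf p ->
  (\int[H]_g (\1_S (sphere_point r g) * p g))%:E =
  (\int[H]_(g in sphere_point r @^-1` S) (p g)%:E)%E.
Proof.
move=> mS hp; rewrite integral_mkcond /Rintegral fineK; last first.
  apply: integrable_fin_num => //; apply: (bmf_integrable H (bmfM (bmf_sphere_indic mS) hp)).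
by apply: eq_integral => g _; rewrite epatch_indic EFinM muleC.
Qed.

Lemma coherent_psd S : psd (coherent_povm S).
Proof.
have [mS|nS] := pselect (measurable S); last first.
  rewrite /coherent_povm asboolF //; split=> [|v]; first by rewrite trmx0 map_mx0.
  by rewrite mulmx0 mul0mx mxE.
apply: psd_qf => [|v]; last first.
  by rewrite qf_coherent //; apply: Rintegral_ge0 => g _; rewrite mulr_ge0 ?weight_ge0.
rewrite /coherent_povm asboolT // linearZ /= map_mxZ rmorph_nat; congr (_ *: _).
by apply: herm_sandwich; apply: avg_herm; exact: bmf_sphere_indic.
Qed.

Lemma coherent_set0 : coherent_povm set0 = 0.
Proof.
rewrite /coherent_povm asboolT // (_ : avg _ _ _ _ = 0) ?mulmx0 ?mul0mx ?scaler0 //.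
apply/matrixP => i j; rewrite [RHS]mxE mxE.
by apply: complex_eq => /=; under eq_Rintegral do rewrite indic0 mul0r; rewrite bint_cst.
Qed.

Lemma coherent_setT : coherent_povm setT = 1%:M.
Proof.
rewrite /coherent_povm asboolT //.
rewrite (_ : (fun g => _) = fun=> 1); last by apply/funext => g; rewrite indicT.
rewrite (avg_cst Q Hinv) mul_mx_scalar -scalemxAl ketmxK scalerA.
rewrite /mxtrace (bigD1 ord_max) //= big1 => [|i ni]; last by rewrite mxE (negPf ni).
by rewrite mxE !eqxx addr0 mul1r mulfV ?pnatr_eq0 // scale1r.
Qed.

Lemma coherent_sigma_additive (v : 'cV[C]_N.+1) :
  semi_sigma_additive (fun S => (complex.Re ((v^t* *m coherent_povm S *m v) 0 0))%:E).
Proof.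
have [mw _] := bmf_weight (v *m v^t*).
pose w (g : T) : \bar R := (N.+1%:R * overlap (v *m v^t*) g)%:E.
have E A : measurable A -> (qf v (coherent_povm A))%:E =
    (\int[H]_(g in sphere_point r @^-1` A) w g)%E.
  by move=> mA; rewrite qf_coherent // int_indicE //; exact: bmf_weight.
have mE : measurable_fun setT w by exact/measurable_EFinP.
have w0 g : (0 <= w g)%E by rewrite lee_fin; exact: weight_ge0.
move=> S mS tS mUS.
have h := @semi_sigma_additive_image _ _ _ _ _ H _ _ (@measurable_sphere_point R r) mE w0 S mS tS mUS.
apply: (cvg_eq _ (E _ mUS) h) => n.
by apply: eq_bigr => i _; exact: E (mS i).
Qed.

Definition coherent_observable : observable R N.+1 X3 :=
  Observable coherent_psd coherent_set0 coherent_setT coherent_sigma_additive.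

End Optimal.

(** * Couplings of mixtures with a discrete law *)

Definition pair_const (R : realType) (c y : R) : R * R := (y, c).

Lemma measurable_pair_const (R : realType) (c : R) : measurable_fun setT (pair_const c).
Proof.
apply/measurable_fun_pairP; split.
  by rewrite (_ : fst \o _ = id) //; exact: measurable_id.
by rewrite (_ : snd \o _ = cst c) //; exact: measurable_cst.
Qed.

HB.instance Definition _ (R : realType) (c : R) :=
  isMeasurableFun.Build _ _ _ _ _ (measurable_pair_const c).

Section Mixture.
Variables (R : realType) (n : nat) (w : 'I_n -> {nonneg R}).
Variables (P : 'I_n -> probability R R) (m : 'I_n -> R).
Hypothesis w1 : \sum_j (w j)%:num = 1.

Let part j : probability (R * R)%type R :=
  distribution (P j) (pair_const (m j) : {mfun R >-> (R * R)%type}).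

Let parts (k : nat) : {measure set (R * R)%type -> \bar R} :=
  if insub k is Some j then mscale (w j) (part j) else mzero.

Definition mixture_coupling := msum parts n.

Lemma mixture_couplingE S :
  mixture_coupling S = (\sum_j ((w j)%:num)%:E * P j [set y | S (y, m j)])%E.
Proof.
by rewrite /mixture_coupling /msum; apply: eq_bigr => j _; rewrite /parts valK.
Qed.

HB.instance Definition _ := Measure.on mixture_coupling.

Lemma mixture_coupling_setT : mixture_coupling setT = 1%E.
Proof.
rewrite mixture_couplingE -w1 -sumEFin; apply: eq_bigr => j _.
have h : P j setT = 1%E := probability_setT (P j).
exact: etrans (congr1 (mule _) h) (mule1 _).
Qed.

HB.instance Definition _ := Measure_isProbability.Build _ _ _ mixture_coupling
  mixture_coupling_setT.

(** With probability [w j], draw the first coordinate from [P j] and set the second to [m j]: this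
    couples [mu] and [nu], and its cost is the weighted mean of the individual ones. *)
Lemma D2_mixture_le (mu nu : probability R R) (B : R) : 0 <= B ->
  (forall S, measurable S -> mu S = (\sum_j ((w j)%:num)%:E * P j S)%E) ->
  (forall S, measurable S -> nu S = (\sum_j ((w j)%:num)%:E * (\1_S (m j))%:E)%E) ->
  (forall j, msd (P j) (fun y => (y - m j)%R) <= B%:E)%E ->
  (D2 mu nu <= (B%:E) `^ 2^-1)%E.
Proof.
move=> B0 hmu hnu hB.
pose gamma : probability (R * R)%type R := mixture_coupling.
have c : couplings mu nu gamma.
  move=> S mS; split.
    rewrite hmu //; apply: etrans (mixture_couplingE _) _; apply: eq_bigr => j _.
    apply: (congr1 (fun A : set R => (((w j)%:num)%:E * P j A)%E)).
    by apply/seteqP; split => y //= [].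
  rewrite hnu //; apply: etrans (mixture_couplingE _) _; apply: eq_bigr => j _.
  congr (_ * _)%E; rewrite indicE; case: (boolP (m j \in S)) => [/set_mem h|/negP h].
    have h1 : P j setT = 1%E := probability_setT (P j).
    by apply: etrans h1; apply: (congr1 (P j)); apply/seteqP; split.
  have h0 : P j set0 = 0%E := measure0 (P j).
  apply: etrans h0; apply: (congr1 (P j)); apply/seteqP; split => y //= [_ /mem_set].
  exact: h.
apply: (@le_trans _ _ (Lnorm gamma 2%:E (fun z : R * R => (z.1 - z.2)%:E))).
  by apply: ereal_inf_lbound; exists gamma.
rewrite Lnorm2E; apply: gt0_ler_poweR; rewrite ?in_itv /= ?leey ?andbT ?msd_ge0 ?lee_fin //.
have msq : measurable_fun setT (fun z : R * R => ((z.1 - z.2) ^+ 2)%:E).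
  by apply/measurable_EFinP; apply: measurable_funX; apply: measurable_funB.
suff : (\int[msum parts n]_z ((z.1 - z.2) ^+ 2)%:E <= B%:E)%E by [].
rewrite ge0_integral_measure_sum //; last first.
  by move=> z _; rewrite lee_fin sqr_ge0.
have -> : B%:E = (\sum_(j < n) ((w j)%:num)%:E * B%:E)%E.
  by under eq_bigr do rewrite -EFinM; rewrite sumEFin -mulr_suml w1 mul1r.
apply: lee_sum => j _; rewrite /parts valK ge0_integral_mscale //; last first.
  by move=> z _; rewrite lee_fin sqr_ge0.
apply: lee_wpmul2l; first by rewrite lee_fin.
apply: le_trans (hB j); rewrite ge0_integral_pushforward //.
by move=> z _; rewrite lee_fin sqr_ge0.
Qed.

End Mixture.

(** * Covariance, parameter measure and calibration errors of the coherent-state observable *)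

Lemma delta_sandwich (K : numClosedFieldType) n (A : 'M[K]_n) j s :
  (A^t* *m delta_mx j j *m A) s s = A j s * (A j s)^*%R.
Proof.
rewrite mxE (bigD1 j) //= big1 ?addr0 => [|k kj].
  rewrite mxE (bigD1 j) //= big1 ?addr0 => [|k kj]; first by rewrite !mxE !eqxx mulr1 mulrC.
  by rewrite [delta_mx _ _ _ _]mxE (negPf kj) mulr0.
rewrite mxE big1 ?mul0r // => l _.
by rewrite [delta_mx _ _ _ _]mxE (negPf kj) andbF mulr0.
Qed.

Lemma conj_sandwich (K : numClosedFieldType) n (W u a b : 'M[K]_n) :
  W^t* *m W = 1%:M -> u *m a *m u^t* = b ->
  W *m u *m W^t* *m (W *m a *m W^t*) *m (W *m u *m W^t*)^t* = W *m b *m W^t*.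
Proof.
move=> hW <-; rewrite !trmx_mul !map_mxM trmxCK !mulmxA.
by rewrite -(mulmxA _ (W^t*) W) hW mulmx1 -(mulmxA _ (W^t*) W) hW mulmx1.
Qed.

Lemma col_proj (K : numClosedFieldType) n (A : 'M[K]_n) j :
  col j A *m (col j A)^t* = A *m delta_mx j j *m A^t*.
Proof.
rewrite colE trmx_mul map_mxM trmx_delta map_delta_mx !mulmxA.
by rewrite -(mulmxA A) mul_delta_mx.
Qed.

Section Coherent.
Variables (R : realType) (N : nat) (Q : spin_system R N).
Variables (H : probability (SU2 R) R) (Hinv : haar_measure H) (N_gt0 : (0 < N)%N).
Local Notation C := R[i].
Local Notation M := 'M[C]_N.+1.
Local Notation T := (SU2 R).
Local Notation X3 := (3.-tuple R).
Local Notation mag := (magnetic R).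
Local Notation X := (spin R N * (spin R N + 1)).
Local Notation K := (ketmx Q).
Local Notation Es := (delta_mx ord_max ord_max : M).
Variable r : R.
Local Notation FO := (@coherent_observable R N Q H Hinv r).

Lemma overlapE (A : M) g : overlap Q A g = complex.Re (\tr (A *m
  (rep Q g *m (ket Q ord_max *m (ket Q ord_max)^t*) *m (rep Q g)^t*))).
Proof.
have e : inket Q (ket Q ord_max *m (ket Q ord_max)^t*) = Es.
  rewrite -(col_ketmx Q ord_max) col_proj /inket; move: (K) (ketmx_tCK Q) => B hB.
  by rewrite !mulmxA hB mul1mx -mulmxA hB mulmx1.
rewrite /overlap -[in RHS](mxtrace_inket Q) [in RHS]inketM -rotatedE.
Transparent U.
by rewrite [in RHS]inketM [in RHS]inketM [in RHS]inket_tC e /U.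
Opaque U.
Qed.

Lemma outdist_coherent rho A : measurable A -> outdist FO rho A =
  (\int[H]_g (\1_A (sphere_point r g) * (N.+1%:R * overlap Q rho g))%:E)%E.
Proof.
move=> mA; transitivity ((complex.Re (\tr (rho *m coherent_povm Q H r A)))%:E) => //.
rewrite coherent_trace // /Rintegral fineK //; apply: integrable_fin_num => //.
apply: (bmf_integrable H (bmfM (bmf_sphere_indic r mA) (bmf_weight Q rho))).
Qed.

Lemma int_coherent rho (f : X3 -> \bar R) : measurable_fun setT f -> (forall x, 0 <= f x)%E ->
  (\int[outdist FO rho]_x f x =
   \int[H]_g (f (sphere_point r g) * (N.+1%:R * overlap Q rho g)%:E))%E.
Proof.
move=> mf f0; apply: ge0_integral_image => //.
- exact: measurable_sphere_point.
- exact: (bmf_weight Q rho).1.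
- by move=> g; rewrite mulr_ge0 // overlap_ge0 //; exact: density_psd.
- by move=> A mA; exact: outdist_coherent.
Qed.

Lemma coherent_covariant : covariant Q FO.
Proof.
move=> g S mS; rewrite /= /coherent_povm.
have mS' := preimage_measurable (@measurable_rotation R g) mS.
rewrite !asboolT // -scalemxAr -scalemxAl; congr (_ *: _).
have hp := bmf_sphere_indic r mS'.
have h := avg_conj Q Hinv Es g hp.
have -> : rep Q g = K *m U Q g *m K^t*.
Transparent frame.
  by rewrite -frame_ket /frame -mulmxA ketmxK mulmx1.
Opaque frame.
have e : avg Q H Es (fun h => \1_(rotation g @^-1` S) (sphere_point r (su2_mul (su2_inv g) h))) =
    avg Q H Es (fun h => \1_S (sphere_point r h)).
  apply: (congr1 (avg Q H Es)); apply/funext => k.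
  have key : rotation g (sphere_point r (su2_mul (su2_inv g) k)) = sphere_point r k.
    by rewrite -sphere_pointM su2_mulVK.
  by rewrite !indicE -[in RHS]key; congr (_%:R).
exact: conj_sandwich (ketmx_tCK Q) (etrans h e).
Qed.

Lemma coherent_point : point_covariant Q H FO ord_max r.
Proof.
move=> rho h mh [B hB].
have p0 g : 0 <= N.+1%:R * overlap Q rho g.
  by rewrite mulr_ge0 // overlap_ge0 //; exact: density_psd.
have bp := bmf_weight Q rho.
have bh : bmf (fun g : T => h (sphere_point r g)).
  by split; [apply: measurableT_comp => //; exact: measurable_sphere_point|exists B].
have bh' : bmf h by split => //; exists B.
have pos x : 0 <= h x + B by have := hB x; rewrite ler_norml => /andP[]; lra.
(* [h] may change sign, so it is shifted by its bound to apply the formula for nonnegative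
   functions; [e2] to [e4] remove the shift. *)
have e1 : \int[outdist FO rho]_x (h x + B) =
    \int[H]_g ((h (sphere_point r g) + B) * (N.+1%:R * overlap Q rho g)).
  rewrite /Rintegral (int_coherent rho (f := fun x => (h x + B)%:E)) //.
  - by apply/measurable_EFinP; apply: measurable_funD.
have e2 : \int[H]_g (N.+1%:R * overlap Q rho g) = 1.
  have h1 : outdist FO rho setT = 1%E := probability_setT (outdist FO rho).
  apply/esym; apply: etrans (congr1 fine (etrans (esym h1) (outdist_coherent rho measurableT))) _.
  by apply: eq_Rintegral => g _; rewrite indicT mul1r.
have e3 : \int[outdist FO rho]_x (h x + B) = \int[outdist FO rho]_x h x + B.
  by rewrite bintD // ?bint_cst //; exact: bmf_cst.
have e4 : \int[H]_g ((h (sphere_point r g) + B) * (N.+1%:R * overlap Q rho g)) =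
    \int[H]_g (h (sphere_point r g) * (N.+1%:R * overlap Q rho g)) + B.
  under eq_Rintegral do rewrite mulrDl.
  by rewrite (bintD H (bmfM bh bp) (bmfM (@bmf_cst _ T R B) bp)) bintZ // e2 mulr1.
have -> : \int[outdist FO rho]_x h x =
    \int[H]_g (h (sphere_point r g) * (N.+1%:R * overlap Q rho g)).
  by apply: (addIr B); rewrite -e3 e1 e4.
transitivity (N.+1%:R * \int[H]_g (overlap Q rho g * h (sphere_point r g))); last first.
  apply: (congr1 (fun z => N.+1%:R * z)); apply: eq_Rintegral => g _.
  exact: (congr1 (fun z => z * h (sphere_point r g)) (overlapE rho g)).
rewrite -(bintZ H _ (bmfM (bmf_overlap Q rho) bh)).
by apply: eq_Rintegral => g _; rewrite mulrC mulrA.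
Qed.

Lemma overlap_frame k j g :
  overlap Q (col j (frame Q k) *m (col j (frame Q k))^t*) (su2_mul k g) = trans Q j ord_max g.
Proof.
rewrite /overlap trace_rotated_delta /trans -delta_sandwich; apply: (congr1 (@complex.Re R)).
have e : inket Q (col j (frame Q k) *m (col j (frame Q k))^t*) =
    U Q k *m delta_mx j j *m (U Q k)^t*.
  rewrite col_proj frame_ket /inket; move: (U Q k) => u.
  by rewrite trC_mul !mulmxA ketmx_tCK mul1mx -mulmxA ketmx_tCK mulmx1.
rewrite e U_mul; move: (U_tCK Q k); move: (U Q k) (U Q g) => u v hu.
suff -> : (u *m v)^t* *m (u *m delta_mx j j *m u^t*) *m (u *m v) = v^t* *m delta_mx j j *m v by [].
rewrite trC_mul !mulmxA -(mulmxA _ (u^t*) u) hu mulmx1.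
by rewrite -(mulmxA _ (u^t*) u) hu mulmx1.
Qed.

(** Shifting the Haar variable by [k] removes the dependence on the direction and leaves the error
    integral with $n=s$. *)
Lemma cal_coherent k j : cal Q FO k j = (efun X (mag j) (mag (@ord_max N)) r)%:E.
Proof.
rewrite /cal /msd int_coherent; last first.
- by move=> x; rewrite lee_fin sqr_ge0.
- apply/measurable_EFinP; apply: measurable_funX; apply: measurable_funB => //.
  exact: measurable_dot.
pose f (g : T) := (dot (axis k) (sphere_point r g) - mag j) ^+ 2 *
  (N.+1%:R * overlap Q (frame_state Q k j) g).
have bf : bmf f.
  apply: bmfM; last exact: bmf_weight.
  apply: bmfX; apply: bmfB; last exact: bmf_cst.
  apply: bmf_sum => i; apply: bmfM; first exact: bmf_cst.
  rewrite /sphere_point; under eq_fun do rewrite tnth_mktuple tnth_rotation_north.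
  by apply: bmfM; [exact: bmf_cst|exact: bmf_ez].
transitivity ((\int[H]_g f g)%:E).
  rewrite /Rintegral fineK; first by apply: eq_integral => g _; rewrite -EFinM.
  by apply: integrable_fin_num => //; exact: bmf_integrable.
congr EFin; rewrite -(haar_int Hinv k bf).
transitivity (\int[H]_g (N.+1%:R * ((r * ez o2 g - mag j) ^+ 2 * trans Q j ord_max g))).
  apply: eq_Rintegral => g _; rewrite /f dot_sphere_pointM.
  rewrite -[density _]/(col j (frame Q k) *m (col j (frame Q k))^t*) overlap_frame.
  by rewrite mulrCA.
rewrite bintZ; last first.
  apply: bmfM; last exact: bmf_trans.
  by apply: bmfX; apply: bmfB; [apply: bmfM; [exact: bmf_cst|exact: bmf_ez]|exact: bmf_cst].
by rewrite int_err_row // mulrC divfK // pnatr_eq0.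
Qed.

End Coherent.

(** * Errors at the optimal radius *)

Section OptimalValues.
Variables (R : realType) (N : nat) (N_gt0 : (0 < N)%N).
Local Notation mag := (magnetic R).
Local Notation X := (spin R N * (spin R N + 1)).

(** With $t^2=2s+3$ the coefficient of $m^2$ is $(t-1)/(t+1)-2t/(t+1)+1=0$ at this radius. *)
Lemma efun_large_spin (F : realFieldType) (t m : F) : 2 < t ->
  let s := (t ^+ 2 - 3) / 2 in
  efun (s * (s + 1)) m s (t * (t - 1) / 2) = (t - 1) ^+ 2 / 4.
Proof.
move=> t2 s.
have a : t ^+ 2 - 4 != 0 by rewrite gt_eqF //; nra.
have b : t ^+ 2 - 3 != 0 by rewrite gt_eqF //; nra.
have c : t ^+ 2 - 1 != 0 by rewrite gt_eqF //; nra.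
have d : t != 0 by rewrite gt_eqF //; lra.
have -> : s * (s + 1) = (t ^+ 2 - 3) * (t ^+ 2 - 1) / 4 by rewrite /s; field.
rewrite /efun.
have -> : 4 * ((t ^+ 2 - 3) * (t ^+ 2 - 1) / 4) - 3 = t ^+ 2 * (t ^+ 2 - 4) by field.
by rewrite /s; field; rewrite a b c d.
Qed.

Lemma efun_optimum (j : 'I_N.+1) (e := efun X (mag j) (mag (@ord_max N)) (r_min R N)) :
  e <= Delta_min_sq R N /\ (N <> 2%N -> e = Delta_min_sq R N).
Proof.
rewrite /e magnetic_max.
have [N1|N1] := eqVneq N 1%N.
  have s1 : spin R N = 1 / 2 by rewrite /spin N1.
  have m1 : mag j ^+ 2 = 1 / 4.
    rewrite /magnetic s1; have := ltn_ord j; rewrite {2}N1.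
    by case: (j : nat) => [|[|//]] _; field.
  have -> : r_min R N = 1 / 2 by rewrite /r_min N1.
  have -> : Delta_min_sq R N = 1 / 6 by rewrite /Delta_min_sq N1.
  rewrite s1 /efun m1.
  have E (a : R) : a = 1 / 6 -> a <= 1 / 6 /\ (N <> 2%N -> a = 1 / 6) by move=> ->.
  apply: E; have -> : 4 * (1 / 2 * (1 / 2 + 1)) - 3 = 0 :> R by field.
  by rewrite mulr0 invr0 mulr0; field.
have [N2|N2] := eqVneq N 2%N.
  have s1 : spin R N = 1 by rewrite /spin N2 divff.
  have m1 : mag j ^+ 2 <= 1 by have := magnetic_sqr_le R j; rewrite s1 expr1n.
  split; last by [].
  have -> : r_min R N = 5 / 4 by rewrite /r_min N2.
  have -> : Delta_min_sq R N = 3 / 8 by rewrite /Delta_min_sq N2.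
  rewrite s1 /efun.
  move: (mag j ^+ 2) m1 => q m1.
  have -> : (4 * (1 * (1 + 1)) - 3 : R) = 5 by ring.
  (* At spin 1 the error is $5/16+m^2/16$: it reaches $3/8$ at $m=\pm1$ but not at $m=0$. *)
  apply: (@le_trans _ _ (5 / 16 + q / 16)); last by lra.
  by rewrite le_eqVlt; apply/orP; left; apply/eqP; field.
have N3 : (3 <= N)%N by case: (N) N_gt0 N1 N2 => [|[|[|]]].
have sN : 3 / 2 <= spin R N.
  by rewrite /spin ler_pM2r ?invr_gt0 // ler_nat.
have p0 : 0 <= 2 * spin R N + 3 by lra.
rewrite /r_min /Delta_min_sq (negPf N1) (negPf N2).
have := sqr_sqrtr p0; have := sqrtr_ge0 (2 * spin R N + 3); set t := Num.sqrt _ => t0 tE.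
have t2 : 2 < t by nra.
have sE : spin R N = (t ^+ 2 - 3) / 2 by rewrite tE; field.
rewrite !sE.
have -> : (2 * ((t ^+ 2 - 3) / 2) - t + 3) / 2 = t * (t - 1) / 2 by field.
have -> : ((t ^+ 2 - 3) / 2 - t + 2) / 2 = (t - 1) ^+ 2 / 4 by field.
by rewrite efun_large_spin.
Qed.

Lemma poweR_half_Delta : ((Delta_min_sq R N)%:E `^ 2^-1 = (Delta_min R N)%:E)%E.
Proof. by rewrite poweR12_sqrt // lee_fin Delta_min_sq_ge0. Qed.

Lemma poweR_half_le (x : \bar R) (B : R) : (0 <= x)%E -> (x `^ 2^-1 <= B%:E)%E ->
  (x <= (B ^+ 2)%:E)%E.
Proof.
case: x => [x| |] // x0; rewrite poweR12_sqrt //= lee_fin => h; rewrite lee_fin.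
rewrite -(sqr_sqrtr (x0 : 0 <= x)) lerXn2r // nnegrE ?sqrtr_ge0 //.
exact: le_trans (sqrtr_ge0 _) h.
Qed.

End OptimalValues.

(** * The metric error of the optimal observable *)

Lemma mulmx_diag_entry (K : numClosedFieldType) n (A B : 'M[K]_n) j :
  (forall i j, i != j -> B i j = 0) -> (A *m B) j j = A j j * B j j.
Proof.
by move=> dB; rewrite mxE (bigD1 j) //= big1 ?addr0 // => i ij; rewrite dB // mulr0.
Qed.

Lemma sandwich_entry0 (K : numClosedFieldType) n (W u a : 'M[K]_n) (c : K) i j :
  W^t* *m W = 1%:M -> u^t* *m u = 1%:M -> a i j = 0 ->
  ((W *m u)^t* *m (c *: (W *m (u *m a *m u^t*) *m W^t*)) *m (W *m u)) i j = 0.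
Proof.
move=> hW hu a0.
rewrite -scalemxAr -scalemxAl trmx_mul map_mxM !mulmxA -(mulmxA _ (W^t*) W) hW mulmx1.
rewrite -(mulmxA (u^t*)) hW mulmx1 hu mul1mx -(mulmxA a) hu mulmx1.
by rewrite mxE a0 mulr0.
Qed.

Section UpperBound.
Variables (R : realType) (N : nat) (Q : spin_system R N).
Variables (H : probability (SU2 R) R) (Hinv : haar_measure H) (N_gt0 : (0 < N)%N).
Local Notation C := R[i].
Local Notation M := 'M[C]_N.+1.
Local Notation T := (SU2 R).
Local Notation mag := (magnetic R).
Local Notation K := (ketmx Q).
Local Notation Es := (delta_mx ord_max ord_max : M).
Local Notation FO := (@coherent_observable R N Q H Hinv (r_min R N)).
Local Notation FO_ r := (@coherent_observable R N Q H Hinv r).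

(** Effects of the marginal along [axis k] depend only on the angle to that axis, so by
    [avg_zonal_diag] they are diagonal in the frame [k]. *)
Lemma coherent_zonal_diag r k S i j : measurable S -> i != j ->
  in_frame Q k (FO_ r (dot (axis k) @^-1` S)) i j = 0.
Proof.
move=> mS ij; have mS' := preimage_measurable (measurable_dot (axis k)) mS.
rewrite /in_frame /= /coherent_povm asboolT //.
pose p (e : R) : R := \1_S (r * e).
have hp : bmf (fun g : T => p (ez o2 g)).
  rewrite /p (_ : (fun g => _) = \1_((fun g : T => r * ez o2 g) @^-1` S)).
    apply: bmf_indic; apply: preimage_measurable => //.
    by apply: measurable_funM => //; exact: (@bmf_ez R o2).1.
  by apply/funext => g; rewrite !indicE; congr (_%:R).
have h := avg_conj Q Hinv Es k hp.
have e : avg Q H Es (fun g => p (ez o2 (su2_mul (su2_inv k) g))) =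
    avg Q H Es (fun g => \1_(dot (axis k) @^-1` S) (sphere_point r g)).
  apply: (congr1 (avg Q H Es)); apply/funext => g.
  have key : dot (axis k) (sphere_point r g) = r * ez o2 (su2_mul (su2_inv k) g).
    by rewrite -(dot_sphere_pointM r k) su2_mulVK.
  by rewrite /p -key !indicE; congr (_%:R).
rewrite -e -h frame_ket; have d := avg_zonal_diag Q Hinv Es hp ij.
exact: sandwich_entry0 (ketmx_tCK Q) (U_tCK Q k) d.
Qed.

Lemma trace_in_frame_diag k (rho A : M) : psd rho ->
  (forall i j, i != j -> in_frame Q k A i j = 0) ->
  complex.Re (\tr (rho *m A)) =
  \sum_j complex.Re (in_frame Q k rho j j) * complex.Re (in_frame Q k A j j).
Proof.
move=> prho dA.
have -> : \tr (rho *m A) = \tr (in_frame Q k rho *m in_frame Q k A).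
  rewrite /in_frame; move: (frameU Q k); move: (frame Q k) => W hW.
  by rewrite [in RHS]mxtrace_mulC !mulmxA mxtrace_mulC !mulmxA hW mul1mx -(mulmxA A) hW mulmx1 mxtrace_mulC.
have pr : psd (in_frame Q k rho) := psd_conj (frame Q k) prho.
rewrite /mxtrace (raddf_sum (@complex.Re R : {additive _ -> _})); apply: eq_bigr => j _.
apply: etrans (congr1 (@complex.Re R) (mulmx_diag_entry (in_frame Q k rho) j dA)) _.
have : 0 <= in_frame Q k rho j j by rewrite -(delta_sesq (in_frame Q k rho)); exact: pr.2.
rewrite lecE => /andP[/eqP im _]; move: im.
by case: (in_frame Q k rho j j) (in_frame Q k A j j) => [a b] [c d] /= ->; rewrite mul0r subr0.
Qed.

(** Marginal and spectral measure are both diagonal in the frame [k]. In any state their outputs are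
    thus mixtures, weighted by the diagonal of the state, of the outputs in eigenstates, and
    [D2_mixture_le] reduces the metric error to calibration errors. *)
Lemma metric_error_coherent k :
  (metric_error (marginal FO (axis k)) (spectral_measure (vdot (axis k) (angmom Q)))
   <= (Delta_min R N)%:E)%E.
Proof.
apply: ge_ereal_sup => _ [rho _ <-]; rewrite -poweR_half_Delta.
have w0 j : 0 <= complex.Re (in_frame Q k rho j j).
  by rewrite -qf_frame; apply: qf_ge0; exact: density_psd.
have w1 : \sum_j (NngNum (w0 j))%:num = 1.
  transitivity (complex.Re (\tr (in_frame Q k rho))).
    by rewrite /mxtrace (raddf_sum (@complex.Re R : {additive _ -> _})).
  by rewrite /in_frame mxtrace_mulC mulmxA (frameU Q k) mul1mx density_tr.
apply: (D2_mixture_le (w := fun j => NngNum (w0 j)) (m := fun j => mag j)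
  (P := fun j => outdist (marginal FO (axis k)) (frame_state Q k j)) w1) => //.
- exact: Delta_min_sq_ge0.
- move=> S mS; transitivity ((complex.Re (\tr (rho *m FO (dot (axis k) @^-1` S))))%:E) => //.
  rewrite (trace_in_frame_diag (density_psd rho) (fun i j => coherent_zonal_diag (r_min R N) k mS)) -sumEFin.
  apply: eq_bigr => j _; rewrite EFinM; apply: (congr1 (mule _)).
  rewrite -qf_frame; apply: esym; exact: outfun_pure.
- move=> S mS; transitivity ((complex.Re (\tr (rho *m spectral_projection (vdot (axis k) (angmom Q)) S)))%:E) => //.
  have e : in_frame Q k (spectral_projection (vdot (axis k) (angmom Q)) S) =
      diag_mx (\row_j (\1_S (mag j))%:C).
    by rewrite /in_frame spectral_axis (unsandwich _ (frameUC Q k)).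
  rewrite (@trace_in_frame_diag k) ?e -?sumEFin; last first.
  - by move=> i j ij; rewrite mxE (negPf ij).
  - exact: density_psd.
  apply: eq_bigr => j _.
  have -> : diag_mx (\row_j0 (\1_S (mag j0))%:C) j j = (\1_S (mag j))%:C :> C.
    by rewrite mxE eqxx mulr1n mxE.
  by rewrite EFinM.
- move=> j; apply: (@le_trans _ _ (cal Q FO k j)); last first.
    by rewrite cal_coherent // lee_fin; exact: (efun_optimum R N_gt0 j).1.
  rewrite /cal (@msd_pushforward _ _ _ (outdist FO (frame_state Q k j)) _ _ _ (dot (axis k))) //.
  + exact: measurable_dot.
  + exact: measurable_subr.
Qed.

Lemma D_max_coherent : (D_max Q FO <= (Delta_min R N)%:E)%E.
Proof.
apply: ge_ereal_sup => _ [e e1 <-]; have [k <-] := rotation_transitive e1.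
exact: metric_error_coherent.
Qed.

Lemma calibration_moment_coherent j :
  calibration_moment Q FO j = (efun (spin R N * (spin R N + 1)) (mag j) (mag (@ord_max N)) (r_min R N))%:E.
Proof.
rewrite -(cal_coherent Q Hinv N_gt0 (r_min R N) (su2_one R) j) /cal /msd /calibration_moment.
rewrite /axis rotation1; apply: eq_measure_integral => A mA _.
transitivity (vecfun FO (ket Q j) A); first exact: outfun_pure.
rewrite -[RHS]/(outfun FO (frame_state Q (su2_one R) j) A) outfun_pure; congr (vecfun _ _ _).
by rewrite frame_ket U1 mulmx1 col_ketmx.
Qed.

End UpperBound.

(** * Bounds for arbitrary observables and uniqueness of the optimum *)

Lemma bint_EFin d (T : measurableType d) (R : realType) (P : probability T R) (f : T -> R) :
  bmf f -> (\int[P]_x (f x)%:E)%E = (\int[P]_x f x)%:E.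
Proof.
by move=> hf; rewrite /Rintegral fineK //; apply: integrable_fin_num => //; exact: bmf_integrable.
Qed.

Section Bounds.
Variables (R : realType) (N : nat) (Q : spin_system R N).
Variables (H : probability (SU2 R) R) (Hinv : haar_measure H) (N_gt0 : (0 < N)%N).
Local Notation C := R[i].
Local Notation M := 'M[C]_N.+1.
Local Notation T := (SU2 R).
Local Notation X3 := (3.-tuple R).
Implicit Types F : observable R N.+1 X3.
Local Notation mu F := (outdist F (mixed R N)).

Lemma Delta_max_ge F : ((Delta_min R N)%:E <= Delta_max Q F)%E.
Proof.
have [D [pD tD dD]] := operator_density (fun S _ => outdist_mixed F S).
have h k j := cal_le_Delta_max Q F k j.
case E : (Delta_max Q F) h => [B| |] h.
- have hc k j : (cal Q F k j <= (B ^+ 2)%:E)%E by apply: poweR_half_le => //; exact: msd_ge0.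
  have [le _] := error_lower_bound Hinv N_gt0 pD tD dD hc.
  have B0 : 0 <= B by rewrite -lee_fin; apply: le_trans (h (su2_one R) ord_max); exact: poweR_ge0.
  by rewrite lee_fin -(ger0_norm B0) -sqrtr_sqr ler_wsqrtr.
- exact: leey.
- have := h (su2_one R) ord_max.
  by move=> /(le_trans (poweR_ge0 _ _)); rewrite leNgt ltNy0.
Qed.

Lemma optimal_density F : Delta_max Q F = (Delta_min R N)%:E ->
  exists D : X3 -> M, [/\ forall x, psd (D x),
    forall v, has_density (mu F) (fun S => qf v (F S)) (fun x => qf v (D x)) &
    \forall x \ae mu F, on_optimal_sphere Q D x].
Proof.
move=> E; have [D [pD tD dD]] := operator_density (fun S _ => outdist_mixed F S).
exists D; split=> //.
have hc k j : (cal Q F k j <= (Delta_min_sq R N)%:E)%E.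
  have := cal_le_Delta_max Q F k j; rewrite E => /poweR_half_le.
  by rewrite /Delta_min sqr_sqrtr ?Delta_min_sq_ge0 //; apply; exact: msd_ge0.
by have [_] := error_lower_bound Hinv N_gt0 pD tD dD hc; apply.
Qed.

Lemma on_sphere_unique (D D' : X3 -> M) x :
  on_optimal_sphere Q D x -> on_optimal_sphere Q D' x -> D x = D' x.
Proof.
move=> [[k xE] h] [_ h']; have e : in_frame Q k (D x) = in_frame Q k (D' x).
  by rewrite [LHS](h k xE) [RHS](h' k xE).
move: e (frameU Q k); rewrite /in_frame; move: (frame Q k) (D x) (D' x) => W A B e hW.
have h2 Z : Z = W *m (W^t* *m Z *m W) *m W^t*.
  by rewrite !mulmxA hW mul1mx -mulmxA hW mulmx1.
by rewrite (h2 A) e -h2.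
Qed.

Lemma covariant_trace F g S : covariant Q F -> measurable S ->
  mu F (rotation g @^-1` S) = mu F S.
Proof.
move=> cF mS.
have e : \tr (F (rotation g @^-1` S)) = \tr (F S).
  have hr : (rep Q g)^t* *m rep Q g = 1%:M.
    by apply: mulmx1C; exact/unitarymxP/rep_unitary.
  by rewrite -(cF g S mS) mxtrace_mulC mulmxA hr mul1mx.
rewrite -[LHS]/((complex.Re (\tr (mixed R N *m F (rotation g @^-1` S))))%:E).
rewrite -[RHS]/((complex.Re (\tr (mixed R N *m F S)))%:E).
by rewrite /= !mul_scalar_mx !mxtraceZ e.
Qed.

(** The uniform law on the sphere of radius [r_min]. It is written with the inverse because
    replacing $g$ by $kg$ then cancels a rotation [k] of the point, so left invariance is enough. *)
Definition invariant_law (S : set X3) : \bar R :=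
  (\int[H]_g (\1_S (scale3 (r_min R N) (rotation (su2_inv g) (north R))))%:E)%E.

Lemma measurable_inv_rotation :
  measurable_fun setT (fun z : T * X3 => rotation (su2_inv z.1) z.2).
Proof.
apply/measurable_fun_tnthP => j.
rewrite (_ : _ \o _ = fun z : T * X3 => \sum_k rotation_mx z.1 k j * tnth z.2 k); last first.
  apply/funext => z; rewrite /= tnth_rotation; apply: eq_bigr => k _.
  by rewrite rotation_mxV mxE.
apply: measurable_sum => k; apply: measurable_funM.
  have [mf _] := @bmf_rotation R k j.
  exact: (measurableT_comp mf (@measurable_fst _ _ T X3)).
exact: (measurableT_comp (measurable_tnth k) (@measurable_snd _ _ T X3)).
Qed.

Lemma su2_invM (g h : su2 R) : su2_inv (su2_mul g h) = su2_mul (su2_inv h) (su2_inv g).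
Proof. by apply: su2_inj; rewrite /= trC_mul. Qed.

(** Rotation invariance lets the law of [S] be averaged over the group; after Tonelli, the inner
    integral is the same constant at every point of the sphere. *)
Lemma covariant_law F S : covariant Q F ->
  (\forall x \ae mu F, exists k, x = scale3 (r_min R N) (axis k)) ->
  measurable S -> mu F S = invariant_law S.
Proof.
move=> cF sF mS.
pose f (z : T * X3) : \bar R := (\1_S (rotation (su2_inv z.1) z.2))%:E.
have mf : measurable_fun setT f.
  apply/measurable_EFinP; apply: (measurableT_comp _ measurable_inv_rotation).
  exact: measurable_indic.
have f0 z : (0 <= f z)%E by rewrite lee_fin.
have e1 g : (\int[mu F]_x f (g, x))%E = mu F S.
  have mS' := preimage_measurable (@measurable_rotation R (su2_inv g)) mS.
  rewrite -(covariant_trace (su2_inv g) cF mS).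
  transitivity (\int[mu F]_x (\1_(rotation (su2_inv g) @^-1` S) x)%:E)%E.
    by apply: eq_integral => x _; rewrite /f !indicE; congr (_%:R%:E).
  by rewrite integral_indic // setIT.
transitivity (\int[H]_g \int[mu F]_x f (g, x))%E.
  under eq_integral do rewrite e1.
  rewrite integral_cst //; have h1 : H setT = 1%E := probability_setT H.
  by apply/esym; exact: etrans (congr1 (mule (mu F S)) h1) (mule1 _).
rewrite (fubini_tonelli f mf f0).
transitivity (\int[mu F]_x (cst (invariant_law S) x))%E; last first.
  rewrite integral_cst //; have h1 : mu F setT = 1%E := probability_setT (mu F).
  exact: etrans (congr1 (mule (invariant_law S)) h1) (mule1 _).
apply: ae_eq_integral => //.
  exact: (measurable_fun_fubini_tonelli_G f mf f0).
apply: filterS sF => _ [k ->] _; rewrite /cst /invariant_law.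
have bf : bmf (fun g : T => \1_S (rotation (su2_inv g) (scale3 (r_min R N) (axis k))) : R).
  split; last by exists 1 => g; rewrite indicE; case: (_ \in _); rewrite ?normr1 ?normr0.
  apply/measurable_EFinP; exact: (measurableT_comp mf (pair2_measurable (scale3 (r_min R N) (axis k)))).
have key g : rotation (su2_inv (su2_mul k g)) (scale3 (r_min R N) (axis k)) =
    scale3 (r_min R N) (rotation (su2_inv g) (north R)).
  rewrite su2_invM rotationM (rotation_scale3 (su2_inv k) (r_min R N) (axis k)).
  by rewrite (rotationK k (north R)) (rotation_scale3 (su2_inv g) (r_min R N) (north R)).
have hh := haar_int Hinv k bf.
have bf' : bmf (fun g : T => \1_S (scale3 (r_min R N) (rotation (su2_inv g) (north R))) : R).
  have [m1 [B m2]] := bf; split.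
    have := measurableT_comp m1 (measurable_su2_mul k).
    by apply: eq_measurable_fun => g _ /=; rewrite key.
  by exists 1 => g; rewrite indicE; case: (_ \in _); rewrite ?normr1 ?normr0.
rewrite (bint_EFin H bf) (bint_EFin H bf') -hh; congr (_%:E).
by apply: eq_Rintegral => g _; rewrite key.
Qed.

(** Both observables have the same outcome law in the mixed state, and by the equality case their
    densities agree almost everywhere on the sphere; all quadratic forms, hence all effects,
    coincide. *)
Lemma optimal_unique F G : covariant Q F -> covariant Q G ->
  Delta_max Q F = (Delta_min R N)%:E -> Delta_max Q G = (Delta_min R N)%:E ->
  observable_eq F G.
Proof.
move=> cF cG oF oG.
have [D [pD dD sD]] := optimal_density oF; have [D' [pD' dD' sD']] := optimal_density oG.
have lF : \forall x \ae mu F, exists k, x = scale3 (r_min R N) (axis k).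
  by apply: filterS sD => x [].
have lG : \forall x \ae mu G, exists k, x = scale3 (r_min R N) (axis k).
  by apply: filterS sD' => x [].
have eqmu S : measurable S -> mu F S = mu G S.
  by move=> mS; rewrite (covariant_law cF lF mS) (covariant_law cG lG mS).
(* The equality case for [F] holds almost everywhere for its own law, and is transferred to the law
   of [G], which has the same null sets. *)
have sDG : \forall x \ae mu G, on_optimal_sphere Q D x.
  have [B [mB B0 sB]] := sD; exists B; split=> //.
  by apply: etrans (esym (eqmu B mB)) B0.
have eqD : \forall x \ae mu G, D x = D' x.
  by apply: filterS (filterI sDG sD') => x [h h']; exact: on_sphere_unique h h'.
move=> S mS.
have eqq v : qf v (F S) = qf v (G S).
  apply: EFin_inj; rewrite (has_densityE (dD v) mS) (has_densityE (dD' v) mS).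
  have mq := has_density_measurable (dD v); have mq' := has_density_measurable (dD' v).
  transitivity (\int[mu G]_(x in S) (qf v (D x))%:E)%E.
    by apply: eq_measure_integral => A mA _; exact: eqmu.
  apply: ae_eq_integral => //; try exact/measurable_EFinP/measurable_funTS.
  by apply: filterS eqD => x ->.
have [hF _] := povm_psd F S; have [hG _] := povm_psd G S.
apply/matrixP => i j; apply: complex_eq.
  by rewrite (Re_polar i j hF) (Re_polar i j hG) !eqq.
by rewrite (Im_polar i j hF) (Im_polar i j hG) !eqq.
Qed.

(** The chain $\Delta_{\min}\le\Delta_{\max}\le D_{\max}$ collapses, so optimality for the metric
    error implies optimality for calibration. *)
Lemma Delta_max_optimal F : (D_max Q F <= (Delta_min R N)%:E)%E ->
  D_max Q F = (Delta_min R N)%:E /\ Delta_max Q F = (Delta_min R N)%:E.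
Proof.
move=> h; have h1 := Delta_max_ge F; have h2 := Delta_max_le_D_max Q F.
by split; apply/eqP; rewrite eq_le; apply/andP; split=> //; [exact: le_trans h1 h2|exact: le_trans h2 h].
Qed.

End Bounds.

Theorem theorem12 (R : realType) (N : nat) (Q : spin_system R N)
    (haar : probability (SU2 R) R) (N_gt0 : (0 < N)%N)
    (haar_inv : haar_measure haar) :
  (forall F : observable R N.+1 (3.-tuple R),
     ((Delta_min R N)%:E <= D_max Q F)%E /\
     ((Delta_min R N)%:E <= Delta_max Q F)%E) /\
  (exists F0 : observable R N.+1 (3.-tuple R),
     covariant Q F0 /\
     point_covariant Q haar F0 ord_max (r_min R N) /\
     D_max Q F0 = (Delta_min R N)%:E /\
     Delta_max Q F0 = (Delta_min R N)%:E /\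
     (forall G : observable R N.+1 (3.-tuple R), covariant Q G ->
        D_max Q G = (Delta_min R N)%:E -> observable_eq G F0) /\
     (forall G : observable R N.+1 (3.-tuple R), covariant Q G ->
        Delta_max Q G = (Delta_min R N)%:E -> observable_eq G F0) /\
     (N <> 2%N -> forall j k : 'I_N.+1,
        calibration_moment Q F0 j = calibration_moment Q F0 k)).
Proof.
split=> [F|].
  have h := Delta_max_ge Q haar_inv N_gt0 F; split=> //.
  exact: le_trans h (Delta_max_le_D_max Q F).
pose F0 := coherent_observable Q haar_inv (r_min R N).
have cF0 : covariant Q F0 := coherent_covariant Q haar_inv (r_min R N).
have [dF0 oF0] := Delta_max_optimal haar_inv N_gt0 (D_max_coherent Q haar_inv N_gt0).
exists F0; split; first exact: cF0.
split; first exact: (coherent_point Q haar_inv (r_min R N)).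
split; first exact: dF0.
split; first exact: oF0.
split=> [G cG dG|].
  have le : (D_max Q G <= (Delta_min R N)%:E)%E by rewrite dG.
  have [_ oG] := Delta_max_optimal haar_inv N_gt0 le.
  exact: (optimal_unique haar_inv N_gt0 cG cF0 oG oF0).
split=> [G cG oG|N2 j k].
  exact: (optimal_unique haar_inv N_gt0 cG cF0 oG oF0).
apply: etrans (calibration_moment_coherent Q haar_inv N_gt0 j) _.
apply: etrans _ (esym (calibration_moment_coherent Q haar_inv N_gt0 k)).
by rewrite (efun_optimum R N_gt0 j).2 // (efun_optimum R N_gt0 k).2.
Qed.
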